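(* Let $A>1$ and $\alpha>0$ be real numbers, and let $x(n)\in[0,1)$ be the fractional part of $\alpha(\log n)^A$ for $n\ge 1$. Then the sequence $(x(n))_{n\ge1}$ has Poissonian gap distribution: for every $s>0$, $$\lim_{N\to\infty}\frac{\#\{n\le N:\ N\,\|u_N(n)-u_N(n+1)\|<s\}}{N}=1-e^{-s}.$$
   Context: For each $N\ge1$, $u_N(1)\le u_N(2)\le\dots\le u_N(N)$ denotes the increasing reordering (with multiplicity) of the first $N$ terms $x(1),\dots,x(N)$, and $u_N(N+1):=u_N(1)$. $\|y\|$ denotes the distance from the real number $y$ to the nearest integer. *)

(* Defs.v *)
From mathcomp Require Import all_boot all_order all_algebra.
From mathcomp Require Import all_classical all_reals all_analysis.
Set Implicit Arguments.
Unset Strict Implicit.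
Unset Printing Implicit Defensive.
Import Order.TTheory GRing.Theory Num.Theory.
Import numFieldNormedType.Exports.
Local Open Scope classical_set_scope.
Local Open Scope ring_scope.

Definition frac_part (R : realType) (y : R) : R := y - (Num.floor y)%:~R.

Definition dist_int (R : realType) (y : R) : R :=
  inf [set `|y - m%:~R| | m in [set: int]].

Definition log_pow_seq (R : realType) (alpha A : R) (n : nat) : R :=
  frac_part (alpha * (ln n%:R) `^ A).

(* Only the terms x 1, ..., x N are used; x 0 plays no role. *)
Definition sorted_terms (R : realType) (x : nat -> R) (N : nat) : seq R :=
  sort <=%R [seq x n | n <- iota 1 N].

(* u_N(n) with 1-based n, for 1 <= n <= N, and u_N(N + 1) := u_N(1); other
   values of n are junk. *)
Definition ordered_term (R : realType) (x : nat -> R) (N n : nat) : R :=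
  nth 0 (sorted_terms x N) (if n == N.+1 then 0%N else n.-1).

Definition gap_count (R : realType) (x : nat -> R) (N : nat) (s : R) : nat :=
  count (fun n => N%:R * dist_int (ordered_term x N n - ordered_term x N n.+1)
                  < s)
        (iota 1 N).

Definition poissonian_gaps (R : realType) (x : nat -> R) : Prop :=
  forall s : R, 0 < s ->
    (fun N : nat => (gap_count x N s)%:R / N%:R : R) @ \oo --> 1 - expR (- s).

(* Main.v *)
(** Let f(n) = alpha (ln n)^A and let g be its inverse.  For a grid of points t
    in [0, 1), the number of n <= N with frac (f n) in [t, t + s/N) is the number
    of k ("turns") such that [g (k + t), g (k + t + s/N)) contains an integer.
    About (ln N)^A turns matter and each of these events is rare, so it is enough
    that any fixed number of them are independent up to every power of 1 / ln N;
    Bonferroni's inequalities then give probability exp (-s) to an empty window.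
    Independence follows from Fejer kernels and exponential sums with phase
    F(t) = sum_i h_i g(k_i + t).  Since g is smooth with log-derivative of size
    (ln N)^(1-A), the derivatives F', ..., F^(m) cannot all be small: after
    rescaling, their coefficients form a perturbation of a Vandermonde matrix.
    Van der Corput's argument therefore saves an arbitrary power of ln N.
    Finally, as a function of s the probability of an empty window is, up to a
    factor, an integral of the proportion of gaps longer than s/N, and difference
    quotients recover this proportion. *)

(* Everything rests on a gap of scales. The phase has size about N, whereas the number of turns, the
   frequencies and the separation of the k_i cost only powers of ln N; so even very lossy bounds
   (Van der Corput, Bonferroni, Fejer expansion) are affordable. The hypothesis A > 1 enters as beta
   = 1/A < 1. For beta = 1 the inverse g would be a pure exponential: all derivatives of F would be
   proportional to one constant, which can be tiny. For beta < 1 the numbers (beta - 1) j are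
   distinct, and this is what keeps the derivatives independent. Two reductions shape the
   statements. Turns below f (N / ln N) are dropped: this loses a proportion about 1 / ln N of the
   integers and leaves all k_i within a factor 1 + eta of each other, the regime in which the
   perturbation argument works. And the true interval [g (k + t), g (k + t + s/N)) has a length that
   varies with t, while independence is proved for fixed lengths; it is therefore bracketed between
   intervals of fixed length whose ratio is close to 1. The grid has N^2 points, fine enough against
   both the windows, of size 1/N, and the derivative of the phase. *)
Require Import Defs.
From mathcomp Require Import all_boot all_order all_algebra.
From mathcomp Require Import all_classical all_reals all_analysis.
From mathcomp Require Import ring lra zify.
From mathcomp Require Import complex.
Set Implicit Arguments.
Unset Strict Implicit.
Unset Printing Implicit Defensive.
Import Order.TTheory GRing.Theory Num.Theory.
Import numFieldNormedType.Exports.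
Local Open Scope classical_set_scope.
Local Open Scope ring_scope.

(** * Iterated Rolle theorem *)

Section Calculus.
Context {R : realType}.
Implicit Types (f df W : R -> R) (F : nat -> R -> R) (a b x : R).

Lemma is_derive_within_continuous f df a b :
  (forall x, a <= x <= b -> is_derive x 1 f (df x)) ->
  {within `[a, b], continuous f}.
Proof.
move=> h; apply: derivable_within_continuous => x; rewrite in_itv/= => xab.
by have := h x xab.
Qed.

Lemma MVT_le f df a b : a <= b ->
  (forall x, a <= x <= b -> is_derive x 1 f (df x)) ->
  exists2 c, a <= c <= b & f b - f a = df c * (b - a).
Proof.
move=> ab h.
have [|c] := @MVT_segment R f df a b ab _ (is_derive_within_continuous h).
  by move=> x; rewrite in_itv/= => /andP[ax xb]; apply: h; rewrite !ltW.
by rewrite in_itv/= => cab e; exists c.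
Qed.

Lemma MVT_bound f df a b C : a <= b ->
  (forall x, a <= x <= b -> is_derive x 1 f (df x)) ->
  (forall x, a <= x <= b -> `|df x| <= C) -> `|f b - f a| <= C * (b - a).
Proof.
move=> ab h hC; have [c cab ->] := MVT_le ab h.
by rewrite normrM (ger0_norm (_ : 0 <= b - a)) ?subr_ge0// ler_wpM2r ?subr_ge0 ?hC.
Qed.

(** Here and below a function comes with its iterated derivatives as a sequence [F], where [F j.+1]
    is the derivative of [F j]. One application of Rolle between consecutive zeros gives [n] zeros
    of [F 1], and the induction shifts the sequence. *)
Lemma Rolle_iter n F (xs : nat -> R) a b :
  (forall j x, a <= x <= b -> is_derive x 1 (F j) (F j.+1 x)) ->
  (forall i, (i <= n)%N -> a <= xs i <= b) ->
  (forall i, (i < n)%N -> xs i < xs i.+1) ->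
  (forall i, (i <= n)%N -> F 0%N (xs i) = 0) ->
  exists2 c, a <= c <= b & F n c = 0.
Proof.
elim: n F xs => [|n IH] F xs hF hab hlt h0.
  by exists (xs 0%N); [exact: hab | exact: h0].
have step i : exists y, (i <= n)%N -> [/\ xs i < y, y < xs i.+1 & F 1%N y = 0].
  have [le|_] := leqP i n; last by exists 0.
  have sub x : xs i <= x <= xs i.+1 -> a <= x <= b.
    have /andP[? _] := hab i (leqW le); have /andP[_ ?] := hab i.+1 le.
    by move=> /andP[? ?]; apply/andP; split; lra.
  have [|||y] := @Rolle R (F 0%N) (xs i) (xs i.+1) (hlt i le).
  - move=> x; rewrite in_itv/= => /andP[? ?].
    have xab : a <= x <= b by apply: sub; rewrite !ltW.
    by have := hF 0%N x xab.
  - by apply: (@is_derive_within_continuous _ (F 1%N)) => x /sub xab; exact: hF.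
  - by rewrite !h0// leqW.
  rewrite in_itv/= => /andP[y1 y2] dy; exists y => _; split=> //.
  have dy' : is_derive y 1 (F 0%N) (F 1%N y) by apply/(hF 0%N)/sub; rewrite !ltW.
  by rewrite -(@derive_val _ _ _ _ _ _ _ dy') (@derive_val _ _ _ _ _ _ _ dy).
have [ys hys] := choice step.
apply: (IH (fun j => F j.+1) ys) => //.
- move=> i le; have [y1 y2 _] := hys i le.
  have /andP[? _] := hab i (leqW le); have /andP[_ ?] := hab i.+1 le.
  by apply/andP; split; lra.
- move=> i lt; have [_ y2 _] := hys i (ltnW lt); have [y3 _ _] := hys i.+1 lt.
  by rewrite (lt_trans y2 y3).
- by move=> i le; have [] := hys i le.
Qed.

Lemma Rolle_iter_seq F (s : seq R) n a b :
  (forall j x, a <= x <= b -> is_derive x 1 (F j) (F j.+1 x)) ->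
  uniq s -> size s = n.+1 -> {in s, forall x, a <= x <= b} ->
  {in s, forall x, F 0%N x = 0} -> exists2 c, a <= c <= b & F n c = 0.
Proof.
move=> hF us ss sab s0; set t := sort <=%R s.
have st : size t = n.+1 by rewrite size_sort.
have tt : sorted <%R t.
  by rewrite lt_sorted_uniq_le sort_uniq us/=; apply: sort_sorted; exact: le_total.
have mt i : (i <= n)%N -> nth 0 t i \in s.
  by move=> le; rewrite -(mem_sort <=%R) mem_nth// st.
apply: (@Rolle_iter n F (nth 0 t)) => // i le.
- exact: sab (mt _ le).
- by apply: (sorted_ltn_nth lt_trans) => //; rewrite ?inE st//; exact: leqW.
- exact: s0 (mt _ le).
Qed.

Lemma derivn_prod_XsubC (s : seq R) :
  (\prod_(x <- s) ('X - x%:P))^`(size s) = (size s)`!%:R%:P.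
Proof.
set p := \prod_(x <- s) _.
have sp : size p = (size s).+1 by rewrite /p size_prod_XsubC.
have mp : p \is monic by exact: monic_prod_XsubC.
rewrite [LHS]size1_polyC.
  rewrite coef_derivn addn0 ffactnn (_ : p`_(size s) = 1)//.
  by move/monicP: mp; rewrite /lead_coef sp.
apply/leq_sizeP => j lej; rewrite coef_derivn nth_default ?mul0rn// sp.
by rewrite -[X in (X <= _)%N]addn1 leq_add2l.
Qed.

(** The error formula of Lagrange interpolation, for a function that vanishes at all the nodes. *)
Lemma interpolation_remainder F (s : seq R) z a b :
  (forall j x, a <= x <= b -> is_derive x 1 (F j) (F j.+1 x)) ->
  uniq s -> {in s, forall x, a <= x <= b} -> {in s, forall x, F 0%N x = 0} ->
  a <= z <= b -> z \notin s ->
  exists2 c, a <= c <= b &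
    F 0%N z = F (size s) c / (size s)`!%:R * \prod_(x <- s) (z - x).
Proof.
move=> hF us sab s0 zab zs.
set P := \prod_(x <- s) ('X - x%:P).
have PE y : P.[y] = \prod_(x <- s) (y - x).
  by rewrite horner_prod; apply: eq_bigr => x _; rewrite !hornerE.
have Pz0 : P.[z] != 0.
  by rewrite PE prodf_seq_neq0; apply/allP => x xs; rewrite subr_eq0;
    apply: contraNneq zs => ->.
(* With this multiple of [P] the difference [G] vanishes at [z] as well as on [s], which is one zero
   more than the degree of [P]. *)
set k := F 0%N z / P.[z].
pose G j y := F j y - k * (P^`(j)).[y].
have [|||||c cab Gc] := @Rolle_iter_seq G (z :: s) (size s) a b.
- move=> j x xab; have := hF j x xab => ?.
  have -> : G j = F j - k \*: horner P^`(j) by [].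
  apply: is_derive_eq; rewrite /G derivnS; by [].
- by rewrite /= zs.
- by [].
- by move=> x; rewrite inE => /predU1P[->//|/sab].
- move=> x; rewrite inE /G derivn0 => /predU1P[->|xs].
    by rewrite /k divfK ?subrr.
  rewrite s0// (_ : P.[x] = 0) ?mulr0 ?subr0//.
  by apply/eqP; rewrite -[_ == 0]/(root P x) root_prod_XsubC.
exists c => //; rewrite -PE.
have f0 : (size s)`!%:R != 0 :> R by rewrite pnatr_eq0 -lt0n fact_gt0.
move: Gc; rewrite /G derivn_prod_XsubC hornerC => /eqP; rewrite subr_eq0 => /eqP ->.
by rewrite mulfK// /k divfK.
Qed.

End Calculus.

(** * Van der Corput's argument *)

Section OscillatoryIntegral.
Context {R : realType}.
Implicit Types (f df W : R -> R) (F : nat -> R -> R) (a b x mu M lam rho : R).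

(** Integrals of cosines are handled as increments [W b - W a] of a primitive, so that the mean
    value theorem replaces integral estimates. *)
Lemma primitive_exists f a b :
  a < b -> {within `[a, b], continuous f} ->
  (forall x, a < x < b -> {for x, continuous f}) ->
  exists W, forall x, a < x < b -> is_derive x 1 W (f x).
Proof.
move=> ab cf cfx.
have fi : (@lebesgue_measure R).-integrable `[a, b] (EFin \o f).
  by apply: continuous_compact_integrable => //; exact: segment_compact.
eexists => x /andP[ax xb].
have [d1 d2] := continuous_FTC1_closed xb fi ax (cfx x (introT andP (conj ax xb))).
by rewrite -d2 derive1E; apply/derivableP; exact: d1.
Qed.

(** Integration by parts: subtracting sin F / F' from the primitive of cos F leaves a function with
    derivative sin F * F'' / F'^2. The bound on F'' replaces the usual monotonicity of F'. *)
Lemma van_der_corput_base F W a b mu M : a <= b -> 0 < mu ->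
  (forall j x, a <= x <= b -> is_derive x 1 (F j) (F j.+1 x)) ->
  (forall x, a <= x <= b -> is_derive x 1 W (cos (F 0%N x))) ->
  (forall x, a <= x <= b -> `|F 2%N x| <= M) ->
  (forall x, a <= x <= b -> mu <= `|F 1%N x|) ->
  `|W b - W a| <= 2 / mu + M / mu ^+ 2 * (b - a).
Proof.
move=> ab mu0 hF hW hM hmu.
have F10 x : a <= x <= b -> F 1%N x != 0.
  by move=> xab; rewrite -normr_gt0 (lt_le_trans mu0) ?hmu.
pose S x := sin (F 0%N x) / F 1%N x.
pose D x := sin (F 0%N x) * F 2%N x / F 1%N x ^+ 2.
have hS x : a <= x <= b -> `|S x| <= mu^-1.
  move=> xab; rewrite /S normrM normfV -[leRHS]mul1r.
  by rewrite ler_pM ?invr_ge0 ?sin_max// lef_pV2 ?posrE ?hmu// normr_gt0 F10.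
have hU : `|(W b - S b) - (W a - S a)| <= M / mu ^+ 2 * (b - a).
  apply: (@MVT_bound _ (W - S) D) => // x xab.
    have d1 := hW x xab; have d2 := hF 0%N x xab; have d3 := hF 1%N x xab.
    have d4 : is_derive x 1 (sin \o F 0%N) (cos (F 0%N x) * F 1%N x).
      exact: is_derive1_comp.
    have d5 := is_deriveV (F10 x xab) d3.
    rewrite -[S]/((sin \o F 0%N) * (fun y => (F 1%N y)^-1)).
    apply: is_derive_eq; rewrite /D /= /GRing.scale/=.
    have n0 := F10 x xab.
    by field.
  rewrite /D normrM normrM normfV normrX.
  have M0 : 0 <= M by apply: le_trans (hM x xab).
  apply: ler_pM; rewrite ?mulr_ge0 ?invr_ge0 ?exprn_ge0//.
    by rewrite -[leRHS]mul1r ler_pM ?sin_max ?hM.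
  by rewrite lef_pV2 ?posrE ?exprn_gt0 ?normr_gt0 ?F10// lerXn2r ?nnegrE ?hmu// ltW.
have Sa : `|S a| <= mu^-1 by apply: hS; rewrite lexx.
have Sb : `|S b| <= mu^-1 by apply: hS; rewrite lexx ab.
have -> : W b - W a = ((W b - S b) - (W a - S a)) + (S b - S a) by ring.
apply: le_trans (ler_normD _ _) _; rewrite [leRHS]addrC lerD//.
by apply: le_trans (ler_normB _ _) _; lra.
Qed.

(** Away from a window of radius [rho] around a minimum of |F_{j+1}| the previous derivative count
    applies with [lam] multiplied by [rho / 2]; the window itself costs [2 * rho]. The recursion B
    -> 2 B + 2 rho is solved by 2^j X - 2 rho, whence the subtracted term. *)
Lemma van_der_corput j F W a b lam rho M :
  a <= b -> b - a <= 1 -> 0 < lam -> 0 < rho ->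
  (forall j x, a <= x <= b -> is_derive x 1 (F j) (F j.+1 x)) ->
  (forall x, a <= x <= b -> is_derive x 1 W (cos (F 0%N x))) ->
  (forall x, a <= x <= b -> `|F 2%N x| <= M) ->
  (forall x, a <= x <= b -> lam <= `|F j.+1 x|) ->
  let mu := lam * (rho / 2) ^+ j in
  `|W b - W a| <= 2 ^+ j * (2 * rho + (2 / mu + M / mu ^+ 2)) - 2 * rho.
Proof.
elim: j a b lam => [|j IH] a b lam ab ab1 lam0 rho0 hF hW hM hlam /=.
  rewrite !expr0 mul1r mulr1.
  have := van_der_corput_base ab lam0 hF hW hM hlam.
  have M0 : 0 <= M by apply: le_trans (hM a _); rewrite ?lexx.
  have : M / lam ^+ 2 * (b - a) <= M / lam ^+ 2.
    by rewrite ler_piMr// divr_ge0 ?exprn_ge0// ltW.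
  lra.
have cF : {within `[a, b], continuous (fun x => `|F j.+1 x|)}.
  have := is_derive_within_continuous (hF j.+1); move=> c x.
  exact: (continuous_comp (c x) (@norm_continuous _ _ _)).
have [c + minc] := EVT_min ab cF; rewrite in_itv/= => cab.
(* As c minimises |F_{j+1}|, |F_{j+1} x - F_{j+1} c| <= 2 |F_{j+1} x|. *)
have low x : a <= x <= b -> lam / 2 * `|x - c| <= `|F j.+1 x|.
  move=> xab.
  have h1 : lam * `|x - c| <= `|F j.+1 x - F j.+1 c|.
    have aux u v : a <= u <= b -> a <= v <= b -> u <= v ->
        lam * (v - u) <= `|F j.+1 v - F j.+1 u|.
      move=> /andP[au ub] /andP[av vb] uv.
      have sub z : u <= z <= v -> a <= z <= b.
        by move=> /andP[? ?]; apply/andP; split; lra.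
      have [|z zuv ->] := @MVT_le R (F j.+1) (F j.+2) u v uv.
        by move=> z /sub zab; exact: hF.
      rewrite normrM (ger0_norm (_ : 0 <= v - u)) ?subr_ge0// ler_wpM2r ?subr_ge0//.
      exact/hlam/sub.
    have [xc|/ltW cx] := leP x c.
      by rewrite distrC (distrC (F j.+1 x)) ger0_norm ?subr_ge0// aux.
    by rewrite ger0_norm ?subr_ge0// aux.
  have h2 : `|F j.+1 c| <= `|F j.+1 x| by apply: minc; rewrite in_itv/=.
  have h3 := ler_normB (F j.+1 x) (F j.+1 c).
  lra.
set mu := lam * _; set X := 2 * rho + _.
have far u v : a <= u -> u <= v -> v <= b ->
    (forall x, u <= x <= v -> rho <= `|x - c|) ->
    `|W v - W u| <= 2 ^+ j * X - 2 * rho.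
  move=> au uv vb hx.
  have sub z : u <= z <= v -> a <= z <= b.
    by move=> /andP[? ?]; apply/andP; split; lra.
  have := IH u v (lam * (rho / 2)) uv _ _ rho0.
  rewrite -mulrA -exprS; apply.
  - by lra.
  - by rewrite mulr_gt0// divr_gt0.
  - by move=> i x /sub; exact: hF.
  - by move=> x /sub; exact: hW.
  - by move=> x /sub; exact: hM.
  move=> x xuv; apply: le_trans (low x (sub x xuv)).
  have := hx x xuv; have -> : lam * (rho / 2) = lam / 2 * rho by ring.
  by move=> ?; rewrite ler_wpM2l// divr_ge0 ?ltW.
have near u v : a <= u -> u <= v -> v <= b -> `|W v - W u| <= v - u.
  move=> au uv vb; rewrite -[leRHS]mul1r.
  have sub z : u <= z <= v -> a <= z <= b.
    by move=> /andP[? ?]; apply/andP; split; lra.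
  by apply: (MVT_bound uv (df := fun x => cos (F 0%N x))) => x /sub xab; [exact: hW|exact: cos_max].
(* Needed when the window sticks out of [a, b] and one of the outer pieces is empty. *)
have X0 : 0 <= 2 ^+ j * X - 2 * rho.
  have M0 : 0 <= M by apply: le_trans (hM a _); rewrite ?lexx.
  have mu0 : 0 < mu by rewrite mulr_gt0// exprn_gt0// divr_gt0.
  have : 0 <= 2 / mu + M / mu ^+ 2.
    by rewrite addr_ge0// divr_ge0// ?exprn_ge0// ltW.
  have : 1 <= 2 ^+ j :> R by rewrite exprn_ege1// ler1n.
  rewrite /X; nra.
move/andP: cab => [ac cb].
(* The window around [c], cut down to [a, b]. *)
pose c1 := Num.max a (c - rho); pose c2 := Num.min b (c + rho).
have e1 : `|W c1 - W a| <= 2 ^+ j * X - 2 * rho.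
  rewrite /c1; case: (leP a (c - rho)) => h; last by rewrite subrr normr0.
  apply: far => //; first by lra.
  by move=> x /andP[_ xc]; rewrite distrC ler_normr; apply/orP; left; lra.
have e2 : `|W b - W c2| <= 2 ^+ j * X - 2 * rho.
  rewrite /c2; case: (leP b (c + rho)) => h; first by rewrite subrr normr0.
  apply: far => //; [by lra|by lra|].
  by move=> x /andP[xc _]; rewrite ler_normr; apply/orP; left; lra.
have e3 : `|W c2 - W c1| <= 2 * rho.
  have e : c1 <= c2 /\ c2 - c1 <= 2 * rho.
    rewrite /c1 /c2; case: (leP a (c - rho)) => h; case: (leP b (c + rho)) => h'; lra.
  apply: le_trans (near c1 c2 _ e.1 _) e.2.
    by rewrite /c1 le_max lexx.
  by rewrite /c2 ge_min lexx.
have -> : W b - W a = (W b - W c2) + (W c2 - W c1) + (W c1 - W a) by ring.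
apply: le_trans (ler_normD _ _) _.
have := ler_normD (W b - W c2) (W c2 - W c1).
rewrite exprS; lra.
Qed.

(** The derivative that is large may change from point to point. On each of [Q] equal pieces the
    bound [M] on the next derivative keeps one fixed derivative above [lam / 2], so Van der Corput's
    bound applies piece by piece. The sum over the grid is a Riemann sum, at distance [M / P] from
    the integral. *)
Lemma exponential_sum_bound m F (Q P : nat) M lam rho :
  (0 < Q)%N -> (0 < P)%N -> 0 < lam -> 0 < rho <= 1 -> M / Q%:R <= lam / 2 ->
  (forall j x, -1 <= x <= 2 -> is_derive x 1 (F j) (F j.+1 x)) ->
  (forall j x, (0 < j <= m.+1)%N -> 0 <= x <= 1 -> `|F j x| <= M) ->
  (forall x, 0 <= x <= 1 -> exists2 j, (0 < j <= m)%N & lam <= `|F j x|) ->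
  let mu := lam / 2 * (rho / 2) ^+ m in
  `|(\sum_(0 <= p < P) cos (F 0%N (p%:R / P%:R))) / P%:R| <=
    M / P%:R + Q%:R * (2 ^+ m * (2 * rho + (2 / mu + M / mu ^+ 2))).
Proof.
move=> Q0 P0 lam0 /andP[rho0 rho1] hQ hF hM hlam /=; set mu := lam / 2 * (rho / 2) ^+ m.
have mpos : (0 < m)%N.
  have [|j /andP[j0 jm] _] := hlam 0; first by rewrite lexx ler01.
  exact: leq_trans j0 jm.
have cosd x : -1 <= x <= 2 ->
    is_derive x 1 (cos \o F 0%N) (- sin (F 0%N x) * F 1%N x).
  by move=> xab; have := hF 0%N x xab => d; exact: is_derive1_comp.
(* The larger interval [-1, 2] makes the primitive differentiable on both sides at 0 and 1. *)
have [|||W hW] := @primitive_exists (cos \o F 0%N) (-1) 2.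
- by lra.
- exact: is_derive_within_continuous cosd.
- move=> x /andP[x1 x2].
  have [|/derivable1_diffP/differentiable_continuous] := cosd x; last by [].
  by rewrite !ltW.
have {}hW x : 0 <= x <= 1 -> is_derive x 1 W (cos (F 0%N x)).
  by move=> /andP[? ?]; apply: hW; apply/andP; split; lra.
have hF' j x : 0 <= x <= 1 -> is_derive x 1 (F j) (F j.+1 x).
  by move=> /andP[? ?]; apply: hF; apply/andP; split; lra.
have M0 : 0 <= M by apply: le_trans (hM 1%N 0 _ _); rewrite ?lexx ?ler01.
have Pp : 0 < P%:R :> R by rewrite ltr0n.
have Qp : 0 < Q%:R :> R by rewrite ltr0n.
have grid (n p : nat) : (0 < n)%N -> (p < n)%N ->
    [/\ 0 <= p%:R / n%:R :> R, p.+1%:R / n%:R <= 1 :> R &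
        p.+1%:R / n%:R - p%:R / n%:R = n%:R^-1 :> R].
  move=> n0 pn; have np : 0 < n%:R :> R by rewrite ltr0n.
  split; first by rewrite divr_ge0.
    by rewrite ler_pdivrMr// mul1r ler_nat.
  by rewrite -mulrBl -natrB// subSnn mul1r.
have tel (n : nat) : (0 < n)%N ->
    W 1 - W 0 = \sum_(0 <= p < n) (W (p.+1%:R / n%:R) - W (p%:R / n%:R)).
  by move=> n0; rewrite telescope_sumr// divff ?pnatr_eq0 -?lt0n// mul0r.
have h1 : `|(\sum_(0 <= p < P) cos (F 0%N (p%:R / P%:R))) / P%:R - (W 1 - W 0)| <= M / P%:R.
  rewrite (tel P P0) mulr_suml -sumrB.
  apply: le_trans (ler_norm_sum _ _ _) _.
  have -> : M / P%:R = \sum_(0 <= p < P) (M / P%:R / P%:R).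
    rewrite sumr_const_nat subn0 -[RHS]mulr_natr -mulrA mulVf ?mulr1//.
    by rewrite gt_eqF.
  rewrite big_nat_cond [leRHS]big_nat_cond; apply: ler_sum => p /andP[/andP[_ pP] _].
  have [q0 q1 qd] := grid P p P0 pP.
  set u := p%:R / P%:R in q0 qd *; set v := p.+1%:R / P%:R in q1 qd *.
  have uv : u <= v by rewrite -subr_ge0 qd invr_ge0 ltW.
  have [|c /andP[uc cv] ->] := @MVT_le R W (fun x => cos (F 0%N x)) u v uv.
    by move=> x /andP[? ?]; apply: hW; apply/andP; split; lra.
  rewrite qd -mulrBl normrM (ger0_norm (_ : 0 <= P%:R^-1)) ?invr_ge0//.
  rewrite ler_wpM2r ?invr_ge0// distrC.
  have : `|cos (F 0%N c) - cos (F 0%N u)| <= M * (c - u).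
    apply: (MVT_bound (f := cos \o F 0%N) uc (df := fun x => - sin (F 0%N x) * F 1%N x)).
      by move=> x /andP[? ?]; apply: cosd; apply/andP; split; lra.
    move=> x /andP[? ?]; rewrite normrM normrN -[leRHS]mul1r.
    rewrite ler_pM// ?sin_max// hM//; apply/andP; split; lra.
  move=> /le_trans; apply; rewrite ler_wpM2l//; lra.
have h2 : `|W 1 - W 0| <= Q%:R * (2 ^+ m * (2 * rho + (2 / mu + M / mu ^+ 2))).
  rewrite (tel Q Q0).
  apply: le_trans (ler_norm_sum _ _ _) _.
  set V := 2 ^+ m * _.
  have -> : Q%:R * V = \sum_(0 <= p < Q) V.
    by rewrite sumr_const_nat subn0 mulr_natl.
  rewrite big_nat_cond [leRHS]big_nat_cond; apply: ler_sum => p /andP[/andP[_ pQ] _].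
  have [q0 q1 qd] := grid Q p Q0 pQ.
  set u := p%:R / Q%:R in q0 qd *; set v := p.+1%:R / Q%:R in q1 qd *.
  have uv : u <= v by rewrite -subr_ge0 qd invr_ge0 ltW.
  have sub x : u <= x <= v -> 0 <= x <= 1.
    by move=> /andP[? ?]; apply/andP; split; lra.
  have [|j /andP[j0 jm] hj] := hlam u; first by apply: sub; rewrite lexx uv.
  have low x : u <= x <= v -> lam / 2 <= `|F j x|.
    move=> /andP[ux xv].
    have : `|F j x - F j u| <= M * (x - u).
      apply: (MVT_bound (df := F j.+1)) => // y /andP[? ?].
        by apply: hF'; apply/andP; split; lra.
      by apply: hM; rewrite ?ltnS//; apply/andP; split; lra.
    have : M * (x - u) <= M / Q%:R by rewrite ler_wpM2l//; lra.
    by have := lerB_dist (F j u) (F j x); rewrite (distrC (F j u)); lra.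
  have := @van_der_corput j.-1 F W u v (lam / 2) rho M uv _ _ rho0.
  rewrite prednK// => /(_ _ _ _ _ _ low).
  have b0 : 0 <= rho / 2 by rewrite divr_ge0// ltW.
  (* The bound for the index [j] of this piece is weakened to the worst index [m], so that the
     pieces can be added. *)
  set mu' := lam / 2 * (rho / 2) ^+ j.-1 => H.
  have mu0 : 0 < mu by rewrite mulr_gt0 ?divr_gt0// exprn_gt0// divr_gt0.
  have le_mu : mu <= mu'.
    rewrite ler_wpM2l ?divr_ge0 ?(ltW lam0)//.
    apply: ler_wiXn2l => //; first by lra.
    by rewrite (leq_trans (leq_pred _)).
  have mu'0 : 0 < mu' by rewrite (lt_le_trans mu0).
  apply: (le_trans (H _ _ _ _ _)).
  - rewrite qd invf_le1// ler1n//.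
  - by rewrite divr_gt0.
  - by move=> i x /sub; exact: hF'.
  - by move=> x /sub; exact: hW.
  - by move=> x /sub xab; apply: hM.
  have i1 : mu'^-1 <= mu^-1 by rewrite lef_pV2 ?posrE.
  have i0 : 0 <= mu'^-1 by rewrite invr_ge0 ltW.
  have i2 : 2 / mu' + M / mu' ^+ 2 <= 2 / mu + M / mu ^+ 2.
    rewrite -!exprVn lerD ?ler_wpM2l// lerXn2r// nnegrE// (le_trans i0)//.
  have i3 : 2 ^+ j.-1 <= 2 ^+ m :> R.
    by rewrite ler_weXn2l ?ler1n// (leq_trans (leq_pred _)).
  have i4 : 0 <= 2 / mu' + M / mu' ^+ 2.
    by rewrite addr_ge0// divr_ge0// ?exprn_ge0// ltW.
  rewrite lerBlDr (@le_trans _ _ V)//; last by lra.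
  by rewrite ler_pM ?exprn_ge0//; lra.
rewrite -[X in `|X| <= _](subrK (W 1 - W 0)).
by apply: le_trans (ler_normD _ _) _; exact: lerD.
Qed.

End OscillatoryIntegral.

(** * Fejer kernels *)

Section FejerKernel.
Context {R : realType}.
Implicit Types (t c d kap theta eps : R) (H M P m : nat).

(** |sum_{a < H} e(a t)|^2 / H in real form, where e(t) = exp(2 pi i t). *)
Definition fejer H t : R :=
  ((\sum_(a < H) cos (2 * pi * a%:R * t)) ^+ 2 +
   (\sum_(a < H) sin (2 * pi * a%:R * t)) ^+ 2) / H%:R.

Lemma fejer_ge0 H t : 0 <= fejer H t.
Proof. by rewrite divr_ge0// addr_ge0// sqr_ge0. Qed.

Lemma fejerE H t : fejer H t =
  (\sum_(q : 'I_H * 'I_H) cos (2 * pi * ((q.1 : nat)%:R - (q.2 : nat)%:R) * t)) / H%:R.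
Proof.
rewrite /fejer -(pair_big xpredT xpredT
  (fun a b : 'I_H => cos (2 * pi * ((a : nat)%:R - (b : nat)%:R) * t)))/=.
congr (_ / _); rewrite !expr2 !big_distrlr -big_split; apply: eq_bigr => a _ /=.
rewrite -big_split; apply: eq_bigr => b _ /=; rewrite -cosB; congr cos; ring.
Qed.

(** Multiplied by 2 sin (pi t), the cosine and sine sums telescope, which gives the closed form
    sin^2 (pi H t) / (H sin^2 (pi t)) of the kernel. *)
Lemma fejer_sin H t : (0 < H)%N -> sin (pi * t) ^+ 2 * fejer H t <= H%:R^-1.
Proof.
move=> H0; have Hp : 0 < H%:R :> R by rewrite ltr0n.
set u := pi * t; rewrite /fejer.
set C := \sum_(a < H) cos _; set S := \sum_(a < H) sin _.
have e1 : 2 * sin u * C = sin (2 * H%:R * u - u) + sin u.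
  have -> : sin (2 * H%:R * u - u) + sin u =
      sin (2 * H%:R * u - u) - sin (2 * 0%N%:R * u - u).
    by rewrite mulr0 mul0r sub0r sinN opprK.
  rewrite /C -(big_mkord xpredT (fun a => cos (2 * pi * a%:R * t))).
  rewrite -(telescope_sumr (fun a : nat => sin (2 * a%:R * u - u)) (leq0n H)).
  rewrite big_distrr; apply: eq_bigr => a _ /=.
  rewrite (_ : 2 * pi * a%:R * t = 2 * a%:R * u); last by rewrite /u; ring.
  rewrite (_ : 2 * a.+1%:R * u - u = 2 * a%:R * u + u); last by rewrite -natr1; ring.
  rewrite sinD sinB; ring.
have e2 : 2 * sin u * S = cos u - cos (2 * H%:R * u - u).
  have -> : cos u - cos (2 * H%:R * u - u) =
      - cos (2 * H%:R * u - u) - - cos (2 * 0%N%:R * u - u).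
    by rewrite mulr0 mul0r sub0r cosN opprK addrC.
  rewrite /S -(big_mkord xpredT (fun a => sin (2 * pi * a%:R * t))).
  rewrite -(telescope_sumr (fun a : nat => - cos (2 * a%:R * u - u)) (leq0n H)).
  rewrite big_distrr; apply: eq_bigr => a _ /=.
  rewrite (_ : 2 * pi * a%:R * t = 2 * a%:R * u); last by rewrite /u; ring.
  rewrite (_ : 2 * a.+1%:R * u - u = 2 * a%:R * u + u); last by rewrite -natr1; ring.
  rewrite cosD cosB; ring.
rewrite mulrA ler_pdivrMr// mulVf ?gt_eqF//.
have e3 : 4 * (sin u ^+ 2 * (C ^+ 2 + S ^+ 2)) = 2 - 2 * cos (2 * H%:R * u).
  transitivity ((2 * sin u * C) ^+ 2 + (2 * sin u * S) ^+ 2); first by ring.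
  rewrite e1 e2; set v := 2 * H%:R * u - u; rewrite (_ : 2 * H%:R * u = v + u);
    last by rewrite /v; ring.
  have h1 := cos2Dsin2 u; have h2 := cos2Dsin2 v.
  rewrite (cosD v u).
  transitivity ((cos u ^+ 2 + sin u ^+ 2) + (cos v ^+ 2 + sin v ^+ 2) -
     2 * (cos v * cos u - sin v * sin u)); first by ring.
  by rewrite h1 h2.
have := cos_geN1 (2 * H%:R * u); lra.
Qed.

Lemma cosD2piz t (n : int) : cos (t + 2 * pi * n%:~R) = cos t.
Proof.
have nat_case (k : nat) (x : R) : cos (x + 2 * pi * k%:R) = cos x.
  have := periodicn (@cosD2pi R) k x.
  by rewrite -mulrnA -[pi *+ _]mulr_natl natrM mulrAC => ->.
case: n => k; first exact: nat_case.
by rewrite NegzE mulrNz mulrN -(nat_case k.+1 (t - _)) subrK.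
Qed.

Lemma sin_sqrE t : sin t ^+ 2 = (1 - cos (2 * t)) / 2.
Proof.
have := cos2Dsin2 t; rewrite (_ : 2 * t = t + t); last by ring.
by rewrite cosD -!expr2; lra.
Qed.

Lemma sin_pi_sqrDz t (n : int) : sin (pi * (t + n%:~R)) ^+ 2 = sin (pi * t) ^+ 2.
Proof.
rewrite !sin_sqrE (_ : 2 * (pi * (t + n%:~R)) = 2 * (pi * t) + 2 * pi * n%:~R); last by ring.
by rewrite cosD2piz.
Qed.

(** Multiplication by 2 sin v makes the sum telescope, and its two ends differ by [h] full
    periods. *)
Lemma sum_cos_roots M (h : nat) theta : (0 < h < M)%N ->
  \sum_(u < M) cos (theta - 2 * pi * h%:R * ((u : nat)%:R / M%:R)) = 0.
Proof.
move=> /andP[h0 hM].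
have Mp : 0 < M%:R :> R by rewrite ltr0n (leq_trans _ hM).
set v := pi * h%:R / M%:R : R.
have sv : sin v != 0.
  rewrite gt_eqF// sin_gt0_pi// /v; apply/andP; split.
    by rewrite divr_gt0// mulr_gt0 ?pi_gt0// ltr0n.
  by rewrite ltr_pdivrMr// ltr_pM2l ?pi_gt0// ltr_nat.
apply: (mulfI (mulf_neq0 (_ : 2 != 0 :> R) sv)); first by rewrite pnatr_eq0.
rewrite mulr0 -(big_mkord xpredT (fun u : nat =>
  cos (theta - 2 * pi * h%:R * (u%:R / M%:R)))) big_distrr/=.
rewrite (eq_bigr (fun u : nat => - sin (theta - 2 * v * u.+1%:R + v) -
   - sin (theta - 2 * v * u%:R + v))); last first.
  move=> u _; rewrite (_ : theta - 2 * pi * h%:R * (u%:R / M%:R) =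
    theta - 2 * v * u%:R); last by rewrite /v; field; rewrite gt_eqF.
  rewrite (_ : theta - 2 * v * u.+1%:R + v = theta - 2 * v * u%:R - v);
    last by rewrite -natr1; ring.
  by rewrite (sinD _ v) (sinB _ v); ring.
rewrite telescope_sumr// mulr0 subr0.
rewrite (_ : theta + v = theta - 2 * v * M%:R + v + (pi *+ 2) *+ h).
  by rewrite (periodicn (@sinD2pi R)) opprK addNr.
rewrite -mulrnA -[pi *+ _]mulr_natl natrM /v; field; by rewrite gt_eqF.
Qed.

(** The frequencies are smaller than [H <= M] in absolute value, so averaging over the M-th division
    points kills all but the diagonal exactly. This finite average plays the part of an integral
    over the circle. *)
Lemma fejer_avg H M t : (0 < H <= M)%N ->
  (\sum_(u < M) fejer H (t - (u : nat)%:R / M%:R)) / M%:R = 1.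
Proof.
move=> /andP[H0 HM].
have Mp : M%:R != 0 :> R by rewrite pnatr_eq0 -lt0n (leq_trans H0).
have Hp : H%:R != 0 :> R by rewrite pnatr_eq0 -lt0n.
under eq_bigr do rewrite fejerE.
rewrite -big_distrl/= exchange_big/=.
rewrite (eq_bigr (fun q : 'I_H * 'I_H => (M * (q.1 == q.2))%:R)); last first.
  move=> [a b] _ /=; have [->|ab] := eqVneq a b.
    under eq_bigr do rewrite subrr mulr0 mul0r cos0.
    by rewrite sumr_const card_ord muln1.
  rewrite muln0.
  wlog lt_ba : a b ab / (b < a)%N.
    move=> W; have [|lt|/val_inj e] := ltngtP b a; first exact: W.
      have ba : b != a by rewrite eq_sym.
      apply: etrans (W b a ba lt); apply: eq_bigr => u _.
      by rewrite -cosN; congr cos; ring.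
    by rewrite e eqxx in ab.
  have := @sum_cos_roots M (a - b) (2 * pi * ((a : nat)%:R - (b : nat)%:R) * t).
  rewrite natrB ?(ltnW lt_ba)// => S0; apply: etrans (S0 _); last first.
    by rewrite subn_gt0 lt_ba (leq_trans _ HM)// (leq_ltn_trans (leq_subr _ _)).
  by apply: eq_bigr => u _; congr cos; ring.
rewrite -natr_sum -big_distrr/= -(pair_big xpredT xpredT (fun a b : 'I_H => ((a == b) : nat)))/=.
rewrite (eq_bigr (fun=> 1%N)); last first.
  by move=> a _; rewrite (bigD1 a)//= eqxx big1// => b /negbTE; rewrite eq_sym => ->.
rewrite sum1_card card_ord natrM; field.
by rewrite Hp Mp.
Qed.

(** A smoothed indicator of the arc formed by the points u/M with [J u]: its discrete convolution
    with the Fejer kernel. *)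
Definition fejer_mean H M (J : pred 'I_M) t : R :=
  (\sum_(u < M | J u) fejer H (t - (u : nat)%:R / M%:R)) / M%:R.

Lemma fejer_mean_ge0 H M (J : pred 'I_M) t : 0 <= fejer_mean H J t.
Proof. by rewrite divr_ge0// sumr_ge0// => u _; exact: fejer_ge0. Qed.

Lemma fejer_meanC H M (J : pred 'I_M) t : (0 < H <= M)%N ->
  fejer_mean H J t + fejer_mean H (predC J) t = 1.
Proof.
by move=> HM; rewrite -(fejer_avg t HM) -mulrDl [in RHS](bigID J)/=.
Qed.

Lemma fejer_mean_le1 H M (J : pred 'I_M) t : (0 < H <= M)%N -> fejer_mean H J t <= 1.
Proof.
by move=> HM; rewrite -(fejer_meanC J t HM) lerDl fejer_mean_ge0.
Qed.

Lemma sin_pi_ge d t : 0 < d -> d <= 1 / 8 -> d <= t <= 1 - d -> d <= sin (pi * t).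
Proof.
move=> d0 d8 /andP[dt td].
have pi0 := pi_gt0 R; have pi2 : (2 : R) <= pi := pi_ge2 R.
have pi4 : (pi : R) < 4 by have := pihalf_lt2 R; lra.
(* On [0, 1/2] the cosine is at least 3/4, because sin c <= c there. As 2 <= pi < 4, this applies to
   pi d for d <= 1/8 and gives more than d. *)
have low (x : R) : 0 <= x <= 1 / 2 -> x * (3 / 4) <= sin x.
  move=> /andP[x0 x2].
  have aux (y : R) : 0 <= y -> `|sin y| <= y.
    move=> y0; have [c _ e] := MVT_le y0 (fun z _ => is_derive_sin z).
    move: e; rewrite sin0 !subr0 => ->; rewrite normrM (ger0_norm y0).
    by rewrite ler_piMl// cos_max.
  have [c /andP[c0 cx] e] := MVT_le x0 (fun z _ => is_derive_sin z).
  move: e; rewrite sin0 !subr0 mulrC => ->.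
  rewrite ler_wpM2l//.
  have := aux c c0; have := cos2Dsin2 c; rewrite -(real_normK (num_real (sin c))).
  have : 0 <= cos c by apply: cos_ge0_pihalf; apply/andP; split; lra.
  have := normr_ge0 (sin c); have := cos_le1 c; nra.
have base : d <= sin (pi * d).
  by apply: le_trans (low _ _); [nra|apply/andP; split; nra].
have mono (z : R) : d <= z -> z <= 1 / 2 -> d <= sin (pi * z).
  move=> dz z2; apply: le_trans base _.
  have [->//|ne] := eqVneq d z.
  by apply/ltW; rewrite ltr_sin ?in_itv/=; [nra|apply/andP; split; nra..].
have [t2|t2] := leP t (1 / 2); first exact: mono.
rewrite (_ : pi * t = pi - pi * (1 - t)); last by ring.
rewrite sinB sinpi cospi mul0r sub0r mulN1r opprK; apply: mono; lra.
Qed.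

Lemma fejer_tail H d t (n : int) : (0 < H)%N -> 0 < d -> d <= 1 / 8 ->
  d <= t + n%:~R <= 1 - d -> fejer H t <= (H%:R * d ^+ 2)^-1.
Proof.
move=> H0 d0 d8 htn.
have := fejer_sin t H0; rewrite -(sin_pi_sqrDz t n).
have := sin_pi_ge d0 d8 htn; set s := sin _ => ds h.
have d2 : 0 < d ^+ 2 by rewrite exprn_gt0.
rewrite invfM -ler_pdivrMr ?invr_gt0// invrK mulrC.
apply: le_trans h; rewrite ler_wpM2r ?fejer_ge0//.
by rewrite lerXn2r ?nnegrE// ltW// (lt_le_trans d0).
Qed.

Lemma fejer_mean_tail H M (J : pred 'I_M) kap t : 0 <= kap -> (0 < M)%N ->
  (forall u, J u -> fejer H (t - (u : nat)%:R / M%:R) <= kap) ->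
  fejer_mean H J t <= kap.
Proof.
move=> k0 M0 h; rewrite /fejer_mean ler_pdivrMr ?ltr0n//.
apply: (@le_trans _ _ (\sum_(u < M | J u) kap)); first exact: ler_sum.
rewrite sumr_const -[X in X <= _]mulr_natr ler_wpM2l// ler_nat.
by apply: leq_trans (max_card _) _; rewrite card_ord.
Qed.

(* With t = - y: some integer lies in [y, y + c). *)
Definition hit c t : bool := `[< exists n : int, 0 <= n%:~R + t < c >].

Definition arc_below M c : pred 'I_M := fun u => (u : nat)%:R / M%:R < c.

(* The shift by d keeps the enlarged and the reduced arc inside [0, 1), so that
   no arc wraps around. *)
Lemma hit_le_fejer_mean H M c d t : (0 < H <= M)%N -> 0 < d -> d <= 1 / 8 ->
  (hit c t)%:R <= fejer_mean H (@arc_below M (c + 2 * d)) (t + d) + (H%:R * d ^+ 2)^-1.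
Proof.
move=> HM d0 d8; have /andP[H0 HM'] := HM.
have M0 : (0 < M)%N by exact: leq_trans HM'.
have k0 : 0 <= (H%:R * d ^+ 2)^-1 by rewrite invr_ge0 mulr_ge0// sqr_ge0.
rewrite /hit; case: asboolP => [[n /andP[n0 nc]]|_]; last first.
  by rewrite addr_ge0// fejer_mean_ge0.
rewrite -[leLHS](fejer_meanC (@arc_below M (c + 2 * d)) (t + d) HM) lerD2l.
apply: fejer_mean_tail => // u; rewrite /arc_below/= -leNgt => uc.
apply: (@fejer_tail H d _ (n + 1)) => //; rewrite intrD.
have : (u : nat)%:R / M%:R <= 1 :> R by rewrite ler_pdivrMr ?ltr0n// mul1r ler_nat ltnW.
have : 0 <= (u : nat)%:R / M%:R :> R by rewrite divr_ge0.
set z := _ / _ in uc *; have -> : (1%:~R : R) = 1 by [].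
by move=> ? ?; apply/andP; split; lra.
Qed.

(** Without a hit some translate of [t] lies in [c, 1), and after the shift by [d] every point of
    the arc [2d, c) is at distance at least [d] from it modulo 1; only the tail of the kernel
    remains. *)
Lemma fejer_mean_le_hit H M c d t : (0 < H <= M)%N -> 0 < d -> d <= 1 / 8 ->
  fejer_mean H (predD (@arc_below M c) (@arc_below M (2 * d))) (t + d)
    <= (hit c t)%:R + (H%:R * d ^+ 2)^-1.
Proof.
move=> HM d0 d8; have /andP[H0 HM'] := HM.
have M0 : (0 < M)%N by exact: leq_trans HM'.
have k0 : 0 <= (H%:R * d ^+ 2)^-1 by rewrite invr_ge0 mulr_ge0// sqr_ge0.
rewrite /hit; case: asboolP => [_|nh].
  by apply: (le_trans (fejer_mean_le1 _ _ HM)); rewrite lerDl.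
rewrite add0r; apply: fejer_mean_tail => // u.
rewrite /predD/= /arc_below -leNgt => /andP[du uc].
set n := - Num.floor t.
have tn : 0 <= n%:~R + t < 1.
  rewrite /n mulrNz; have := floor_le t; have := floorD1_gt t; rewrite intrD => ? ?.
  by apply/andP; split; lra.
have ct : c <= n%:~R + t.
  by rewrite leNgt; apply/negP => lt; apply: nh; exists n; case/andP: tn => -> _.
apply: (@fejer_tail H d _ n) => //.
by move/andP: tn => [? ?]; apply/andP; split; lra.
Qed.

Lemma card_below M (z : R) : 0 <= z ->
  Num.min M%:R z <= \sum_(0 <= u < M) (u%:R < z)%R%:R <= z + 1.
Proof.
move=> z0.
(* The cap by [M] is added to the upper bound as well, so that the induction on [M] goes through. *)
suff : Num.min M%:R z <= \sum_(0 <= u < M) (u%:R < z)%R%:R <= Num.min M%:R (z + 1).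
  by move=> /andP[-> h]; apply: (le_trans h); rewrite ge_min lexx orbT.
elim: M => [|M /andP[IH1 IH2]].
  by rewrite big_geq// ge_min lexx/= le_min lexx/=; lra.
rewrite big_nat_recr//=; move: IH1 IH2; set S := \sum_(0 <= _ < _) _.
rewrite !ge_min !le_min -natr1 => /orP IH1 /andP[IH2 IH3].
have [Mz|zM] := ltP M%:R z; rewrite ?addr0 ?mulr1n ?mulr0n ?addr0.
  apply/andP; split; first by apply/orP; case: IH1 => ?; left; lra.
  by apply/andP; split; lra.
by apply/andP; split; [apply/orP; case: IH1 => ?; right; lra|apply/andP; split; lra].
Qed.

Lemma arc_belowE M c : (0 < M)%N ->
  \sum_(u < M | @arc_below M c u) 1 = \sum_(0 <= u < M) (u%:R < c * M%:R)%R%:R :> R.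
Proof.
move=> M0; rewrite big_mkord big_mkcond/=; apply: eq_bigr => u _.
by rewrite /arc_below ltr_pdivrMr ?ltr0n//; case: ifP.
Qed.

Lemma arc_below_le M c : (0 < M)%N -> 0 <= c ->
  (\sum_(u < M | @arc_below M c u) 1) / M%:R <= c + M%:R^-1.
Proof.
move=> M0 c0; have Mp : 0 < M%:R :> R by rewrite ltr0n.
rewrite arc_belowE// ler_pdivrMr// mulrDl mulVf ?gt_eqF//.
by have /andP[] := @card_below M (c * M%:R) (mulr_ge0 c0 (ltW Mp)).
Qed.

Lemma arc_ring_ge M c d : (0 < M)%N -> 0 <= c -> c <= 1 -> 0 <= d ->
  c - 2 * d - M%:R^-1 <=
  (\sum_(u < M | predD (@arc_below M c) (@arc_below M (2 * d)) u) 1) / M%:R.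
Proof.
move=> M0 c0 c1 d0; have Mp : 0 < M%:R :> R by rewrite ltr0n.
have h1 := arc_below_le M0 (mulr_ge0 (ler0n R 2) d0).
have h2 : c <= (\sum_(u < M | @arc_below M c u) 1) / M%:R :> R.
  rewrite arc_belowE// ler_pdivlMr//.
  have /andP[h _] := @card_below M (c * M%:R) (mulr_ge0 c0 (ltW Mp)).
  by apply: le_trans h; rewrite le_min lexx andbT ler_piMl// ltW.
have h3 : \sum_(u < M | @arc_below M c u) 1 <= \sum_(u < M | @arc_below M (2 * d) u) 1 +
   \sum_(u < M | predD (@arc_below M c) (@arc_below M (2 * d)) u) 1 :> R.
  rewrite big_mkcond [X in _ <= X + _]big_mkcond [X in _ <= _ + X]big_mkcond -big_split.
  apply: ler_sum => u _; rewrite /predD/=.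
  by case: (@arc_below M c u); case: (@arc_below M (2 * d) u) => /=; lra.
have h4 : (\sum_(u < M | @arc_below M c u) 1) / M%:R <=
  (\sum_(u < M | @arc_below M (2 * d) u) 1) / M%:R +
   (\sum_(u < M | predD (@arc_below M c) (@arc_below M (2 * d)) u) 1) / M%:R :> R.
  by rewrite -mulrDl ler_wpM2r// invr_ge0 ltW.
lra.
Qed.

End FejerKernel.

(** * Correlations from exponential sums *)

Section Correlations.
Context {R : realType}.
Implicit Types (t c d kap theta eps : R) (H M P m : nat).

(** Since the sine sums vanish, each cosine sum equals a sum of complex exponentials; the product is
    expanded there and the real part is taken. *)
Lemma prod_sum_cos m (Q : finType) (phi : 'I_m -> Q -> R) :
  (forall i, \sum_q sin (phi i q) = 0) ->
  \prod_(i < m) \sum_q cos (phi i q) =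
  \sum_(f : {ffun 'I_m -> Q}) cos (\sum_(i < m) phi i (f i)).
Proof.
move=> s0.
pose e (x : R) : R[i] := Complex (cos x) (sin x).
have eD x y : e (x + y) = e x * e y.
  by rewrite /e cosD sinD; apply/eqP;
    rewrite eq_complex/= (addrC (sin x * _)) (mulrC (sin x)) !eqxx.
have e_sum (F : 'I_m -> R) : \prod_i e (F i) = e (\sum_i F i).
  by apply/esym/(big_morph e eD); rewrite /e cos0 sin0.
have ReD : {morph (@complex.Re R) : x y / x + y} by move=> [? ?] [? ?].
have ImD : {morph (@complex.Im R) : x y / x + y} by move=> [? ?] [? ?].
have realsum i : \sum_q e (phi i q) = Complex (\sum_q cos (phi i q)) 0.
  apply/eqP; rewrite eq_complex (big_morph _ ReD (id1 := 0))// (big_morph _ ImD (id1 := 0))//.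
  by rewrite /= s0 !eqxx.
have rM (x y : R) : Complex (x * y) 0 = Complex x 0 * Complex y 0 :> R[i].
  by apply/eqP; rewrite eq_complex/= mulr0 subr0 mulr0 mul0r addr0 !eqxx.
have := @bigA_distr_bigA R[i] 0 1 *%R +%R 'I_m Q (fun i q => e (phi i q)).
rewrite (eq_bigr _ (fun i _ => realsum i)).
rewrite -(big_morph (fun x : R => Complex x 0) rM (erefl (1 : R[i]))).
move=> /(congr1 (@complex.Re R))/= ->.
rewrite (big_morph _ ReD (id1 := 0))//.
by apply: eq_bigr => f _; rewrite e_sum.
Qed.

Definition grid_mean P (f : nat -> R) : R := (\sum_(0 <= p < P) f p) / P%:R.

Lemma grid_mean_le P f g : (forall p, (p < P)%N -> f p <= g p) ->
  grid_mean P f <= grid_mean P g.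
Proof.
move=> h; rewrite ler_wpM2r ?invr_ge0// big_nat [leRHS]big_nat.
by apply: ler_sum => p /andP[_ /h].
Qed.

Lemma eq_grid_mean P f g : (forall p, (p < P)%N -> f p = g p) ->
  grid_mean P f = grid_mean P g.
Proof. by move=> h; apply/le_anti/andP; split; apply: grid_mean_le => p /h ->. Qed.

Lemma grid_mean_cst P (a : R) : (0 < P)%N -> grid_mean P (fun=> a) = a.
Proof.
move=> P0; rewrite /grid_mean sumr_const_nat subn0 -[_ *+ P]mulr_natr mulfK//.
by rewrite pnatr_eq0 -lt0n.
Qed.

Lemma grid_meanD P f g :
  grid_mean P (fun p => f p + g p) = grid_mean P f + grid_mean P g.
Proof. by rewrite /grid_mean big_split mulrDl. Qed.

Lemma grid_meanZ P (a : R) f : grid_mean P (fun p => a * f p) = a * grid_mean P f.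
Proof. by rewrite /grid_mean -big_distrr mulrA. Qed.

Lemma grid_mean_sum P (I : finType) (f : I -> nat -> R) :
  grid_mean P (fun p => \sum_i f i p) = \sum_i grid_mean P (f i).
Proof. by rewrite /grid_mean exchange_big big_distrl. Qed.

Lemma grid_meanB P (F G : nat -> R) :
  grid_mean P (fun p => F p - G p) = grid_mean P F - grid_mean P G.
Proof. by rewrite /grid_mean sumrB mulrBl. Qed.

Lemma grid_mean_big P m (c : nat -> R) (F : nat -> nat -> R) :
  grid_mean P (fun p => \sum_(0 <= i < m) c i * F i p) =
  \sum_(0 <= i < m) c i * grid_mean P (F i).
Proof.
rewrite /grid_mean exchange_big/= mulr_suml; apply: eq_bigr => i _.
by rewrite -big_distrr/= mulrA.
Qed.

Lemma grid_mean_norm P f : `|grid_mean P f| <= grid_mean P (fun p => `|f p|).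
Proof.
rewrite /grid_mean normrM normfV (ger0_norm (ler0n _ P)) ler_wpM2r ?invr_ge0//.
exact: ler_norm_sum.
Qed.

Section FixedTuple.
Variables (m H P : nat) (s : 'I_m -> nat -> R) (eps : R).
Hypothesis H_gt0 : (0 < H)%N.
Hypothesis P_gt0 : (0 < P)%N.
Hypothesis eps_ge0 : 0 <= eps.
Hypothesis exp_sum_le : forall (h : 'I_m -> int) theta,
  (exists i, h i != 0) -> (forall i, (`|h i| < H)%N) ->
  `|grid_mean P (fun p => cos (theta + 2 * pi * \sum_i (h i)%:~R * s i p))| <= eps.

(** Expanded into exponentials, the product has H^(2m) terms over the denominator H^m. The H^m terms
    with zero frequency vector contribute exactly 1, each other term at most [eps]. *)
Lemma grid_mean_prod_fejer (u : 'I_m -> R) :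
  `|grid_mean P (fun p => \prod_i fejer H (s i p - u i)) - 1| <= H%:R ^+ m * eps.
Proof.
have Hp : H%:R != 0 :> R by rewrite pnatr_eq0 -lt0n.
pose Q : finType := ('I_H * 'I_H)%type.
pose h (f : {ffun 'I_m -> Q}) i : int := ((f i).1 : nat)%:Z - ((f i).2 : nat)%:Z.
pose X f p : R := cos (- (2 * pi * \sum_i (h f i)%:~R * u i) +
  2 * pi * \sum_i (h f i)%:~R * s i p).
have e1 p : \prod_i fejer H (s i p - u i) = (H%:R ^+ m)^-1 * \sum_f X f p.
  under eq_bigr do rewrite fejerE.
  rewrite prodf_div prodr_const card_ord [LHS]mulrC; congr (_ * _).
  rewrite (@prod_sum_cos m Q (fun i q => 2 * pi * ((q.1 : nat)%:R - (q.2 : nat)%:R) *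
    (s i p - u i))).
    apply: eq_bigr => f _; rewrite /X; congr cos.
    rewrite -mulrN -mulrDr -sumrN -big_split/= big_distrr; apply: eq_bigr => i _ /=.
    by rewrite /h intrB -!pmulrn; ring.
  (* Exchanging the two indices of a pair changes the sign of the sine, so the sine sum equals its
     opposite. *)
  move=> i; apply/eqP; rewrite -[_ == 0](@mulrn_eq0 R _ 2)/= mulr2n addr_eq0 -sumrN.
  rewrite (reindex_inj (h := fun q : Q => (q.2, q.1)))/=; last by move=> [? ?] [? ?] [-> ->].
  by apply/eqP/eq_bigr => -[a b] _ /=; rewrite -sinN; congr sin; ring.
rewrite (eq_grid_mean (fun p _ => e1 p)) grid_meanZ grid_mean_sum.
(* The indicator of the terms with zero frequency vector. *)
pose D (f : {ffun 'I_m -> Q}) : R := \prod_i ((f i).1 == (f i).2)%:R.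
have sD : \sum_f D f = H%:R ^+ m.
  rewrite -(@bigA_distr_bigA R 0 1 *%R +%R 'I_m Q (fun _ q => (q.1 == q.2)%:R)).
  rewrite -[in RHS](card_ord m) -prodr_const; apply: eq_bigr => i _.
  rewrite -(pair_big xpredT xpredT (fun a b : 'I_H => ((a == b)%:R : R)))/=.
  rewrite (eq_bigr (fun=> 1)); first by rewrite sumr_const card_ord.
  by move=> a _; rewrite (bigD1 a)//= eqxx big1 ?addr0// => b /negbTE; rewrite eq_sym => ->.
rewrite [X in _ - X](_ : 1 = (H%:R ^+ m)^-1 * \sum_f D f); last first.
  by rewrite sD mulVf// expf_neq0.
rewrite -mulrBr -sumrB normrM ger0_norm ?invr_ge0 ?exprn_ge0//.
rewrite mulrC ler_pdivrMr ?exprn_gt0 ?ltr0n//.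
apply: le_trans (ler_norm_sum _ _ _) _.
apply: (@le_trans _ _ (\sum_(f : {ffun 'I_m -> Q}) eps)); last first.
  rewrite sumr_const card_ffun card_prod !card_ord -[X in X <= _]mulr_natr natrX natrM.
  by rewrite exprMn mulrAC mulrC.
apply: ler_sum => f _.
have [diag|] := boolP [forall i, (f i).1 == (f i).2].
  have h0 i : h f i = 0 by have /forallP/(_ i)/eqP := diag; rewrite /h => ->; rewrite subrr.
  rewrite (eq_grid_mean (g := fun=> 1)).
    rewrite grid_mean_cst// /D big1 ?subrr ?normr0// => i _.
    by move/forallP: diag => ->.
  move=> p _; rewrite /X !big1 ?mulr0 ?oppr0 ?addr0 ?cos0// => i _;
  by rewrite h0 mul0r.
rewrite negb_forall => /existsP nd.
have -> : D f = 0.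
  by have [i /negbTE ni] := nd; rewrite /D (bigD1 i)//= ni mul0r.
rewrite subr0; apply: exp_sum_le.
  by have [i ni] := nd; exists i; rewrite /h subr_eq0 eqz_nat.
move=> i; rewrite /h; case: (f i) => a b /=.
by move: (ltn_ord a) (ltn_ord b); move: (nat_of_ord a) (nat_of_ord b) => {}a {}b; lia.
Qed.

(** A product of Fejer means is an average of products of kernels with shifts u_i/M, and the
    estimate for single kernels is uniform in the shifts. *)
Lemma grid_mean_prod_fejer_mean M (J : 'I_m -> pred 'I_M) : (0 < M)%N ->
  `|grid_mean P (fun p => \prod_i fejer_mean H (J i) (s i p)) -
    \prod_i ((\sum_(u < M | J i u) 1) / M%:R)| <= H%:R ^+ m * eps.
Proof.
move=> M0; have Mp : 0 < M%:R :> R by rewrite ltr0n.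
have He : 0 <= H%:R ^+ m * eps by rewrite mulr_ge0// exprn_ge0.
pose w (u : {ffun 'I_m -> 'I_M}) : R := \prod_i (J i (u i))%:R.
have e1 p : \prod_i fejer_mean H (J i) (s i p) = (M%:R ^+ m)^-1 *
    \sum_(u : {ffun 'I_m -> 'I_M}) w u * \prod_i fejer H (s i p - ((u i : nat)%:R / M%:R)).
  rewrite prodf_div prodr_const card_ord [LHS]mulrC; congr (_ * _).
  under eq_bigr do rewrite big_mkcond.
  rewrite bigA_distr_bigA; apply: eq_bigr => u _; rewrite -big_split; apply: eq_bigr => i _ /=.
  by case: ifP; rewrite ?mul1r ?mul0r.
have e2 : \prod_i ((\sum_(u < M | J i u) 1) / M%:R) = (M%:R ^+ m)^-1 * \sum_u w u.
  rewrite prodf_div prodr_const card_ord [LHS]mulrC; congr (_ * _).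
  under eq_bigr do rewrite big_mkcond.
  rewrite bigA_distr_bigA; apply: eq_bigr => u _; apply: eq_bigr => i _ /=.
  by case: ifP.
rewrite (eq_grid_mean (fun p _ => e1 p)) grid_meanZ grid_mean_sum e2.
rewrite -mulrBr -sumrB normrM ger0_norm ?invr_ge0 ?exprn_ge0//.
rewrite mulrC ler_pdivrMr ?exprn_gt0//.
apply: le_trans (ler_norm_sum _ _ _) _.
apply: (@le_trans _ _ (\sum_(u : {ffun 'I_m -> 'I_M}) (H%:R ^+ m * eps))); last first.
  by rewrite sumr_const card_ffun !card_ord -[X in X <= _]mulr_natr natrX.
apply: ler_sum => u _; rewrite grid_meanZ -[X in _ - X]mulr1 -mulrBr normrM.
rewrite -[leRHS]mul1r ler_pM//; last exact: grid_mean_prod_fejer.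
rewrite /w normr_prod prodr_ile1// => i _.
by rewrite normr_ge0/=; case: (J i _); rewrite ?normr1 ?normr0.
Qed.

Lemma prod_le_add (a b : 'I_m -> R) kap : 0 <= kap ->
  (forall i, 0 <= a i <= 1) -> (forall i, 0 <= b i <= 1) ->
  (forall i, a i <= b i + kap) -> \prod_i a i <= \prod_i b i + m%:R * kap.
Proof.
move=> k0 ha hb hab.
suff H' (r : seq 'I_m) : [/\ 0 <= \prod_(i <- r) a i <= 1, 0 <= \prod_(i <- r) b i <= 1 &
    \prod_(i <- r) a i <= \prod_(i <- r) b i + (size r)%:R * kap].
  have sz : size (index_enum 'I_m) = m by rewrite [index_enum _]unlock -enumT size_enum_ord.
  by have [_ _] := H' (index_enum 'I_m); rewrite sz.
elim: r => [|i r [/andP[a0 a1] /andP[b0 b1] IH]].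
  by rewrite !big_nil mul0r addr0 ler01 lexx; split.
rewrite !big_cons/= -natr1.
set x := \prod_(j <- r) a j in a0 a1 IH *; set y := \prod_(j <- r) b j in b0 b1 IH *.
have /andP[ai0 ai1] := ha i; have /andP[bi0 bi1] := hb i; have abi := hab i.
set z := (size r)%:R * kap in IH *.
have z0 : 0 <= z by rewrite mulr_ge0.
rewrite mulrDl mul1r -/z; split; [apply/andP; split; nra..|].
have h1 : a i * x <= a i * y + z by nra.
have h2 : a i * y <= b i * y + kap by nra.
lra.
Qed.

(** The hits lie between two products of Fejer means. Each factor loses the tail (H d^2)^-1 and a
    change of arc length of at most 3 d. *)
Lemma grid_mean_prod_hit (c : 'I_m -> R) d : 0 < d -> d <= 1 / 8 ->
  (forall i, 0 <= c i <= 1) ->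
  `|grid_mean P (fun p => \prod_i (hit (c i) (s i p - d))%:R) - \prod_i c i| <=
   m%:R * ((H%:R * d ^+ 2)^-1 + 3 * d) + H%:R ^+ m * eps.
Proof.
move=> d0 d8 hc.
(* [M >= H] makes the averages of kernels exact, and 1/M <= d absorbs the rounding of arcs: 2 d +
   1/M <= 3 d. *)
have [M [M0 HM Md]] : exists M, [/\ (0 < M)%N, (H <= M)%N & M%:R^-1 <= d].
  exists (maxn H (Num.truncn d^-1).+1); split; rewrite ?leq_max ?leqnn// ?orbT//.
  have dp : 0 < d^-1 by rewrite invr_gt0.
  rewrite invf_ple ?posrE ?ltr0n ?leq_max ?orbT//.
  apply: (@le_trans _ _ ((Num.truncn d^-1).+1)%:R); last by rewrite ler_nat leq_maxr.
  by apply/ltW; have /andP[] := truncn_itv (ltW dp).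
have HHM : (0 < H <= M)%N by rewrite H_gt0.
set kap := (H%:R * d ^+ 2)^-1.
have kap0 : 0 <= kap by rewrite invr_ge0 mulr_ge0// sqr_ge0.
have cnt (J : pred 'I_M) : 0 <= (\sum_(u < M | J u) 1) / M%:R <= (1 : R).
  apply/andP; split; first by rewrite divr_ge0// sumr_ge0.
  rewrite ler_pdivrMr ?ltr0n// mul1r sumr_const ler_nat.
  by apply: leq_trans (max_card _) _; rewrite card_ord.
have hit01 i p : 0 <= (hit (c i) (s i p - d))%:R <= (1 : R) by case: hit; rewrite ?lexx ?ler01.
have fm01 (J : pred 'I_M) t : 0 <= fejer_mean H J t <= 1.
  by rewrite fejer_mean_ge0 fejer_mean_le1.
have up : grid_mean P (fun p => \prod_i (hit (c i) (s i p - d))%:R) <=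
    \prod_i c i + (m%:R * (kap + 3 * d) + H%:R ^+ m * eps).
  pose J i : pred 'I_M := @arc_below _ M (c i + 2 * d).
  have := grid_mean_prod_fejer_mean J M0; rewrite ler_norml => /andP[_ h1].
  have h2 : grid_mean P (fun p => \prod_i (hit (c i) (s i p - d))%:R) <=
      grid_mean P (fun p => \prod_i fejer_mean H (J i) (s i p)) + m%:R * kap.
    rewrite -[X in _ + X](grid_mean_cst _ P_gt0) -grid_meanD.
    apply: grid_mean_le => p _; apply: prod_le_add => // i; rewrite ?hit01 ?fm01//.
    by rewrite -[X in fejer_mean _ _ X](subrK d); exact: hit_le_fejer_mean.
  have h3 : \prod_i ((\sum_(u < M | J i u) 1) / M%:R) <= \prod_i c i + m%:R * (3 * d).
    apply: prod_le_add => [|i|i|i]; [lra|exact: cnt|exact: hc|].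
    have /andP[ci0 _] := hc i.
    have : 0 <= c i + 2 * d by lra.
    by move=> /(arc_below_le M0); lra.
  lra.
have low : \prod_i c i <= grid_mean P (fun p => \prod_i (hit (c i) (s i p - d))%:R) +
     (m%:R * (kap + 3 * d) + H%:R ^+ m * eps).
  pose J i : pred 'I_M := predD (@arc_below _ M (c i)) (@arc_below _ M (2 * d)).
  have := grid_mean_prod_fejer_mean J M0; rewrite ler_norml => /andP[h1 _].
  have h2 : grid_mean P (fun p => \prod_i fejer_mean H (J i) (s i p)) <=
     grid_mean P (fun p => \prod_i (hit (c i) (s i p - d))%:R) + m%:R * kap.
    rewrite -[X in _ + X](grid_mean_cst _ P_gt0) -grid_meanD.
    apply: grid_mean_le => p _; apply: prod_le_add => // i; rewrite ?hit01 ?fm01//.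
    by rewrite -[X in fejer_mean _ _ X](subrK d); exact: fejer_mean_le_hit.
  have h3 : \prod_i c i <= \prod_i ((\sum_(u < M | J i u) 1) / M%:R) + m%:R * (3 * d).
    apply: prod_le_add => [|i|i|i]; [lra|exact: hc|exact: cnt|].
    have /andP[ci0 ci1] := hc i.
    by have := arc_ring_ge M0 ci0 ci1 (ltW d0); rewrite -/(J i); lra.
  lra.
rewrite ler_norml; apply/andP; split; lra.
Qed.

End FixedTuple.

End Correlations.

(** * Bonferroni inequalities *)

Section Bonferroni.
Context {R : realType}.
Implicit Types (l : seq R) (x err : R) (P r j : nat).

Fixpoint esymm j l : R :=
  match j, l with
  | 0%N, _ => 1
  | j'.+1, [::] => 0
  | j'.+1, x :: l' => esymm j l' + x * esymm j' l'
  end.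

Lemma esymm0 l : esymm 0 l = 1.
Proof. by case: l. Qed.

Lemma esymm_le_exp j l : {in l, forall x, 0 <= x} ->
  esymm j l <= (\sum_(x <- l) x) ^+ j / j`!%:R.
Proof.
elim: l j => [|x l IH] j h.
  by rewrite big_nil; case: j => [|j] /=; rewrite ?divr1 ?expr0// expr0n mul0r.
have x0 : 0 <= x by apply: h; rewrite mem_head.
have hl : {in l, forall x, 0 <= x} by move=> y yl; apply: h; rewrite inE yl orbT.
case: j => [|j]; first by rewrite /= divr1 expr0.
rewrite big_cons /=; set S := \sum_(y <- l) y.
have S0 : 0 <= S by rewrite /S big_seq; apply: sumr_ge0 => y /hl.
have fp n : 0 < n`!%:R :> R by rewrite ltr0n fact_gt0.
(* The first two terms of the binomial expansion. *)
have key n : S ^+ n.+1 + n.+1%:R * (x * S ^+ n) <= (x + S) ^+ n.+1.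
  elim: n => [|n IHn]; first by rewrite !expr1 expr0 mulr1 mul1r addrC.
  rewrite [leRHS]exprS; apply: (@le_trans _ _ ((x + S) * (S ^+ n.+1 + n.+1%:R * (x * S ^+ n)))).
    rewrite -[n.+2%:R]natr1 !exprS; have : 0 <= S ^+ n by rewrite exprn_ge0.
    have : 0 <= n.+1%:R :> R by []; set a := n.+1%:R; set b := S ^+ n => a0 b0.
    have := mulr_ge0 (mulr_ge0 a0 b0) (mulr_ge0 x0 x0); nra.
  by rewrite ler_wpM2l// addr_ge0.
have h1 := IH j.+1 hl; have h2 : x * esymm j l <= x * (S ^+ j / j`!%:R).
  by rewrite ler_wpM2l// IH.
apply: le_trans (lerD h1 h2) _; rewrite ler_pdivlMr// mulrDl divfK ?gt_eqF//.
apply: le_trans (key j); rewrite lerD2l factS natrM.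
rewrite (_ : x * (S ^+ j / j`!%:R) * (j.+1%:R * j`!%:R) = j.+1%:R * (x * S ^+ j))//.
by field; rewrite gt_eqF.
Qed.

(** The induction carries more: the remainder after [n] terms has the sign (-1)^n and is at most the
    next symmetric function. The two parts are propagated by D_{n+1}(x :: l) = D_{n+1}(l) - x
    D_n(l). *)
Lemma bonferroni r l : {in l, forall x, 0 <= x <= 1} ->
  `|\prod_(x <- l) (1 - x) - \sum_(j < r.+1) (-1) ^+ j * esymm j l| <= esymm r.+1 l.
Proof.
pose D r l := \prod_(x <- l) (1 - x) - \sum_(j < r) (-1) ^+ j * esymm j l.
move=> h; suff main n : 0 <= (-1) ^+ n * D n l <= esymm n l.
  have /andP[a b] := main r.+1.
  by move: b; rewrite -(ger0_norm a) normrMsign.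
elim: l h n => [|x l IH] h n.
  rewrite /D big_nil; case: n => [|n]; first by rewrite big_ord0 subr0 mul1r ler01 lexx.
  by rewrite big_ord_recl/= mul1r big1 ?addr0 ?subrr ?mulr0 ?lexx// => i _; rewrite /bump/= mulr0.
have /andP[x0 x1] : 0 <= x <= 1 by apply: h; rewrite mem_head.
have {}h : {in l, forall x, 0 <= x <= 1} by move=> y yl; apply: h; rewrite inE yl orbT.
have P01 : 0 <= \prod_(y <- l) (1 - y) <= 1.
  rewrite big_seq prodr_ge0/=; last by move=> y /h/andP[? ?]; lra.
  by apply: prodr_ile1 => y /h/andP[? ?]; apply/andP; split; lra.
case: n => [|n].
  rewrite /D big_ord0 subr0 mul1r big_cons /=.
  by move/andP: P01 => [? ?]; apply/andP; split; nra.
have -> : D n.+1 (x :: l) = D n.+1 l - x * D n l.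
  rewrite /D big_cons !big_ord_recl/= !expr0 !mul1r.
  rewrite (eq_bigr (fun i : 'I_n => (-1) ^+ bump 0 i * esymm (bump 0 i) l -
    x * ((-1) ^+ i * esymm i l))); last first.
    by move=> i _; rewrite /bump/= add1n exprS; ring.
  rewrite sumrB -big_distrr/= esymm0; ring.
have /andP[a b] := IH h n.+1; have /andP[c d] := IH h n.
rewrite mulrBr mulrCA [(-1) ^+ n.+1 * D n l](_ : _ = - ((-1) ^+ n * D n l)); last first.
  by rewrite exprS; ring.
rewrite /= mulrN opprK; apply/andP; split; first by rewrite addr_ge0// mulr_ge0.
by rewrite lerD// ler_wpM2l.
Qed.

(** In the induction [d] collects the factors already chosen and [l] the elements still undecided;
    the power of [size l + 1] bounds the number of products that occur. *)
Lemma grid_mean_esymm (T : eqType) (D : {pred T}) r P (a : T -> nat -> R) (c : T -> R) err :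
  (forall d : seq T, uniq d -> {subset d <= D} -> (size d <= r)%N ->
    `|grid_mean P (fun p => \prod_(k <- d) a k p) - \prod_(k <- d) c k| <= err) ->
  forall (l d : seq T) j, uniq (d ++ l) -> {subset d ++ l <= D} -> (size d + j <= r)%N ->
  `|grid_mean P (fun p => \prod_(k <- d) a k p * esymm j [seq a k p | k <- l]) -
    \prod_(k <- d) c k * esymm j [seq c k | k <- l]| <= err * ((size l).+1)%:R ^+ j.
Proof.
move=> hyp; elim=> [|k l IH] d j ud sd hj.
  have err0 : 0 <= err by apply: le_trans (hyp [::] _ _ _).
  case: j hj => [|j] hj.
    rewrite /= expr0 !mulr1; rewrite cats0 in ud sd.
    under eq_grid_mean do rewrite mulr1.
    by apply: hyp => //; rewrite addn0 in hj.
  rewrite /= expr1n mulr1 mulr0; under eq_grid_mean do rewrite mulr0.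
  by rewrite /grid_mean sumr_const_nat mul0rn mul0r subrr normr0.
case: j hj => [|j] hj.
  rewrite /= expr0 !mulr1.
  under eq_grid_mean do rewrite mulr1.
  apply: hyp; last by rewrite addn0 in hj.
    by move: ud; rewrite cat_uniq => /andP[].
  by move=> y yd; apply: sd; rewrite mem_cat yd.
have u1 : uniq (d ++ l).
  by move: ud; rewrite !cat_uniq/= negb_or => /and3P[-> /andP[_ ->] /andP[_ ->]].
have u2 : uniq ((k :: d) ++ l).
  by move: ud; rewrite -cat1s catA -(perm_uniq (s1 := (k :: d) ++ l))// perm_cat2r perm_sym
    perm_catC.
have s1 : {subset d ++ l <= D}.
  by move=> y; rewrite mem_cat => yy; apply: sd; rewrite mem_cat inE; case/orP: yy => ->;
    rewrite ?orbT.
have s2 : {subset (k :: d) ++ l <= D}.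
  move=> y; rewrite mem_cat inE -orbA => yy; apply: sd; rewrite mem_cat inE.
  by case/or3P: yy => ->; rewrite ?orbT.
have h1 := IH d j.+1 u1 s1 hj.
have h2 := IH (k :: d) j u2 s2.
rewrite /= addSnnS in h2; have {}h2 := h2 hj.
set X1 := grid_mean P _ - _ in h1; set X2 := grid_mean P _ - _ in h2.
have -> : grid_mean P (fun p => \prod_(k0 <- d) a k0 p * esymm j.+1 [seq a k0 p | k0 <- k :: l]) -
    \prod_(k0 <- d) c k0 * esymm j.+1 [seq c k0 | k0 <- k :: l] = X1 + X2.
  rewrite /X1 /X2 addrACA -grid_meanD -opprD; congr (_ - _).
    by apply: eq_grid_mean => p _; rewrite big_cons /=; ring.
  by rewrite big_cons /=; ring.
apply: le_trans (ler_normD _ _) _; apply: le_trans (lerD h1 h2) _.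
have err0 : 0 <= err by apply: le_trans (hyp [::] _ _ _).
rewrite -mulrDr ler_wpM2l//= -[(size l).+2%:R]natr1; set n := (size l).+1%:R : R.
have n0 : 0 <= n by [].
rewrite !exprS mulrDl mul1r lerD//; last by rewrite lerXn2r ?nnegrE//; lra.
by rewrite ler_wpM2l// lerXn2r ?nnegrE//; lra.
Qed.

(** Bonferroni is applied to the observed events [a] and to the model [c]. The r + 1 truncated terms
    and the observed remainder each cost one comparison error, which gives r + 2; the model
    remainder occurs twice, once for itself and once as a bound for the observed one. *)
Lemma grid_mean_void (T : eqType) r P (ks : seq T) (a : T -> nat -> R) (c : T -> R) err :
  (0 < P)%N -> uniq ks ->
  (forall d : seq T, uniq d -> {subset d <= ks} -> (size d <= r.+1)%N ->
    `|grid_mean P (fun p => \prod_(k <- d) a k p) - \prod_(k <- d) c k| <= err) ->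
  (forall k p, 0 <= a k p <= 1) -> (forall k, k \in ks -> 0 <= c k <= 1) ->
  `|grid_mean P (fun p => \prod_(k <- ks) (1 - a k p)) - \prod_(k <- ks) (1 - c k)| <=
    r.+2%:R * (err * ((size ks).+1)%:R ^+ r.+1) +
    2 * ((\sum_(k <- ks) c k) ^+ r.+1 / r.+1`!%:R).
Proof.
move=> P0 uks hyp ha hc.
have err0 : 0 <= err by apply: le_trans (hyp [::] _ _ _).
set n := (size ks).+1%:R : R; have n1 : 1 <= n by rewrite ler1n.
pose ea j p := esymm j [seq a k p | k <- ks]; pose ec j := esymm j [seq c k | k <- ks].
have he j : (j <= r.+1)%N -> `|grid_mean P (ea j) - ec j| <= err * n ^+ r.+1.
  move=> hj; have := @grid_mean_esymm T (mem ks) r.+1 P a c err hyp ks [::] j uks.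
  rewrite big_nil mul1r => /(_ _ hj) h.
  rewrite (@eq_grid_mean _ _ _ (fun p => \prod_(k <- [::]) a k p * esymm j [seq a k p | k <- ks])).
    by apply: le_trans (h _) _ => //; rewrite ler_wpM2l// ler_weXn2l.
  by move=> p _; rewrite big_nil mul1r.
have ba p : `|\prod_(k <- ks) (1 - a k p) - \sum_(j < r.+1) (-1) ^+ j * ea j p| <= ea r.+1 p.
  have := @bonferroni r [seq a k p | k <- ks]; rewrite big_map; apply.
  by move=> x /mapP[k _ ->].
have bc : `|\prod_(k <- ks) (1 - c k) - \sum_(j < r.+1) (-1) ^+ j * ec j| <= ec r.+1.
  have := @bonferroni r [seq c k | k <- ks]; rewrite big_map; apply.
  by move=> x /mapP[k kks ->]; exact: hc.
have h1 : `|grid_mean P (fun p => \prod_(k <- ks) (1 - a k p)) -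
    \sum_(j < r.+1) (-1) ^+ j * grid_mean P (ea j)| <= grid_mean P (ea r.+1).
  have -> : \sum_(j < r.+1) (-1) ^+ j * grid_mean P (ea j) =
      grid_mean P (fun p => \sum_(j < r.+1) (-1) ^+ j * ea j p).
    by rewrite grid_mean_sum; apply: eq_bigr => j _; rewrite grid_meanZ.
  rewrite -mulN1r -grid_meanZ -grid_meanD; apply: le_trans (grid_mean_norm _ _) _.
  by apply: grid_mean_le => p _; rewrite mulN1r; exact: ba.
have h2 : `|\sum_(j < r.+1) (-1) ^+ j * grid_mean P (ea j) - \sum_(j < r.+1) (-1) ^+ j * ec j|
    <= r.+1%:R * (err * n ^+ r.+1).
  rewrite -sumrB; apply: le_trans (ler_norm_sum _ _ _) _.
  apply: (@le_trans _ _ (\sum_(j < r.+1) (err * n ^+ r.+1))).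
    by apply: ler_sum => j _; rewrite -mulrBr normrMsign he// ltnW.
  by rewrite sumr_const card_ord mulr_natl.
have h3 := he r.+1 (leqnn _).
have h4 : ec r.+1 <= (\sum_(k <- ks) c k) ^+ r.+1 / r.+1`!%:R.
  rewrite -(big_map c xpredT id); apply: esymm_le_exp.
  by move=> x /mapP[k /hc/andP[? _] ->].
rewrite -[r.+2%:R]natr1 mulrDl mul1r.
move: h1 h2 h3 bc; rewrite !ler_norml => /andP[? ?] /andP[? ?] /andP[? ?] /andP[? ?].
by apply/andP; split; lra.
Qed.

Lemma prod_1B_expR (T : eqType) (ks : seq T) (c : T -> R) (cmax : R) :
  (forall k, k \in ks -> 0 <= c k <= cmax) -> cmax <= 1 ->
  `|\prod_(k <- ks) (1 - c k) - expR (- \sum_(k <- ks) c k)| <= cmax * \sum_(k <- ks) c k.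
Proof.
move=> hc c1; elim: ks hc => [|k ks IH] hc.
  by rewrite !big_nil oppr0 expR0 subrr normr0 mulr0.
have /andP[k0 kc] := hc k (mem_head _ _).
have {}hc y : y \in ks -> 0 <= c y <= cmax by move=> yk; apply: hc; rewrite inE yk orbT.
have {}IH := IH hc.
rewrite !big_cons opprD expRD; set X := \prod_(j <- ks) _ in IH *;
  set S := \sum_(j <- ks) c j in IH *.
have S0 : 0 <= S by rewrite /S big_seq sumr_ge0// => y /hc/andP[].
have e1 : `|(1 - c k) - expR (- c k)| <= cmax * c k.
  have h1 := expR_ge1Dx (- c k); have h2 := expR_ge1Dx (c k).
  have h3 := expRxMexpNx_1 (c k); have h4 := expR_gt0 (- c k).
  have h5 : expR (- c k) <= 1 by rewrite expR_le1; lra.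
  rewrite ler_norml; apply/andP; split; nra.
have e2 : expR (- S) <= 1 by rewrite expR_le1; lra.
have e3 := expR_gt0 (- S).
have -> : (1 - c k) * X - expR (- c k) * expR (- S) =
   (1 - c k) * (X - expR (- S)) + ((1 - c k) - expR (- c k)) * expR (- S) by ring.
apply: le_trans (ler_normD _ _) _; rewrite [leRHS]mulrDr [leRHS]addrC lerD//.
  rewrite normrM -[leRHS]mul1r ler_pM// ger0_norm; lra.
by rewrite normrM -[leRHS]mulr1 ler_pM// ger0_norm// ltW.
Qed.

End Bonferroni.

(** * Logarithmic derivatives of the inverse function *)

Section Nondegeneracy.
Context {R : realType}.
Variables (beta b : R).
Hypotheses (beta_gt0 : 0 < beta) (beta_lt1 : beta < 1) (b_gt0 : 0 < b).
Implicit Types (t v y z : R) (j l m r : nat).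

(* For beta = 1/A and b = beta alpha^(-beta), the inverse of n |-> alpha (ln n)^A. *)
Definition stretch y : R := expR (b / beta * expR (beta * ln y)).

(** Coefficient of y^(beta l - j) in g^(j) / g. The recursion is Q_{j+1} = (g'/g) Q_j + Q_j' with
    g'/g = b y^(beta - 1): the first summand raises [l] by one, the second brings down the
    exponent. *)
Fixpoint dcoef j l : R :=
  if j is j'.+1 then
    b * (if l is l'.+1 then dcoef j' l' else 0) + (beta * l%:R - j'%:R) * dcoef j' l
  else (l == 0%N)%:R.

(* The j-th derivative of [stretch] divided by [stretch]. *)
Definition dquot j y : R :=
  \sum_(l < j.+1) dcoef j l * expR ((beta * (l : nat)%:R - j%:R) * ln y).

Lemma dcoef_gt j l : (j < l)%N -> dcoef j l = 0.
Proof.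
elim: j l => [|j IH] [|l]//= jl; rewrite IH// IH ?mulr0 ?addr0//.
by rewrite ltnW.
Qed.

Lemma dcoef_diag j : dcoef j j = b ^+ j.
Proof. by elim: j => [//|j IH] /=; rewrite IH dcoef_gt// mulr0 addr0 exprS. Qed.

Lemma is_derive_expR_ln (p y : R) : 0 < y ->
  is_derive y 1 (fun y => expR (p * ln y)) (p * expR ((p - 1) * ln y)).
Proof.
move=> y0; have d1 := is_derive1_ln y0.
have d2 : is_derive y 1 (p \*: (@ln R)) (p * y^-1) by exact: is_deriveZ.
have d3 : is_derive y 1 (expR \o (p \*: (@ln R))) (expR (p * ln y) * (p * y^-1)).
  exact: is_derive1_comp.
rewrite mulrBl mul1r expRB lnK ?posrE//.
rewrite (_ : p * (_ / _) = expR (p * ln y) * (p * y^-1))//.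
by rewrite mulrCA.
Qed.

Lemma is_derive_stretch y : 0 < y ->
  is_derive y 1 stretch (stretch y * (b * expR ((beta - 1) * ln y))).
Proof.
move=> y0; have d1 := is_derive_expR_ln beta y0.
have d2 : is_derive y 1 ((b / beta) \*: (fun y => expR (beta * ln y)))
   (b / beta * (beta * expR ((beta - 1) * ln y))) by exact: is_deriveZ.
have d3 : is_derive y 1 (expR \o ((b / beta) \*: (fun y => expR (beta * ln y))))
    (stretch y * (b / beta * (beta * expR ((beta - 1) * ln y)))).
  exact: is_derive1_comp.
by rewrite [b / beta * (_ * _)]mulrA divfK ?gt_eqF// in d3.
Qed.

Lemma is_derive_stretch_dquot j y : 0 < y ->
  is_derive y 1 (fun y => stretch y * dquot j y) (stretch y * dquot j.+1 y).
Proof.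
move=> y0; have d1 := is_derive_stretch y0.
pose q l := beta * l%:R - j%:R.
have d2 : is_derive y 1 (\sum_(l < j.+1) (dcoef j l \*: (fun y => expR (q l * ln y))))
    (\sum_(l < j.+1) (dcoef j l * (q l * expR ((q l - 1) * ln y)))).
  apply: is_derive_sum => l; apply: is_deriveZ; exact: is_derive_expR_ln.
have dE z : (\sum_(l < j.+1) (dcoef j l \*: (fun y => expR (q l * ln y)))) z = dquot j z.
  by rewrite fct_sumE.
have -> : (fun y => stretch y * dquot j y) =
    stretch * (\sum_(l < j.+1) (dcoef j l \*: (fun y => expR (q l * ln y)))).
  by apply/funext => z; rewrite -dE.
apply: is_derive_eq; rewrite dE /GRing.scale/=.
rewrite mulrCA -mulrDr; congr (_ * _).
rewrite {2}/dquot.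
under [RHS]eq_bigr do rewrite /= mulrDl.
rewrite big_split /= addrC; congr (_ + _); last first.
  rewrite [RHS]big_ord_recl/= mulr0 mul0r add0r /dquot big_distrl/=.
  apply: eq_bigr => l _; rewrite /bump/= add1n.
  rewrite (_ : (beta * l.+1%:R - j.+1%:R) * ln y =
    (beta * l%:R - j%:R) * ln y + (beta - 1) * ln y); last by rewrite -!natr1; ring.
  by rewrite expRD; ring.
rewrite [RHS]big_ord_recr/= dcoef_gt// mulr0 mul0r addr0.
apply: eq_bigr => l _.
rewrite (_ : (q l - 1) * ln y = (beta * l%:R - j.+1%:R) * ln y).
  by rewrite /q mulrA (mulrC (dcoef _ _)).
by rewrite /q -natr1; ring.
Qed.

(* The r-th derivative in v of [dquot j (Y e^v)], normalised; t = Y^(-beta), and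
   as t and v tend to 0 it converges to ((beta - 1) j)^r. *)
Definition dscaled t j r v : R := \sum_(l < j.+1)
  dcoef j l / b ^+ j * t ^+ (j - l) * (beta * (l : nat)%:R - j%:R) ^+ r *
  expR ((beta * (l : nat)%:R - j%:R) * v).

Lemma is_derive_dscaled t j r v :
  is_derive v 1 (dscaled t j r) (dscaled t j r.+1 v).
Proof.
pose q l := beta * l%:R - j%:R.
pose c l := dcoef j l / b ^+ j * t ^+ (j - l) * q l ^+ r.
have -> : dscaled t j r = \sum_(l < j.+1) (c l \*: (fun v => expR (q l * v))).
  by apply/funext => z; rewrite fct_sumE.
have -> : dscaled t j r.+1 v = \sum_(l < j.+1) c l * (q l * expR (q l * v)).
  by apply: eq_bigr => l _; rewrite /c exprSr -!mulrA.
apply: is_derive_sum => l; apply: is_deriveZ.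
have d1 : is_derive v 1 (q l \*: id) (q l * 1) by exact: is_deriveZ.
have d2 : is_derive v 1 (expR \o (q l \*: id)) (expR (q l * v) * (q l * 1)).
  exact: is_derive1_comp.
by rewrite mulr1 mulrC in d2.
Qed.

Lemma dquotE (Y : R) j v : 0 < Y ->
  dquot j (Y * expR v) =
  b ^+ j * expR (((beta - 1) * j%:R) * ln Y) * dscaled (expR (- (beta * ln Y))) j 0 v.
Proof.
move=> Y0; rewrite /dquot /dscaled big_distrr/=; apply: eq_bigr => l _.
rewrite lnM ?posrE ?expR_gt0// expRK expr0 mulr1 mulrDr expRD.
have bj : b ^+ j != 0 by rewrite expf_neq0// gt_eqF.
have lj : (l <= j)%N by rewrite -ltnS.
have -> : expR (- (beta * ln Y)) ^+ (j - l) = expR (- (beta * ln Y) * (j%:R - l%:R)).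
  by rewrite -natrB// expRM_natr.
rewrite (_ : (beta * l%:R - j%:R) * ln Y = ((beta - 1) * j%:R) * ln Y +
  - (beta * ln Y) * (j%:R - l%:R)); last by ring.
by rewrite expRD; field.
Qed.

(** Only the term l = j survives, with coefficient 1; the others carry a factor t^(j - l) <= t. As
    beta < 1 the exponents are nonpositive, so for v >= 0 the exponentials are at most 1 and differ
    from 1 by O(v). *)
Lemma dscaled_near m : exists2 C, 0 < C & forall j r t v, (j <= m)%N -> (r <= m)%N ->
  0 <= t <= 1 -> 0 <= v -> `|dscaled t j r v - ((beta - 1) * j%:R) ^+ r| <= C * (v + t).
Proof.
pose q j l := beta * l%:R - j%:R.
pose C j r := \sum_(l < j.+1) `|dcoef j l / b ^+ j * q j l ^+ r| + `|q j j ^+ r * q j j|.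
have C0 j r : 0 <= C j r by rewrite addr_ge0// sumr_ge0.
exists (\sum_(j < m.+1) \sum_(r < m.+1) C j r + 1).
  by rewrite ltr_wpDl// sumr_ge0// => j _; rewrite sumr_ge0.
move=> j r t v jm rm /andP[t0 t1] v0.
apply: (@le_trans _ _ (C j r * (v + t))); last first.
  rewrite ler_wpM2r ?addr_ge0//.
  have h1 : C j r <= \sum_(r' < m.+1) C j r'.
    by rewrite (bigD1 (Ordinal (rm : r < m.+1)%N))//= lerDl sumr_ge0.
  have h2 : \sum_(r' < m.+1) C j r' <= \sum_(j' < m.+1) \sum_(r' < m.+1) C j' r'.
    rewrite [leRHS](bigD1 (Ordinal (jm : j < m.+1)%N))//= lerDl sumr_ge0// => i _.
    by rewrite sumr_ge0.
  by apply: (le_trans h1); apply: (le_trans h2); rewrite lerDl.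
have qE : q j j = (beta - 1) * j%:R by rewrite /q; ring.
have q0 l : (l <= j)%N -> q j l <= 0.
  move=> lj; rewrite /q subr_le0; apply: (@le_trans _ _ l%:R).
    by rewrite -[leRHS]mul1r ler_wpM2r// ltW.
  by rewrite ler_nat.
have e0 l : (l <= j)%N -> 0 <= expR (q j l * v) <= 1.
  by move=> lj; rewrite expR_ge0 expR_le1 mulr_le0_ge0// q0.
rewrite /dscaled big_ord_recr/= subnn expr0 mulr1 dcoef_diag divff ?mul1r ?expf_neq0 ?gt_eqF//.
rewrite -qE -addrA -[X in _ + (_ - X)]mulr1 -mulrBr.
apply: le_trans (ler_normD _ _) _.
rewrite /C [leRHS]mulrDl lerD//; last first.
  rewrite !normrM -mulrA ler_wpM2l//.
  have /andP[_ e1] := e0 j (leqnn _); have e2 := expR_ge1Dx (q j j * v).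
  rewrite (ler0_norm (q0 j (leqnn _))) distrC ger0_norm ?subr_ge0//.
  have := q0 j (leqnn _); nra.
apply: le_trans (ler_norm_sum _ _ _) _.
rewrite big_distrl big_ord_recr/=; apply: ler_wpDr.
  by rewrite mulr_ge0// addr_ge0.
apply: ler_sum => l _.
have /andP[e1 e2] := e0 l (ltnW (ltn_ord l)).
rewrite [X in `|X| <= _](_ : _ = dcoef j l / b ^+ j * q j l ^+ r *
  (t ^+ (j - l) * expR (q j l * v)));
  last by rewrite /q; ring.
rewrite normrM ler_wpM2l// ger0_norm ?mulr_ge0 ?exprn_ge0//.
apply: (@le_trans _ _ t); last by rewrite lerDr.
rewrite -[leRHS]mulr1 ler_pM ?exprn_ge0// ler_iXnr// subn_gt0; exact: ltn_ord.
Qed.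

End Nondegeneracy.

(** * Kernel vectors and Vandermonde systems *)

Section LinearAlgebra.
Context {R : realType}.

Lemma exists_left_kernel n (E : 'M[R]_(n.+1, n)) : exists Gam : 'I_n.+1 -> R,
  [/\ forall j, `|Gam j| <= 1, exists j, `|Gam j| = 1 &
      forall i, \sum_j Gam j * E j i = 0].
Proof.
pose u := nz_row (kermx E).
have u0 : u != 0.
  rewrite nz_row_eq0 kermx_eq0; apply/negP => /eqP rE.
  by have := rank_leq_col E; rewrite rE ltnn.
have uE : u *m E = 0 by apply/sub_kermxP; exact: nz_row_sub.
have [j0 _ j0max] := @arg_maxP _ R 'I_n.+1 ord0 xpredT (fun j => `|u 0 j|) isT.
have M0 : 0 < `|u 0 j0|.
  rewrite lt_neqAle normr_ge0 andbT eq_sym; apply: contra u0 => /eqP uj.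
  apply/eqP/rowP => j; rewrite mxE; apply/eqP; rewrite -normr_le0 -uj.
  exact: j0max.
exists (fun j => u 0 j / `|u 0 j0|); split.
- move=> j; rewrite normrM normfV normr_id ler_pdivrMr// mul1r; exact: j0max.
- by exists j0; rewrite normrM normfV normr_id divff// gt_eqF.
- move=> i; have /rowP/(_ i) := uE; rewrite !mxE => e.
  under eq_bigr do rewrite mulrAC.
  by rewrite -big_distrl/= e mul0r.
Qed.

(** A vector with an entry of modulus 1 cannot have a tiny image under an invertible matrix; the sum
    of the entries of the inverse gives a [K] that depends on the nodes only. *)
Lemma vandermonde_lower n (tau : 'I_n -> R) : injective tau ->
  exists2 K, 0 < K & forall Gam : 'I_n -> R, (exists j, `|Gam j| = 1) ->
    exists r : 'I_n, 1 <= K * `|\sum_j Gam j * tau j ^+ r|.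
Proof.
move=> inj; pose V := Vandermonde n (\row_j tau j).
have uV : V \in unitmx.
  rewrite unitmxE det_Vandermonde unitfE; apply/prodf_neq0 => i _.
  apply/prodf_neq0 => j ij; rewrite !mxE subr_eq0.
  by apply: contraTneq ij => /inj ->; rewrite ltnn.
pose K := \sum_i \sum_j `|invmx V i j| + 1.
have K0 : 0 < K.
  by rewrite ltr_wpDl// sumr_ge0// => i _; rewrite sumr_ge0.
exists K => // Gam [j Gj].
have [r _ rmax] := @arg_maxP _ R 'I_n j xpredT (fun r => `|\sum_j Gam j * tau j ^+ r|) isT.
exists r; set w := fun r : 'I_n => _ in rmax *.
have wE : V *m (\col_j Gam j) = \col_r (\sum_j Gam j * tau j ^+ r).
  by apply/colP => i; rewrite !mxE; apply: eq_bigr => k _; rewrite !mxE mulrC.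
have := congr1 (mulmx (invmx V)) wE; rewrite mulKmx// => /colP/(_ j).
rewrite !mxE => e; rewrite -Gj e.
apply: le_trans (ler_norm_sum _ _ _) _.
apply: (@le_trans _ _ (\sum_k `|invmx V j k| * `|\sum_j Gam j * tau j ^+ r|)).
  by apply: ler_sum => k _; rewrite normrM !mxE ler_wpM2l//; exact: rmax.
rewrite -big_distrl/= ler_wpM2r//.
apply: (@le_trans _ _ (\sum_i \sum_k `|invmx V i k|)); last by rewrite /K lerDl.
by rewrite [leRHS](bigD1 j)//= lerDl sumr_ge0// => i _; rewrite sumr_ge0.
Qed.

End LinearAlgebra.

Section Nondegeneracy.
Context {R : realType}.
Variables (beta b : R).
Hypotheses (beta_gt0 : 0 < beta) (beta_lt1 : beta < 1) (b_gt0 : 0 < b).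

(* Choose Gam so that F = sum_j Gam_j dscaled_j vanishes on s.  By Rolle the
   derivatives of F of order < n vanish near 0, so the Vandermonde system forces
   the n-th one to be bounded below, and F z is then an interpolation remainder. *)
Lemma dscaled_separating n : exists c0 eta t0 : R,
  [/\ 0 < c0, 0 < eta, eta <= 1 & 0 < t0] /\
  forall t (s : seq R) z, 0 <= t <= t0 -> uniq s -> size s = n ->
    {in s, forall x, 0 <= x <= eta} -> 0 <= z <= eta -> z \notin s ->
  exists Gam : 'I_n.+1 -> R, [/\ forall j, `|Gam j| <= 1,
    {in s, forall x, \sum_j Gam j * dscaled beta b t j.+1 0 x = 0} &
    c0 * \prod_(x <- s) `|z - x| <= `|\sum_j Gam j * dscaled beta b t j.+1 0 z|].
Proof.
pose tau (j : 'I_n.+1) := (beta - 1) * j.+1%:R.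
have itau : injective tau.
  move=> i j /mulfI e; apply/val_inj/eqP; rewrite -eqSS -(eqr_nat R) e//.
  by rewrite subr_eq0 lt_eqF.
have [K K0 hK] := vandermonde_lower itau.
have [C C0 hC] := dscaled_near beta_lt1 b_gt0 n.+1.
(* Chosen so that n + 1 errors, each at most C (eta + eta), add up to at most half of K^-1. *)
pose eta := Num.min 1 (K^-1 / (4 * n.+1%:R * C)).
have den0 : 0 < 4 * n.+1%:R * C by rewrite !mulr_gt0.
have eta0 : 0 < eta by rewrite lt_min ltr01 divr_gt0// invr_gt0.
have eta1 : eta <= 1 by rewrite ge_min lexx.
exists (K^-1 / 2 / n`!%:R), eta, eta; split.
  by split => //; rewrite !divr_gt0 ?invr_gt0 ?ltr0n ?fact_gt0.
move=> t s z /andP[t_ge0 t_le] us ss hs hz zs.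
have t1 : 0 <= t <= 1 by rewrite t_ge0 (le_trans t_le).
have [Gam [G1 Gj Gs]] := @exists_left_kernel R n
  (\matrix_(j, i) dscaled beta b t j.+1 0 (nth 0 s i)).
pose F r v := \sum_j Gam j * dscaled beta b t j.+1 r v.
have zeros : {in s, forall x, F 0%N x = 0}.
  move=> x xs; have xi : (index x s < n)%N by rewrite -ss index_mem.
  rewrite /F -[RHS](Gs (Ordinal xi)).
  by apply: eq_bigr => j _; rewrite mxE/= nth_index.
exists Gam; split => //.
have dF j x : 0 <= x <= eta -> is_derive x 1 (F j) (F j.+1 x).
  move=> _; have -> : F j = \sum_k (Gam k \*: dscaled beta b t k.+1 j).
    by apply/funext => v; rewrite fct_sumE.
  by apply: is_derive_sum => k; apply: is_deriveZ; exact: is_derive_dscaled.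
have near (r : nat) v : (r <= n)%N -> 0 <= v <= eta ->
    `|F r v - \sum_j Gam j * tau j ^+ r| <= K^-1 / 2.
  move=> rn /andP[v0 ve]; rewrite -sumrB; apply: le_trans (ler_norm_sum _ _ _) _.
  apply: (@le_trans _ _ (\sum_(j < n.+1) (C * (eta + eta)))).
    apply: ler_sum => j _; rewrite -mulrBr normrM -[leRHS]mul1r ler_pM//.
    apply: le_trans (hC _ _ _ _ _ _ _ _) _ => //; first exact: leqW.
    by rewrite ler_wpM2l ?(ltW C0)// lerD.
  rewrite sumr_const card_ord -[X in X <= _]mulr_natl.
  have : eta <= K^-1 / (4 * n.+1%:R * C) by rewrite ge_min lexx orbT.
  rewrite ler_pdivlMr// => h; lra.
have [r] := hK Gam Gj; rewrite mulrC -ler_pdivrMr// mul1r => hr.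
have rn : (r <= n)%N by rewrite -ltnS.
(* For r < n, Rolle on r + 1 of the zeros gives a zero of the r-th derivative, against the lower
   bound [hr]; so r = n. *)
have [lt_rn|ge_rn] := ltnP r n.
  have [|||c cab Fc] := @Rolle_iter_seq R F (take r.+1 s) r 0 eta dF (take_uniq _ us).
  - by rewrite size_takel// ss.
  - by move=> x /mem_take/hs.
  - by move=> x /mem_take/zeros.
  have := near r c rn cab; rewrite Fc sub0r normrN.
  have : 0 < K^-1 by rewrite invr_gt0.
  lra.
have en : r = n :> nat by apply/eqP; rewrite eqn_leq rn.
have [c cab e0] := interpolation_remainder dF us hs zeros hz zs.
rewrite -[X in _ <= `|X|]/(F 0%N z) e0.
rewrite ss !normrM normfV normr_prod (ger0_norm (ler0n _ _)).
rewrite ler_wpM2r ?prodr_ge0// ler_wpM2r ?invr_ge0//.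
have := near n c (leqnn _) cab; rewrite en in hr.
have := lerB_dist (\sum_j Gam j * tau j ^+ n) (F n c); rewrite distrC.
have e : K^-1 - K^-1 / 2 = K^-1 / 2 by field; rewrite gt_eqF.
lra.
Qed.

Lemma ln_sub_ge (x y : R) : 0 < x -> x <= y -> (y - x) / y <= ln y - ln x.
Proof.
move=> x0 xy; have y0 : 0 < y by exact: lt_le_trans xy.
have e : ln x - ln y = ln (x / y) by rewrite ln_div ?posrE.
have := @le_ln1Dx R (x / y - 1); rewrite (_ : 1 + (x / y - 1) = x / y); last by ring.
rewrite -e => h.
have : -1 < x / y - 1 by have := divr_gt0 x0 y0; lra.
by move=> /h; rewrite mulrBl divff ?gt_eqF//; lra.
Qed.

(** A combination [Gam] of the derivatives that vanishes at all points but [y i0] isolates the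
    weight [w i0], so one derivative is large. In logarithmic coordinates the points are 1/(2Y)
    apart, which costs Y^-n; undoing the scaling costs at most Y^-(n+1), and the total is rounded to
    Y^-(2n+2). *)
Lemma dquot_nondegenerate n : exists c eta Y0 : R,
  [/\ 0 < c, 0 < eta, eta <= 1 & 1 <= Y0] /\
  forall Y (y w : 'I_n.+1 -> R) i0, Y0 <= Y ->
    (forall i, Y <= y i <= (1 + eta) * Y) ->
    (forall i k, i != k -> 1 <= `|y i - y k|) ->
  exists j : 'I_n.+1, c * Y ^- (2 * n.+1) * `|w i0| <=
    `|\sum_i w i * dquot beta b j.+1 (y i)|.
Proof.
have [c0 [eta [t0 [[c0_gt0 eta0 eta1 t0_gt0] main]]]] := dscaled_separating n.
(* A lower bound for b^(j+1), uniform in j <= n. *)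
pose bm := Num.min 1 b ^+ n.+1.
have m0 : 0 < Num.min 1 b by rewrite lt_min ltr01.
have bm0 : 0 < bm by rewrite exprn_gt0.
(* The threshold on Y is what makes t = Y^(-beta) at most [t0]. *)
exists (c0 / n.+1%:R / 2 ^+ n * bm), eta, (Num.max 1 (expR (- ln t0 / beta))).
split; first by split; rewrite ?le_max ?lexx// mulr_gt0 ?divr_gt0// exprn_gt0.
move=> Y y w i0; rewrite ge_max => /andP[Y1 Yt] hy hsep.
have Y0 : 0 < Y by apply: lt_le_trans Y1.
have y0 i : 0 < y i by have /andP[h _] := hy i; exact: lt_le_trans h.
pose t := expR (- (beta * ln Y)).
have ht : 0 <= t <= t0.
  rewrite expR_ge0 -[leRHS]lnK ?posrE// ler_expR.
  move: Yt; rewrite -[leRHS]lnK ?posrE// ler_expR ler_pdivrMr//; lra.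
pose v i := ln (y i) - ln Y.
have yE i : y i = Y * expR (v i).
  by rewrite /v expRB !lnK ?posrE// mulrC divfK// gt_eqF.
have v_rng i : 0 <= v i <= eta.
  have /andP[h1 h2] := hy i; apply/andP; split; first by rewrite subr_ge0 ler_ln ?posrE.
  rewrite /v lerBlDr; apply: (@le_trans _ _ (ln ((1 + eta) * Y))).
    by rewrite ler_ln ?posrE// mulr_gt0//; lra.
  rewrite lnM ?posrE//; last by lra.
  by rewrite lerD2r le_ln1Dx//; lra.
have v_sep i k : i != k -> (2 * Y)^-1 <= `|v i - v k|.
  have aux p q : 1 <= `|y p - y q| -> y p <= y q -> (2 * Y)^-1 <= `|v p - v q|.
    move=> d le; rewrite /v (_ : ln (y p) - _ - _ = ln (y p) - ln (y q)); last by ring.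
    rewrite distrC ger0_norm ?subr_ge0 ?ler_ln ?posrE//.
    apply: le_trans (ln_sub_ge (y0 p) le).
    rewrite ler_pdivlMr// mulrC ler_pdivrMr ?mulr_gt0//.
    move: d; rewrite distrC ger0_norm ?subr_ge0// => d.
    have /andP[_ h2] := hy q; apply: (@le_trans _ _ (2 * Y)); first by nra.
    by rewrite -[leLHS]mul1r ler_wpM2r// mulr_ge0// ltW.
  move=> ik; have [le|/ltW le] := leP (y i) (y k); first exact: aux (hsep _ _ ik) le.
  by rewrite distrC; apply: aux le; rewrite distrC hsep.
have vinj : injective v.
  move=> i k e; apply/eqP/negPn/negP => /v_sep; rewrite e subrr normr0.
  by apply/negP; rewrite -ltNge invr_gt0 mulr_gt0.
pose s := [seq v i | i <- enum 'I_n.+1 & i != i0].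
have size_s : size s = n.
  by rewrite size_map -(rem_filter i0 (enum_uniq _)) size_rem ?mem_enum// size_enum_ord.
have us : uniq s by rewrite map_inj_uniq// filter_uniq// enum_uniq.
have sv : {in s, forall x, 0 <= x <= eta} by move=> x /mapP[i _ ->].
have ns : v i0 \notin s.
  by apply/mapP => -[k]; rewrite mem_filter => /andP[ne _] /vinj e; rewrite e eqxx in ne.
have [Gam [G1 Gs Gz]] := main t s (v i0) ht us size_s sv (v_rng i0) ns.
pose S (j : 'I_n.+1) := \sum_i w i * dscaled beta b t j.+1 0 (v i).
have [j _ jmax] := @arg_maxP _ R 'I_n.+1 ord0 xpredT (fun j => `|S j|) isT.
exists j.
have prod_ge : ((2 * Y)^-1) ^+ n <= \prod_(x <- s) `|v i0 - x|.
  have -> : ((2 * Y)^-1) ^+ n = \prod_(x <- s) (2 * Y)^-1.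
    by rewrite big_const_seq count_predT size_s iter_mulr_1.
  rewrite big_seq [leRHS]big_seq; apply: ler_prod => x.
  move=> /mapP[k]; rewrite mem_filter => /andP[ne _] ->.
  by rewrite invr_ge0 mulr_ge0 ?(ltW Y0)//= v_sep// eq_sym.
have lower : c0 * ((2 * Y)^-1) ^+ n * `|w i0| <= n.+1%:R * `|S j|.
  apply: (@le_trans _ _ `|\sum_j Gam j * S j|); last first.
    apply: le_trans (ler_norm_sum _ _ _) _.
    apply: (@le_trans _ _ (\sum_(k < n.+1) `|S j|)).
      by apply: ler_sum => k _; rewrite normrM -[leRHS]mul1r ler_pM//; exact: jmax.
    by rewrite sumr_const card_ord mulr_natl.
  have -> : \sum_j Gam j * S j = w i0 * \sum_j Gam j * dscaled beta b t j.+1 0 (v i0).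
    under eq_bigr do rewrite /S big_distrr/=.
    rewrite exchange_big (bigD1 i0)//= [X in _ + X]big1 ?addr0.
      by rewrite big_distrr/=; apply: eq_bigr => k _; ring.
    move=> i ne; have vi : v i \in s by apply: map_f; rewrite mem_filter ne mem_enum.
    rewrite -[RHS](mulr0 (w i)) -[X in _ = _ * X](Gs _ vi) big_distrr/=; apply: eq_bigr => k _;
      ring.
  rewrite normrM mulrC ler_wpM2l//; apply: le_trans Gz.
  by rewrite ler_wpM2l// ltW.
have -> : \sum_i w i * dquot beta b j.+1 (y i) =
    b ^+ j.+1 * expR ((beta - 1) * j.+1%:R * ln Y) * S j.
  rewrite /S big_distrr/=; apply: eq_bigr => i _.
  by rewrite yE dquotE// mulrCA.
rewrite !normrM normrX (gtr0_norm b_gt0) (gtr0_norm (expR_gt0 _)).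
have Yi0 : 0 < Y^-1 by rewrite invr_gt0.
have Yi1 : Y^-1 <= 1 by rewrite invf_le1.
have a1 : bm <= b ^+ j.+1.
  apply: (@le_trans _ _ (Num.min 1 b ^+ j.+1)).
    by apply: ler_wiXn2l; rewrite ?(ltW m0)// ge_min lexx.
  by rewrite lerXn2r ?nnegrE ?(ltW m0) ?(ltW b_gt0)// ge_min lexx orbT.
have a2 : Y^-1 ^+ n.+1 <= expR ((beta - 1) * j.+1%:R * ln Y).
  rewrite -[X in X ^+ _]lnK ?posrE// lnV ?posrE// -expRM_natl ler_expR.
  have l0 : 0 <= ln Y by rewrite ln_ge0.
  rewrite mulrN -mulNr ler_wpM2r//.
  have h1 : j.+1%:R <= n.+1%:R :> R by rewrite ler_nat.
  have h2 : 0 <= beta * j.+1%:R by rewrite mulr_ge0// ltW.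
  lra.
have a3 : c0 / n.+1%:R / 2 ^+ n * Y^-1 ^+ n.+1 * `|w i0| <= `|S j|.
  move: lower; rewrite [leRHS]mulrC -ler_pdivrMr// => /(le_trans _); apply.
  rewrite invfM exprMn (exprVn 2) exprS.
  rewrite [leRHS](_ : _ = c0 / n.+1%:R / 2 ^+ n * (Y^-1 ^+ n) * `|w i0|); last by ring.
  rewrite ler_wpM2r// ler_wpM2l// ?divr_ge0 ?exprn_ge0 ?(ltW c0_gt0)//.
  by rewrite ler_piMl// exprn_ge0// ltW.
have z1 : 0 <= c0 / n.+1%:R / 2 ^+ n * Y^-1 ^+ n.+1 * `|w i0|.
  by rewrite !mulr_ge0 ?invr_ge0 ?exprn_ge0 ?(ltW c0_gt0) ?(ltW Yi0).
have h1 : bm * Y^-1 ^+ n.+1 <= b ^+ j.+1 * expR ((beta - 1) * j.+1%:R * ln Y).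
  by rewrite ler_pM ?(ltW bm0) ?exprn_ge0 ?(ltW Yi0).
apply: le_trans (ler_pM _ z1 h1 a3); last by rewrite mulr_ge0 ?(ltW bm0)// exprn_ge0 ?(ltW Yi0).
rewrite -(exprVn Y) mul2n -addnn exprD le_eqVlt; apply/orP; left; apply/eqP; ring.
Qed.

End Nondegeneracy.

(** * Exponential sums along the inverse function *)

Section ExponentialSums.
Context {R : realType}.
Variables (beta b : R).
Hypotheses (beta_gt0 : 0 < beta) (beta_lt1 : beta < 1) (b_gt0 : 0 < b).
Local Notation g := (stretch beta b).
Local Notation q := (dquot beta b).

Lemma dquot_bound m : exists2 C, 1 <= C & forall j y, (j <= m)%N -> 1 <= y -> `|q j y| <= C.
Proof.
exists (\sum_(j < m.+1) \sum_(l < j.+1) `|dcoef beta b j l| + 1).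
  by rewrite lerDr sumr_ge0// => j _; rewrite sumr_ge0.
move=> j y jm y1.
apply: (@le_trans _ _ (\sum_(l < j.+1) `|dcoef beta b j l|)).
  apply: le_trans (ler_norm_sum _ _ _) _; apply: ler_sum => l _.
  rewrite normrM -[leRHS]mulr1 ler_wpM2l// gtr0_norm ?expR_gt0// expR_le1.
  rewrite mulr_le0_ge0 ?ln_ge0// subr_le0.
  apply: (@le_trans _ _ l%:R); last by rewrite ler_nat -ltnS.
  by rewrite -[leRHS]mul1r ler_wpM2r// ltW.
rewrite (bigD1 (Ordinal (jm : j < m.+1)%N))//= -addrA lerDl addr_ge0// sumr_ge0// => i _.
by rewrite sumr_ge0.
Qed.

Lemma dquot0 y : q 0 y = 1.
Proof. by rewrite /dquot big_ord_recl big_ord0 /= mulr0 subr0 mul0r expR0 mulr1 addr0. Qed.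

(** [L] stands for ln N. The large derivative is at least N up to powers of L, and every parameter
    of Van der Corput's bound is a power of L, times N where needed; all losses are finally beaten
    by L^D <= N. *)
Lemma exponential_sum_polylog n e E a : exists (eta Y0 L0 : R) (D : nat),
  [/\ 0 < eta, eta <= 1 & 2 <= Y0] /\
  forall (N L Y : R) (P H : nat) (k : 'I_n.+1 -> R) (h : 'I_n.+1 -> int) (theta : R),
  L0 <= L -> L ^+ D <= N -> Y0 <= Y -> Y <= L ^+ a -> N ^+ 2 <= P%:R -> H%:R <= L ^+ e ->
  (forall i, Y <= k i /\ k i + 1 <= (1 + eta) * Y) ->
  (forall i j, i != j -> 1 <= `|k i - k j|) ->
  (forall i x, 0 <= x <= 1 -> N / L <= g (k i + x) <= 3 * N) ->
  (exists i, h i != 0) -> (forall i, (`|h i| < H)%N) ->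
  `|grid_mean P (fun p => cos (theta +
     2 * pi * \sum_i (h i)%:~R * - g (k i + p%:R / P%:R)))| <= L ^- E.
Proof.
(* The inequalities between exponents that make [D] large enough for the terms [T1], [T3] and [T4]
   below. *)
have hD x y : [/\ (e.+1 + E <= x + 2 * y + e + E + 4)%N,
    (1 + x.+1 + y + E <= x + 2 * y + e + E + 4)%N &
    (1 + 1 + x.+1 + e + y + y + E <= x + 2 * y + e + E + 4)%N] by split; lia.
have [c [eta [Y0 [[c0 eta0 eta1 Y01] nondeg]]]] := dquot_nondegenerate beta_gt0 beta_lt1 b_gt0 n.
set m := n.+1 in nondeg *.
have [Cq Cq1 hCq] := dquot_bound m.+1.
have [CM CM0 hCM] : exists2 CM : R, 0 < CM & CM = m%:R * 8 * 3 * Cq.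
  by eexists; [|reflexivity]; rewrite !mulr_gt0// (lt_le_trans ltr01).
(* [lam] is c N L^-s: the factor Y^-(2m) costs L^(2am) and g >= N/L one more power. [u0] is the
   exponent of M/lam, hence of [Q] up to one power. *)
pose s := (a * (2 * m)).+1; have [u0 hu0] : exists u0, u0 = (e + s)%N by eexists.
(* With rho = L^-r, the product of Q and rho is at most L^-(E+1); then mu is at least N L^-u, the
   final 1 in [u] absorbing the constants. *)
pose r := (u0 + E + 2)%N; have [u hu] : exists u, u = (s + r * m + 1)%N by eexists.
pose D := (u0 + 2 * u + e + E + 4)%N.
(* Each summand is a constant that a single factor L has to absorb. *)
pose L0 := 2 ^+ (m + 3) + 4 * CM + 2 ^+ m.+1 / c + 2 * CM / c + 1 : R.
exists eta, (Num.max Y0 2), L0, D; split; first by rewrite le_max lexx orbT.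
move=> N L Y P H k h theta hL hN.
rewrite ge_max => /andP[hY Y2] hYa hP hH hk hsep hg [i0 hi0] hh.
have t0 x : 0 < 2 ^+ x :> R by rewrite exprn_gt0.
have cc0 (x : R) : 0 < x -> 0 < x / c by move=> ?; rewrite divr_gt0.
have [L1 L2 L3 L4] : [/\ 2 ^+ (m + 3) <= L, 4 * CM <= L, 2 ^+ m.+1 / c <= L & 2 * CM / c + 1 <= L].
  have := t0 (m + 3)%N; have := cc0 _ (t0 m.+1); have := cc0 (2 * CM) (mulr_gt0 (ltr0Sn R 1) CM0).
  rewrite /L0 in hL; split; lra.
have Lone : 1 <= L by apply: le_trans L1; rewrite exprn_ege1// ler1n.
have Lp : 0 < L by apply: lt_le_trans Lone.
have Lx x : 0 < L ^+ x by rewrite exprn_gt0.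
have Lm x y : (x <= y)%N -> L ^+ x <= L ^+ y by move=> ?; rewrite ler_weXn2l.
have Np : 0 < N by apply: lt_le_trans hN.
have Hp : (0 < H)%N by apply: leq_ltn_trans (hh i0).
have Pp : (0 < P)%N by rewrite -(ltr0n R) (lt_le_trans _ hP)// exprn_gt0.
have Ppos : 0 < P%:R :> R by rewrite ltr0n.
pose cf i : R := - (2 * pi * (h i)%:~R).
pose F (j : nat) (x : R) : R := (if j is 0 then theta else 0) +
  \sum_i cf i * (g (k i + x) * q j (k i + x)).
have Fe p : theta + 2 * pi * \sum_i (h i)%:~R * - g (k i + p) = F 0%N p.
  rewrite /F big_distrr; congr (_ + _); apply: eq_bigr => i _ /=.
  by rewrite dquot0 /cf; ring.
have pi4 : (pi : R) <= 4 by have := pihalf_lt2 R; lra.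
have pi2 : 2 <= (pi : R) := pi_ge2 R.
have cf_le i : `|cf i| <= 8 * L ^+ e.
  rewrite /cf normrN normrM (ger0_norm (mulr_ge0 _ (pi_ge0 R)))// ler_pM//.
  - by rewrite mulr_ge0// pi_ge0.
  - lra.
  apply: le_trans hH; rewrite -intr_norm -natr_absz ler_nat; exact: ltnW.
have cf_ge : 1 <= `|cf i0|.
  rewrite /cf normrN normrM (ger0_norm (mulr_ge0 _ (pi_ge0 R)))//.
  have : 1 <= `|(h i0)%:~R| :> R by rewrite -intr_norm -natr_absz ler1n absz_gt0.
  by nra.
pose M := CM * L ^+ e * N.
pose lam := c * L ^- s * N.
have lam0 : 0 < lam by rewrite !mulr_gt0// invr_gt0.
have yrng i (x : R) : 0 <= x <= 1 -> Y <= k i + x <= (1 + eta) * Y.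
  by move=> /andP[x0 x1]; have [k1 k2] := hk i; apply/andP; split; lra.
pose z := 2 * M / lam.
pose Q := (Num.truncn z).+1.
have M0 : 0 < M by rewrite (mulr_gt0 (mulr_gt0 CM0 (Lx e)) Np).
have z0 : 0 <= z by rewrite divr_ge0 ?(ltW lam0)// mulr_ge0// ltW.
have hzQ : z <= Q%:R by apply/ltW; have /andP[] := truncn_itv z0.
have Qp : 0 < Q%:R :> R by rewrite ltr0n.
have hQ : M / Q%:R <= lam / 2.
  rewrite ler_pdivrMr//; move: hzQ; rewrite /z ler_pdivrMr// => ?; lra.
have Qle : Q%:R <= L ^+ u0.+1.
  have e1 : z = 2 * CM / c * L ^+ u0.
    rewrite /z /M /lam hu0 exprD; field; rewrite !gt_eqF//.
  have : Q%:R <= z + 1 by rewrite /Q -natr1 lerD2r; have /andP[] := truncn_itv z0.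
  move=> /le_trans; apply; rewrite e1 exprS.
  have := ler_wpM2r (ltW (Lx u0)) L4; have : 1 <= L ^+ u0 by rewrite exprn_ege1.
  lra.
pose rho := L ^- r.
have rho0 : 0 < rho by rewrite invr_gt0.
have rho1 : rho <= 1 by rewrite invf_le1 ?exprn_ege1.
have bound := @exponential_sum_bound R m F Q P M lam rho isT Pp lam0 _ hQ.
have {bound} := bound (introT andP (conj rho0 rho1)).
have chain j (x : R) : -1 <= x <= 2 -> is_derive x 1 (F j) (F j.+1 x).
  move=> /andP[x1 x2].
  pose sh i : R -> R := fun y => k i + y.
  have -> : F j = cst (if j is 0 then theta else 0) +
      \sum_i (cf i \*: ((fun y => g y * q j y) \o sh i)).
    by apply/funext => y; rewrite /F !fctE fct_sumE.
  apply: is_deriveD.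
  apply: is_derive_sum => i; apply: is_deriveZ.
  have y0 : 0 < k i + x by have [? _] := hk i; lra.
  have d1 : is_derive (sh i x) 1 (fun y => g y * q j y)
     (g (k i + x) * q j.+1 (k i + x)) by exact: is_derive_stretch_dquot.
  have d2 : is_derive x 1 (sh i) (0 + 1).
    exact: (@is_deriveD _ _ _ (cst (k i)) id).
  rewrite add0r in d2.
  by have := is_derive1_comp d1 d2; rewrite mulr1.
have gb i (x : R) : 0 <= x <= 1 -> N / L <= g (k i + x) <= 3 * N.
  exact: hg.
have Mbound j (x : R) : (0 < j <= m.+1)%N -> 0 <= x <= 1 -> `|F j x| <= M.
  case: j => // j /andP[_ jm] x01; rewrite /F add0r.
  apply: le_trans (ler_norm_sum _ _ _) _.
  apply: (@le_trans _ _ (\sum_(i < m) (8 * L ^+ e * (3 * N * Cq)))).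
    apply: ler_sum => i _; rewrite normrM ler_pM// normrM ler_pM//.
      by have /andP[_] := gb i x x01; rewrite gtr0_norm// expR_gt0.
    by apply: hCq => //; have /andP[? _] := yrng i x x01; lra.
  rewrite sumr_const card_ord -[X in X <= _]mulr_natl /M hCM.
  by rewrite le_eqVlt; apply/orP; left; apply/eqP; ring.
have lower (x : R) : 0 <= x <= 1 -> exists2 j, (0 < j <= m)%N & lam <= `|F j x|.
  move=> x01.
  have [||j hj] := nondeg Y (fun i => k i + x) (fun i => cf i * g (k i + x)) i0 hY.
  - by move=> i; exact: yrng.
  - by move=> i j /hsep; rewrite (_ : k i + x - (k j + x) = k i - k j)//; ring.
  exists j.+1; first by rewrite ltn_ord.
  rewrite /F add0r; under eq_bigr do rewrite mulrA.
  apply: le_trans hj.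
  have [g1 g2] : N / L <= g (k i0 + x) /\ g (k i0 + x) <= 3 * N by apply/andP/gb.
  have i1 : L ^- (a * (2 * m)) <= Y ^- (2 * m).
    by rewrite exprM lef_pV2 ?posrE ?exprn_gt0//; [rewrite lerXn2r ?nnegrE ?exprn_ge0//; lra|lra].
  have i2 : N / L <= `|cf i0| * g (k i0 + x).
    by apply: (le_trans g1); rewrite ler_peMl// (le_trans _ g1)// divr_ge0 ?ltW.
  have i3 : 0 <= L ^- (a * (2 * m)) by rewrite invr_ge0 exprn_ge0// ltW.
  have i4 : 0 <= N / L by rewrite divr_ge0 ?ltW.
  rewrite normrM (gtr0_norm (expR_gt0 _)) -mulrA.
  rewrite (_ : lam = c * (L ^- (a * (2 * m)) * (N / L))).
    by rewrite ler_wpM2l ?(ltW c0)// ler_pM.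
  by rewrite /lam /s exprS; field; rewrite !gt_eqF.
move=> /(_ chain Mbound lower)/=.
rewrite (eq_grid_mean (g := fun p => cos (F 0%N (p%:R / P%:R)))); last by move=> p _; rewrite Fe.
rewrite -/(grid_mean P (fun p => cos (F 0%N (p%:R / P%:R)))).
set mu := lam / 2 * _; move=> bound; apply: (le_trans bound).
have mu_ge : N * L ^- u <= mu.
  pose X := N / L ^+ s / (L ^+ r) ^+ m.
  have X0 : 0 <= X.
    by apply/ltW; rewrite /X divr_gt0 ?divr_gt0 ?exprn_gt0.
  have e1 : mu = c / 2 / 2 ^+ m * X.
    rewrite /mu /lam /rho /X exprMn !exprVn; field.
    by rewrite !expf_neq0 ?gt_eqF.
  have e2 : N * L ^- u = L^-1 * X.
    by rewrite hu !exprD expr1 exprM /X; field; rewrite !expf_neq0 ?gt_eqF.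
  rewrite e1 e2 ler_wpM2r// -[leRHS]invrK lef_pV2 ?posrE ?invr_gt0 ?divr_gt0//.
  by move: L3; rewrite !invfM !invrK exprS; lra.
have NL0 : 0 < N * L ^- u by rewrite mulr_gt0// invr_gt0.
have mu0 : 0 < mu by exact: lt_le_trans mu_ge.
have mui : mu^-1 <= L ^+ u / N.
  by rewrite -[leRHS]invrK lef_pV2 ?posrE ?invr_gt0 ?divr_gt0// invfM invrK mulrC.
have mui0 : 0 <= mu^-1 by rewrite invr_ge0 ltW.
(* The four error terms [T1] to [T4] each receive a quarter of L^-E; all but [T2] have a factor 1/N
   and are treated by this bound. *)
have small (X : R) d : 4 * X <= L ^+ d -> (d + E <= D)%N -> X / N <= L ^- E / 4.
  move=> hX hd; rewrite ler_pdivrMr//.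
  have h1 : L ^+ (d + E) <= N by apply: le_trans hN; exact: Lm.
  have h2 : L ^- E * L ^+ (d + E) <= L ^- E * N by rewrite ler_wpM2l// invr_ge0 ltW.
  move: h2; rewrite exprD mulrCA mulVf ?gt_eqF// mulr1 => h2; lra.
have twoL x : (x <= m + 3)%N -> 2 ^+ x <= L.
  by move=> hx; apply: le_trans L1; rewrite ler_weXn2l// ler1n.
have T1 : M / P%:R <= L ^- E / 4.
  apply: le_trans (_ : CM * L ^+ e / N <= _).
    rewrite ler_pdivrMr// /M; apply: (@le_trans _ _ (CM * L ^+ e / N * N ^+ 2)).
      by rewrite le_eqVlt; apply/orP; left; apply/eqP; field; rewrite gt_eqF.
    by rewrite ler_wpM2l// !mulr_ge0 ?invr_ge0 ?(ltW CM0) ?(ltW (Lx _)) ?(ltW Np).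
  apply: (small _ e.+1); last by have [] := hD u0 u.
  by rewrite mulrA exprS ler_wpM2r// ltW.
have T2 : L ^+ u0.+1 * (2 ^+ m * (2 * rho)) <= L ^- E / 4.
  have er : L ^+ r = L ^+ u0.+1 * L ^+ E * L by rewrite -exprD -exprSr /r addn2.
  rewrite /rho er [leLHS](_ : _ = L ^- E * (2 ^+ m * 2 / L)); last first.
    by field; rewrite !gt_eqF.
  rewrite ler_wpM2l ?invr_ge0 ?(ltW (Lx _))// ler_pdivrMr//.
  by move: L1; rewrite exprD (_ : 2 ^+ 3 = 8 :> R); [lra|ring].
have T3 : L ^+ u0.+1 * (2 ^+ m * (2 / mu)) <= L ^- E / 4.
  apply: le_trans (_ : L ^+ u0.+1 * (2 ^+ m * (2 * (L ^+ u / N))) <= _).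
    by rewrite !ler_wpM2l// ?(ltW (Lx _)) ?(ltW (t0 _)).
  rewrite [leLHS](_ : _ = L ^+ u0.+1 * (2 ^+ m * (2 * L ^+ u)) / N); last by ring.
  apply: (small _ (1 + u0.+1 + u)%N); last by have [] := hD u0 u.
  rewrite !exprD expr1 [leLHS](_ : _ = 2 ^+ m.+3 * L ^+ u0.+1 * L ^+ u); last first.
    by rewrite !exprS; ring.
  by rewrite !ler_wpM2r ?(ltW (Lx _))// twoL// addn3.
have T4 : L ^+ u0.+1 * (2 ^+ m * (M / mu ^+ 2)) <= L ^- E / 4.
  apply: le_trans (_ : L ^+ u0.+1 * (2 ^+ m * (M * (L ^+ u / N) ^+ 2)) <= _).
    rewrite !ler_wpM2l// ?(ltW (Lx _)) ?(ltW (t0 _)) ?(ltW M0)//.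
    by rewrite -exprVn lerXn2r// nnegrE// divr_ge0 ?(ltW Np) ?(ltW (Lx _)).
  rewrite [leLHS](_ : _ = L ^+ u0.+1 * (2 ^+ m * (CM * L ^+ e * L ^+ u * L ^+ u)) / N); last first.
    by rewrite /M; field; rewrite gt_eqF.
  apply: (small _ (1 + 1 + u0.+1 + e + u + u)%N); last by have [] := hD u0 u.
  rewrite !exprD expr1 [leLHS](_ : _ = 2 ^+ m * (4 * CM) * L ^+ u0.+1 * L ^+ e * L ^+ u * L ^+ u);
    last by ring.
  have w1 : 2 ^+ m * (4 * CM) <= L * L.
    by rewrite ler_pM ?(ltW (t0 _)) ?mulr_ge0 ?(ltW CM0)// twoL// leq_addr.
  by rewrite !ler_wpM2r ?(ltW (Lx _)).
have TT : Q%:R * (2 ^+ m * (2 * rho + (2 / mu + M / mu ^+ 2))) <=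
   L ^+ u0.+1 * (2 ^+ m * (2 * rho)) + L ^+ u0.+1 * (2 ^+ m * (2 / mu)) +
   L ^+ u0.+1 * (2 ^+ m * (M / mu ^+ 2)).
  have p1 : 0 <= M / mu ^+ 2 by rewrite divr_ge0 ?(ltW M0)// exprn_ge0// ltW.
  have p2 : 0 <= 2 / mu by rewrite mulr_ge0.
  have p3 : 0 <= 2 ^+ m * (2 * rho + (2 / mu + M / mu ^+ 2)).
    rewrite mulr_ge0 ?(ltW (t0 _))//; lra.
  apply: le_trans (ler_wpM2r p3 Qle) _; rewrite le_eqVlt; apply/orP; left; apply/eqP; ring.
by lra.
Qed.

Lemma correlation_polylog n E a : exists (eta Y0 L0 : R) (D : nat),
  [/\ 0 < eta, eta <= 1 & 2 <= Y0] /\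
  forall (N L Y : R) (P : nat) (k c : 'I_n.+1 -> R),
  L0 <= L -> L ^+ D <= N -> Y0 <= Y -> Y <= L ^+ a -> N ^+ 2 <= P%:R ->
  (forall i, Y <= k i /\ k i + 1 <= (1 + eta) * Y) ->
  (forall i j, i != j -> 1 <= `|k i - k j|) ->
  (forall i x, 0 <= x <= 1 -> N / L <= g (k i + x) <= 3 * N) ->
  (forall i, 0 <= c i <= 1) ->
  `|grid_mean P (fun p => \prod_i (hit (c i) (- g (k i + p%:R / P%:R)))%:R) -
    \prod_i c i| <= L ^- E.
Proof.
(* With d = L^-E1 and H above L^(3 E1), the kernel tail (H d^2)^-1 is at most d. [E2] is large
   enough to compensate the H^m frequencies. *)
set m := n.+1; pose E1 := (E + 2)%N; pose e1 := (3 * E1)%N.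
pose E2 := (e1.+1 * m + E + 1)%N.
have [eta [Y0 [L1 [D [h1 main]]]]] := exponential_sum_polylog n e1.+1 E2 a.
exists eta, Y0, (Num.max L1 (8 + 4 * m%:R)), D; split => // N L Y P k c.
rewrite ge_max => /andP[hL1 hL2] hN hY hYa hP hk hsep hg hc.
have m1 : 1 <= m%:R :> R by rewrite ler1n.
have Lone : 1 <= L by lra.
have Lp : 0 < L by lra.
have Lx x : 0 < L ^+ x by rewrite exprn_gt0.
have Np : 0 < N by apply: lt_le_trans hN.
pose H := (Num.truncn (L ^+ e1)).+1.
have /andP[H1 H2] := truncn_itv (ltW (Lx e1)).
have Hle : H%:R <= L ^+ e1.+1.
  rewrite /H -natr1 exprS; have : 1 <= L ^+ e1 by rewrite exprn_ege1.
  nra.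
pose d := L ^- E1.
have d0 : 0 < d by rewrite invr_gt0.
have dL : d <= L ^- E / L / L.
  by rewrite /d /E1 exprD expr2 !invfM mulrA.
have LE1 : L ^- E <= 1 by rewrite invf_le1 ?exprn_ege1.
have LE0 : 0 < L ^- E by rewrite invr_gt0.
have divL (z : R) : 0 <= z -> z / L <= z / 8.
  by move=> z0; rewrite ler_wpM2l// lef_pV2 ?posrE//; lra.
have d8 : d <= 1 / 8.
  apply: (le_trans dL); apply: (@le_trans _ _ (L ^- E / L)).
    by rewrite ler_pdivrMr// ler_peMr// divr_ge0// ltW.
  have := divL _ (ltW LE0); lra.
have Pp : (0 < P)%N by rewrite -(ltr0n R) (lt_le_trans _ hP)// exprn_gt0.
(* The shift by [d] cancels the one in the hits of [grid_mean_prod_hit]; in the exponential sums it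
   only changes the constant phase [theta]. *)
pose s i p := d - g (k i + p%:R / P%:R).
have eps0 : 0 <= L ^- E2 by rewrite invr_ge0 ltW.
have := @grid_mean_prod_hit R m H P s (L ^- E2) isT Pp eps0 _ c d d0 d8 hc.
rewrite (eq_grid_mean (g := fun p => \prod_i (hit (c i) (- g (k i + p%:R / P%:R)))%:R)); last first.
  by move=> p _; apply: eq_bigr => i _; rewrite /s addrAC subrr add0r.
move=> bound; apply: (le_trans (bound _)).
  move=> h theta hnz hlt.
  have := main N L Y P H k h (theta + 2 * pi * \sum_i (h i)%:~R * d) hL1 hN hY hYa hP Hle hk
    hsep hg hnz hlt.
  rewrite (eq_grid_mean (g := fun p => cos (theta + 2 * pi * \sum_i (h i)%:~R * s i p)))//.
  move=> p _; congr cos; rewrite -addrA; congr (_ + _); rewrite -mulrDr -big_split/=; congr (_ * _).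
  by apply: eq_bigr => i _; rewrite /s mulrBr mulrN.
have t1 : (H%:R * d ^+ 2)^-1 <= d.
  rewrite invf_ple ?posrE ?mulr_gt0 ?exprn_gt0 ?ltr0n//.
  rewrite -ler_pdivrMr ?exprn_gt0//; apply/ltW/(le_lt_trans _ H2).
  suff -> : d^-1 / d ^+ 2 = L ^+ e1 by [].
  by rewrite /d /e1 exprVn !invrK -exprM -exprD -mulnS mulnC.
have t2 : m%:R * ((H%:R * d ^+ 2)^-1 + 3 * d) <= L ^- E / 2.
  apply: (@le_trans _ _ (m%:R * (4 * d))); first by rewrite ler_wpM2l//; lra.
  apply: (@le_trans _ _ (L * (L ^- E / L / L))).
    by rewrite mulrA ler_pM ?(ltW d0) ?mulr_ge0//; lra.
  have -> : L * (L ^- E / L / L) = L ^- E / L by field; rewrite !gt_eqF.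
  by have := divL _ (ltW LE0); lra.
have t3 : H%:R ^+ m * L ^- E2 <= L ^- E / 2.
  apply: (@le_trans _ _ (L ^+ (e1.+1 * m) * L ^- E2)).
    by rewrite ler_wpM2r// exprM lerXn2r ?nnegrE// ltW.
  rewrite /E2 !exprD expr1.
  have -> : L ^+ (e1.+1 * m) / (L ^+ (e1.+1 * m) * L ^+ E * L) = L ^- E / L.
    by field; rewrite !gt_eqF.
  by have := divL _ (ltW LE0); lra.
lra.
Qed.

End ExponentialSums.

(** * Asymptotics of the turns *)

Section Growth.
Context {R : realType}.

Lemma near_ln_ge (C : R) : \forall N \near \oo, C <= ln (N : nat)%:R.
Proof.
near=> N; rewrite -(expRK C).
have hN : expR C <= N%:R by near: N; exact: nbhs_infty_ger.
by rewrite ler_ln ?posrE ?expR_gt0// (lt_le_trans (expR_gt0 C)).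
Unshelve. all: by end_near. Qed.

Lemma exprn_le_expR (D : nat) (x : R) : D.+1`!%:R <= x -> x ^+ D <= expR x.
Proof.
move=> hx; have f0 : 0 < D.+1`!%:R :> R by rewrite ltr0n fact_gt0.
have x0 : 0 < x by apply: lt_le_trans hx.
apply: le_trans (expR_ge1Dxn D (ltW x0)); apply: ler_wpDl => //.
by rewrite ler_pdivlMr// exprS mulrC ler_wpM2r// exprn_ge0// ltW.
Qed.

Lemma ln_le_eps (eps : R) : 0 < eps -> exists2 L0, 1 <= L0 & forall L, L0 <= L -> ln L <= eps * L.
Proof.
move=> e0; pose z := Num.max 6 eps^-1; have z6 : 6 <= z by rewrite le_max lexx.
exists (expR z); first by rewrite -expR0 ler_expR; lra.
move=> L hL; have L0 : 0 < L by apply: lt_le_trans hL; exact: expR_gt0.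
have zl : z <= ln L by rewrite -(expRK z) ler_ln ?posrE ?expR_gt0.
have := @exprn_le_expR 2 (ln L); rewrite lnK ?posrE// => h.
have {}h : ln L ^+ 2 <= L by apply: h; apply: le_trans zl.
have ez : eps^-1 <= ln L by apply: le_trans zl; rewrite le_max lexx orbT.
have h1 : 1 <= eps * ln L by rewrite -ler_pdivrMl// mulr1.
apply: (@le_trans _ _ (eps * ln L ^+ 2)); last by rewrite ler_wpM2l// ltW.
rewrite expr2 mulrA ler_peMl//; lra.
Qed.

Lemma expR_N_lipschitz (x y : R) : 0 <= x -> 0 <= y -> `|expR (- x) - expR (- y)| <= `|x - y|.
Proof.
wlog xy : x y / x <= y.
  move=> W; have [xy|/ltW yx] := leP x y; first exact: W.
  by move=> x0 y0; rewrite distrC (distrC x); exact: W.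
move=> x0 y0; rewrite distrC (distrC x) (ger0_norm (_ : 0 <= y - x)) ?subr_ge0//.
rewrite distrC ger0_norm ?subr_ge0 ?ler_expR ?lerN2//.
have -> : - y = - x + (x - y) by ring.
rewrite expRD; have := expR_ge1Dx (x - y).
have : expR (- x) <= 1 by rewrite expR_le1 oppr_le0.
have := expR_gt0 (- x); have : expR (x - y) <= 1 by rewrite expR_le1 subr_le0.
nra.
Qed.

End Growth.

(** * The inverse of n |-> alpha (ln n)^A *)

Section Inverse.
Context {R : realType}.
Variables (A alpha : R).
Hypotheses (A_gt1 : 1 < A) (alpha_gt0 : 0 < alpha).

Definition lpow (x : R) : R := alpha * ln x `^ A.
Definition inv_degree : R := A^-1.
Definition stretch_coef : R := inv_degree * expR (- (inv_degree * ln alpha)).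
Local Notation f := lpow.
Local Notation g := (stretch inv_degree stretch_coef).

Lemma degree_gt0 : 0 < A. Proof. exact: lt_trans A_gt1. Qed.

Lemma inv_degree_gt0 : 0 < inv_degree. Proof. by rewrite invr_gt0 degree_gt0. Qed.

Lemma inv_degree_lt1 : inv_degree < 1. Proof. by rewrite invf_lt1 ?degree_gt0. Qed.

Lemma stretch_coef_gt0 : 0 < stretch_coef.
Proof. by rewrite mulr_gt0 ?inv_degree_gt0 ?expR_gt0. Qed.

Lemma stretchE y : g y = expR (expR (inv_degree * (ln y - ln alpha))).
Proof.
rewrite /stretch /stretch_coef [inv_degree * _]mulrC mulfK ?gt_eqF ?inv_degree_gt0// -expRD.
by congr (expR (expR _)); ring.
Qed.

Lemma ln_lpow x : 1 < x -> ln (f x) = ln alpha + A * ln (ln x).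
Proof.
by move=> x1; rewrite /f lnM ?posrE ?powR_gt0 ?ln_gt0// ln_powR.
Qed.

Lemma lpowK x : 1 < x -> g (f x) = x.
Proof.
move=> x1; rewrite stretchE ln_lpow// addrAC subrr add0r mulrA mulVf ?gt_eqF ?degree_gt0//.
by rewrite mul1r !lnK ?posrE ?ln_gt0// (lt_trans ltr01).
Qed.

Lemma ler_stretch y z : 0 < y -> 0 < z -> (g y <= g z) = (y <= z).
Proof.
move=> y0 z0; rewrite !stretchE !ler_expR ler_pM2l ?inv_degree_gt0// lerD2r.
by rewrite ler_ln ?posrE.
Qed.

Lemma ltr_stretch y z : 0 < y -> 0 < z -> (g y < g z) = (y < z).
Proof. by move=> y0 z0; rewrite ltNge ler_stretch// -ltNge. Qed.

Lemma lpow_gt0 x : 1 < x -> 0 < f x.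
Proof. by move=> x1; rewrite mulr_gt0// powR_gt0// ln_gt0. Qed.

Lemma lpow_ge0 x : 0 <= f x.
Proof. by rewrite mulr_ge0 ?powR_ge0// ltW. Qed.

Lemma lpow_le x y : 1 < x -> x <= y -> f x <= f y.
Proof.
move=> x1 xy; have y1 := lt_le_trans x1 xy.
by rewrite -(ler_stretch (lpow_gt0 x1) (lpow_gt0 y1)) (lpowK x1) (lpowK y1).
Qed.

(** The two summands are g'/g and 1/y; together they control the logarithmic derivatives of both g
    and g'. *)
Lemma stretch_slope_small eps : 0 < eps -> exists2 Y0 : R, 1 <= Y0 &
  forall y, Y0 <= y -> stretch_coef * expR ((inv_degree - 1) * ln y) + y^-1 <= eps.
Proof.
move=> e0; have b0 := stretch_coef_gt0; have b1 := inv_degree_lt1.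
have e2 : 0 < eps / 2 by rewrite divr_gt0.
pose z := Num.max (2 / eps) (expR (- ln (eps / 2 / stretch_coef) / (1 - inv_degree))).
exists (Num.max 1 z); first by rewrite le_max lexx.
move=> y; rewrite ge_max => /andP[y1]; rewrite /z ge_max => /andP[hy1 hy2].
have y0 : 0 < y by lra.
have t1 : y^-1 <= eps / 2 by rewrite invf_ple ?posrE// invf_div.
suff t2 : stretch_coef * expR ((inv_degree - 1) * ln y) <= eps / 2 by lra.
rewrite mulrC -ler_pdivlMr// -[leRHS]lnK ?posrE ?divr_gt0// ler_expR.
have : - ln (eps / 2 / stretch_coef) / (1 - inv_degree) <= ln y.
  by rewrite -[leLHS]expRK ler_ln ?posrE ?expR_gt0.
rewrite ler_pdivrMr; last lra.
lra.
Qed.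

(** The logarithms of g and g' have slope at most eps beyond [Y0]. The distance 2 covers any two
    points of [k, k + 2], hence of a turn and a window that starts in it. *)
Lemma stretch_ratio eps Y0 : 1 <= Y0 ->
  (forall y, Y0 <= y -> stretch_coef * expR ((inv_degree - 1) * ln y) + y^-1 <= eps) ->
  forall y z, Y0 <= y -> Y0 <= z -> `|y - z| <= 2 ->
  g y <= expR (2 * eps) * g z /\
  g y * (stretch_coef * expR ((inv_degree - 1) * ln y)) <=
    expR (2 * eps) * (g z * (stretch_coef * expR ((inv_degree - 1) * ln z))).
Proof.
move=> Y1 slope y z hy hz yz; have b0 := stretch_coef_gt0; have b1 := inv_degree_lt1;
  have bb := inv_degree_gt0.
pose G y := expR (inv_degree * (ln y - ln alpha)).
pose h y := G y + (inv_degree - 1) * ln y.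
have gG x : g x = expR (G x) by rewrite stretchE.
have pos x : Y0 <= x -> 0 < x by move=> ?; lra.
have dln x : Y0 <= x -> is_derive x 1 (@ln R) x^-1 by move=> /pos; exact: is_derive1_ln.
have dG x : Y0 <= x -> is_derive x 1 G (stretch_coef * expR ((inv_degree - 1) * ln x)).
  move=> hx; have := @is_derive_expR_ln R inv_degree x (pos x hx) => d1.
  have d2 : is_derive x 1 (expR (- (inv_degree * ln alpha)) \*: (fun y => expR (inv_degree * ln y)))
      (expR (- (inv_degree * ln alpha)) * (inv_degree * expR ((inv_degree - 1) * ln x)))
        by exact: is_deriveZ.
  have -> : G = expR (- (inv_degree * ln alpha)) \*: (fun y => expR (inv_degree * ln y)).
    apply/funext => w; rewrite /G.
    by rewrite -[RHS]/(expR (- (inv_degree * ln alpha)) * expR (inv_degree * ln w)) -expRD;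
      congr expR; ring.
  by rewrite (_ : stretch_coef * _ =
    expR (- (inv_degree * ln alpha)) * (inv_degree * expR ((inv_degree - 1) * ln x)))//
    /stretch_coef; ring.
have dh x : Y0 <= x -> is_derive x 1 h
  (stretch_coef * expR ((inv_degree - 1) * ln x) + (inv_degree - 1) * x^-1).
  move=> hx; have d1 := dG x hx; have d2 := dln x hx.
  have -> : h = G + (inv_degree - 1) \*: (@ln R) by [].
  exact: is_deriveD.
have lip (F dF : R -> R) : (forall x, Y0 <= x -> is_derive x 1 F (dF x)) ->
    (forall x, Y0 <= x -> `|dF x| <= eps) -> F y - F z <= 2 * eps.
  move=> hF hdF.
  have e0 : 0 <= eps by apply: le_trans (hdF y hy).
  have aux u v : Y0 <= u -> u <= v -> `|F v - F u| <= eps * (v - u).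
    by move=> hu uv; apply: (MVT_bound uv (df := dF)) => x /andP[ux _];
      [apply: hF|apply: hdF]; exact: le_trans ux.
  apply: le_trans (ler_norm _) _; apply: (@le_trans _ _ (eps * `|y - z|)).
    have [yz'|/ltW yz'] := leP y z.
      by rewrite distrC (distrC y) (ger0_norm (_ : 0 <= z - y)) ?subr_ge0// aux.
    by rewrite (ger0_norm (_ : 0 <= y - z)) ?subr_ge0// aux.
  by rewrite mulrC ler_wpM2r.
have spos x : Y0 <= x -> 0 <= stretch_coef * expR ((inv_degree - 1) * ln x) /\ 0 < x^-1.
  by move=> /pos x0; rewrite invr_gt0 mulr_ge0 ?expR_ge0 ?(ltW b0).
split.
  rewrite !gG -expRD ler_expR -lerBlDr; apply: (lip G _ dG) => x hx.
  have [s1 s2] := spos x hx; have := slope x hx.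
  by rewrite ger0_norm//; lra.
have ge x : g x * (stretch_coef * expR ((inv_degree - 1) * ln x)) = stretch_coef * expR (h x).
  by rewrite gG /h expRD; ring.
rewrite (ge y) (ge z) [leRHS]mulrCA ler_wpM2l ?(ltW b0)// -expRD ler_expR -lerBlDr.
apply: (lip h _ dh) => x hx.
have [s1 s2] := spos x hx; have := slope x hx => s3.
by rewrite ler_norml; apply/andP; split; nra.
Qed.

(** An integer power that exceeds A, with one more factor ln N to absorb [alpha] and the added 1 in
    [lpow_range]. *)
Definition log_degree : nat := (Num.truncn A).+2.

(** Dividing x = e^L by L only replaces L by L - ln L under the power A, and the ratio of the two
    powers tends to 1. *)
Lemma lpow_range (eta C : R) : 0 < eta -> eta <= 1 ->
  exists L0 : R, forall L x, L0 <= L -> x = expR L ->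
  [/\ C <= L, 2 * L <= x, C <= f (x / L),
      f x <= (1 + eta) * f (x / L) & f x + 1 <= L ^+ log_degree].
Proof.
move=> eta0 eta1; have A0 := degree_gt0; pose a := (Num.truncn A).+1.
have Aa : A <= a%:R by apply/ltW; have /andP[] := truncn_itv (ltW A0).
have l0 : 0 < ln (1 + eta) by rewrite ln_gt0//; lra.
have [L1 L11 hL1] := @ln_le_eps R (ln (1 + eta) / (2 * A)) (divr_gt0 l0 (mulr_gt0 (ltr0Sn R 1) A0)).
have [L2 L21 hL2] := @ln_le_eps R (1 / 2) (divr_gt0 ltr01 (ltr0Sn R 1)).
have l2 : ln 2 <= 1 :> R by have := @le_ln1Dx R 1; rewrite (_ : 1 + 1 = 2 :> R)//; apply; lra.
have [c0 hC C0] : exists2 c0 : R, C <= c0 & 0 <= c0 by exists `|C|; rewrite ?ler_norm.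
have [c3 hc3] : exists c3 : R, c3 = 2 * c0 / alpha by eexists.
have [c6 hc6] : exists c6 : R, c6 = 3`!%:R by eexists.
exists (c0 + L1 + L2 + 2 + c3 + alpha + 1 + c6) => L x hL xL.
have al0 := alpha_gt0.
have Ca : 0 <= c3 by rewrite hc3 divr_ge0 ?mulr_ge0// ltW.
have f3 : 0 <= c6 by rewrite hc6.
have L1' : 1 <= L by lra.
have Lp : 0 < L by lra.
have Np : 0 < x by rewrite xL expR_gt0.
have lnx : ln x = L by rewrite xL expRK.
have hlnL := hL1 L _; have hlnL2 := hL2 L _.
have {}hlnL : ln L <= ln (1 + eta) / (2 * A) * L by apply: hlnL; lra.
have {}hlnL2 : ln L <= 1 / 2 * L by apply: hlnL2; lra.
have lnL0 : 0 <= ln L by rewrite ln_ge0.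
have eN : ln (x / L) = L - ln L by rewrite ln_div ?posrE// lnx.
have NL : 2 * L <= x.
  rewrite xL; apply: le_trans (_ : L ^+ 2 <= _).
    by rewrite expr2 ler_wpM2r//; lra.
  by apply: exprn_le_expR; rewrite -hc6; lra.
have x0 : 0 < L - ln L by lra.
have LA : L <= L `^ A by rewrite le1r_powR// ltW.
have key : L `^ A <= (1 + eta) * (L - ln L) `^ A.
  rewrite -ler_ln ?posrE ?mulr_gt0 ?powR_gt0//; last lra.
  rewrite lnM ?posrE ?powR_gt0//; last lra.
  rewrite !ln_powR.
  have h1 : ln L - ln (L - ln L) <= ln L / (L - ln L).
    have e : ln L - ln (L - ln L) = ln (L / (L - ln L)) by rewrite ln_div ?posrE.
    have e' : L / (L - ln L) = 1 + ln L / (L - ln L) by field; rewrite gt_eqF.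
    rewrite e e' le_ln1Dx//; apply: (lt_le_trans (_ : -1 < 0)); first by lra.
    by rewrite divr_ge0// ltW.
  have h2 : ln L / (L - ln L) <= ln (1 + eta) / A.
    rewrite ler_pdivrMr//; apply: (le_trans hlnL).
    rewrite (_ : ln (1 + eta) / (2 * A) * L = ln (1 + eta) / A * (L / 2)); last first.
      by field; rewrite gt_eqF.
    by rewrite ler_wpM2l ?divr_ge0 ?(ltW l0) ?(ltW A0)//; lra.
  have h3 : A * (ln L - ln (L - ln L)) <= ln (1 + eta).
    have := ler_wpM2l (ltW A0) (le_trans h1 h2).
    by rewrite [X in _ <= X -> _]mulrC divfK ?gt_eqF.
  lra.
have fN : f x = alpha * L `^ A by rewrite /f lnx.
have fNL : f (x / L) = alpha * (L - ln L) `^ A by rewrite /f eN.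
split=> //.
- lra.
- rewrite fNL; have : L <= 2 * (L - ln L) `^ A.
    apply: (le_trans LA); apply: (le_trans key); rewrite ler_wpM2r ?powR_ge0//; lra.
  have : 2 * c0 <= alpha * L.
    by rewrite [leRHS]mulrC -ler_pdivrMr// -hc3; lra.
  nra.
- rewrite fN fNL mulrCA ler_wpM2l// ltW//.
- rewrite fN; apply: (@le_trans _ _ (L ^+ a.+1))=> //.
  have : L `^ A <= L ^+ a by rewrite -powR_mulrn ?(ltW Lp)// ler_powR.
  have : 1 <= L ^+ a by rewrite exprn_ege1.
  rewrite exprS; nra.
Qed.

End Inverse.

(** * Independence of hits on finitely many turns *)

Section VoidModel.
Context {R : realType}.
Variables (A alpha : R).
Hypotheses (A_gt1 : 1 < A) (alpha_gt0 : 0 < alpha).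
Local Notation f := (lpow A alpha).
Local Notation g := (stretch (inv_degree A) (stretch_coef A alpha)).
Local Notation a := (log_degree A).
Implicit Types (N p k r E : nat) (e w s : R).

(** The added 1 puts the first turn strictly above f (N / ln N). *)
Definition first_turn N : nat := (Num.truncn (f (N%:R / ln N%:R))).+1.
Definition last_turn N : nat := Num.truncn (f N%:R).
Definition grid_point N p : R := p%:R / (N ^ 2)%:R.
(** The interval starts at g (k + t) but has a length independent of t: s/N times the length of the
    whole turn. The factor [w], slightly below or above 1, makes it shorter or longer than the true
    interval. *)
Definition turn_hit w s N k p : bool :=
  hit (w * (s / N%:R) * (g k.+1%:R - g k%:R)) (- g (k%:R + grid_point N p)).

Lemma natr_dist_ge1 (u v : nat) : u != v -> 1 <= `|u%:R - v%:R| :> R.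
Proof.
have lt_case (x y : nat) : (x < y)%N -> 1 <= `|y%:R - x%:R| :> R.
  by move=> xy; rewrite ler_normr lerBrDl natr1 ler_nat xy.
by rewrite neq_ltn => /orP[uv|uv]; [rewrite distrC|]; exact: lt_case.
Qed.

Lemma turn_range N (C eta : R) : (0 < N)%N ->
  [/\ C <= ln N%:R, 2 * ln N%:R <= N%:R :> R, C <= f (N%:R / ln N%:R),
      f N%:R <= (1 + eta) * f (N%:R / ln N%:R) & f N%:R + 1 <= ln N%:R ^+ a] ->
  1 <= C ->
  [/\ 1 < N%:R / ln N%:R :> R, C <= (first_turn N)%:R, (first_turn N)%:R <= (ln N%:R : R) ^+ a,
    f (N%:R / ln N%:R) < (first_turn N)%:R & (first_turn N)%:R <= f (N%:R / ln N%:R) + 1] /\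
    (last_turn N)%:R <= f N%:R /\ f N%:R < (last_turn N).+1%:R.
Proof.
move=> N0 [h1 h2 h3 h4 h5] C1.
have Np : 0 < N%:R :> R by rewrite ltr0n.
have L1 : 1 <= ln N%:R :> R by exact: le_trans h1.
have Lp : 0 < ln N%:R :> R by lra.
have NL : 1 < N%:R / ln N%:R :> R by rewrite ltr_pdivlMr//; lra.
have f0 := lpow_ge0 A alpha_gt0 (N%:R / ln N%:R).
have f1 := lpow_ge0 A alpha_gt0 N%:R.
have /andP[t1 t2] := truncn_itv f0; have /andP[t3 t4] := truncn_itv f1.
have fm : f (N%:R / ln N%:R) <= f N%:R.
  apply: (lpow_le A_gt1 alpha_gt0 NL).
  by rewrite ler_pdivrMr// ler_peMr// ltW.
have l1 : (first_turn N)%:R <= f (N%:R / ln N%:R) + 1 by rewrite /first_turn -natr1 lerD2r.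
split => //; split => //.
- by apply: (le_trans h3); exact: ltW.
- by apply: (le_trans l1); lra.
Qed.

(** The turns and lengths are quantified after N because the lengths used later depend on N. The
    induction on [r] merges the thresholds for the different sizes, since [correlation_polylog]
    treats one size at a time. *)
Lemma correlation_near r E : \forall N \near \oo, forall (d : seq nat) (c : nat -> R),
  uniq d -> {in d, forall k, (first_turn N <= k < last_turn N)%N} -> (size d <= r)%N ->
  {in d, forall k, 0 <= c k <= 1} ->
  `|grid_mean (N ^ 2) (fun p => \prod_(k <- d) (hit (c k) (- g (k%:R + grid_point N p)))%:R) -
    \prod_(k <- d) c k| <= ln N%:R ^- E.
Proof.
elim: r => [|r IH].
  near=> N => -[|k d] c //= _ _ _ _.
  have L1 : 1 <= ln N%:R :> R by near: N; exact: near_ln_ge.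
  have N0 : (0 < N ^ 2)%N by rewrite expn_gt0; apply/orP; left; near: N; exact: nbhs_infty_gt.
  rewrite (eq_grid_mean (g := fun=> 1)); last by move=> p _; rewrite big_nil.
  by rewrite grid_mean_cst// big_nil subrr normr0 invr_ge0 exprn_ge0//; lra.
have [eta [Y0 [L0 [D [[eta0 eta1 Y02] main]]]]] :=
  correlation_polylog (inv_degree_gt0 A_gt1) (inv_degree_lt1 A_gt1)
    (stretch_coef_gt0 alpha A_gt1) r E a.
have [L1 hL1] := lpow_range A_gt1 alpha_gt0 Y0 eta0 eta1.
near=> N => d c ud hd; rewrite leq_eqVlt => /predU1P[sd|]; last first.
  by rewrite ltnS => sd hc; apply: (near IH N _ d c).
move=> hc.
have N0 : (0 < N)%N by near: N; exact: nbhs_infty_gt.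
have Np : 0 < N%:R :> R by rewrite ltr0n.
have g0 : L0 <= ln N%:R by near: N; exact: near_ln_ge.
have g1 : L1 <= ln N%:R by near: N; exact: near_ln_ge.
have g2 : D.+1`!%:R <= ln N%:R :> R by near: N; exact: near_ln_ge.
have NE : N%:R = expR (ln N%:R) :> R by rewrite lnK ?posrE.
have range := hL1 _ _ g1 NE.
have Y01 : 1 <= Y0 by lra.
have [[NL l1 l2 l3 l4] [u1 u2]] := turn_range N0 range Y01.
have [_ h2 h3 h4 _] := range.
have LD : ln N%:R ^+ D <= N%:R :> R by rewrite {2}NE exprn_le_expR.
pose k (i : 'I_r.+1) : R := (nth 0%N d i)%:R.
have di (i : 'I_r.+1) : nth 0%N d i \in d by rewrite mem_nth// sd.
have big_d (F : nat -> R) : \prod_(k <- d) F k = \prod_(i < r.+1) F (nth 0%N d i).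
  by rewrite (big_nth 0%N) big_mkord sd.
rewrite big_d (eq_grid_mean (fun p _ => big_d _)).
apply: (main N%:R (ln N%:R) (first_turn N)%:R (N ^ 2)%N k (fun i => c (nth 0%N d i))) => //.
- by rewrite natrX.
- move=> i; have /andP[k1 k2] := hd _ (di i); rewrite /k; split; first by rewrite ler_nat.
  rewrite natr1; apply: (@le_trans _ _ (last_turn N)%:R); first by rewrite ler_nat.
  apply: (le_trans u1); apply: (le_trans h4); rewrite ler_wpM2l ?(ltW l3)//; lra.
- move=> i j ij; rewrite /k.
  have ne : nth 0%N d i != nth 0%N d j by rewrite nth_uniq ?sd.
  exact: natr_dist_ge1.
- move=> i x /andP[x0 x1]; have /andP[k1 k2] := hd _ (di i).
  have lo0 : 0 < (first_turn N)%:R :> R by rewrite ltr0n.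
  have kp : (first_turn N)%:R <= k i by rewrite ler_nat.
  have f0 := lpow_gt0 A alpha_gt0 NL.
  apply/andP; split.
    rewrite -[leLHS](lpowK A_gt1 alpha_gt0 NL) ler_stretch//; lra.
  have N1 : 1 < N%:R :> R by case: range; lra.
  apply: (@le_trans _ _ N%:R); last by lra.
  rewrite -[leRHS](lpowK A_gt1 alpha_gt0 N1) ler_stretch//; [|lra|exact: lpow_gt0].
  apply: le_trans u1; apply: (@le_trans _ _ (k i + 1)); first by lra.
  by rewrite /k natr1 ler_nat.
- by move=> i; exact/hc/di.
Unshelve. all: by end_near. Qed.

End VoidModel.

(** * Empty windows *)

Section VoidLimit.
Context {R : realType}.
Variables (A alpha : R).
Hypotheses (A_gt1 : 1 < A) (alpha_gt0 : 0 < alpha).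
Local Notation f := (lpow A alpha).
Local Notation g := (stretch (inv_degree A) (stretch_coef A alpha)).
Local Notation gp y := (g y * (stretch_coef A alpha * expR ((inv_degree A - 1) * ln y))).
Local Notation a := (log_degree A).
Local Notation first_turn := (first_turn A alpha).
Local Notation last_turn := (last_turn A alpha).
Local Notation turn_hit := (turn_hit A alpha).
Implicit Types (N p k r E : nat) (e w s y z : R).

(* Only the turns k with first_turn N <= k < last_turn N are used; they cover
   the integers n from about N / ln N to about N. *)
Definition regular_turns e N :=
  [/\ (first_turn N < last_turn N)%N, g (first_turn N)%:R <= expR (2 * e) * (N%:R / ln N%:R),
      N%:R <= expR (2 * e) * g (last_turn N)%:R, g (last_turn N)%:R <= N%:R &
      (last_turn N).+1%:R <= (ln N%:R : R) ^+ a] /\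
  forall y z, (first_turn N)%:R <= y -> (first_turn N)%:R <= z -> `|y - z| <= 2 ->
    g y <= expR (2 * e) * g z /\ gp y <= expR (2 * e) * gp z.

Lemma regular_turns_near e : 0 < e -> \forall N \near \oo, regular_turns e N.
Proof.
move=> e0.
have [Y1 Y11 slope] := stretch_slope_small alpha A_gt1 e0.
have [L1 hL1] := lpow_range A_gt1 alpha_gt0 (Y1 + 1) ltr01 (lexx 1).
near=> N.
have N0 : (0 < N)%N by near: N; exact: nbhs_infty_gt.
have Np : 0 < N%:R :> R by rewrite ltr0n.
have g1 : L1 <= ln N%:R by near: N; exact: near_ln_ge.
(* Makes expR (2 e) g (first_turn N) < N, so that the range of turns is not empty. *)
have g2 : expR (2 * e) * expR (2 * e) + 1 <= ln N%:R :> R by near: N; exact: near_ln_ge.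
have NE : N%:R = expR (ln N%:R) :> R by rewrite lnK ?posrE.
have range := hL1 _ _ g1 NE.
have Y12 : 1 <= Y1 + 1 by lra.
have [[NL l1 l2 l3 l4] [u1 u2]] := turn_range A_gt1 alpha_gt0 N0 range Y12.
have [h1 h2 h3 h4 h5] := range.
have N1 : 1 < N%:R :> R by lra.
have L0 : 0 < ln N%:R :> R by lra.
have ratio := stretch_ratio A_gt1 Y11 slope.
have fm : f (N%:R / ln N%:R) <= f N%:R.
  apply: (lpow_le A_gt1 alpha_gt0 NL).
  by rewrite ler_pdivrMr// ler_peMr ?(ltW Np)//; lra.
have hi1 : f N%:R < (last_turn N)%:R + 1 by rewrite natr1.
have hiY : Y1 <= (last_turn N)%:R by lra.
have loY : Y1 <= (first_turn N)%:R by lra.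
have dist1 (u v : R) : v <= u -> u <= v + 1 -> `|u - v| <= 2.
  by move=> ? ?; rewrite ler_norml; apply/andP; split; lra.
have e1 : g (first_turn N)%:R <= expR (2 * e) * (N%:R / ln N%:R).
  rewrite -[N%:R / ln N%:R](lpowK A_gt1 alpha_gt0 NL).
  by apply: (ratio _ _ _ _ _).1 => //; [lra|apply: dist1 => //; exact: ltW].
have e2 : N%:R <= expR (2 * e) * g (last_turn N)%:R.
  rewrite -[leLHS](lpowK A_gt1 alpha_gt0 N1).
  by apply: (ratio _ _ _ _ _).1 => //; [lra|apply: dist1 => //; lra].
have e3 : g (last_turn N)%:R <= N%:R.
  rewrite -[leRHS](lpowK A_gt1 alpha_gt0 N1) ler_stretch//; first lra.
  exact: lpow_gt0.
split; [split => //|].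
- have lo0 : 0 < (first_turn N)%:R :> R by exact: lt_le_trans ltr01 (le_trans Y11 loY).
  have hi0 : 0 < (last_turn N)%:R :> R by exact: lt_le_trans ltr01 (le_trans Y11 hiY).
  rewrite -(ltr_nat R) -(ltr_stretch alpha A_gt1 lo0 hi0).
  have o0 : 0 < expR (2 * e) :> R by exact: expR_gt0.
  rewrite -(ltr_pM2l o0); apply: lt_le_trans e2.
  apply: (@le_lt_trans _ _ (expR (2 * e) * (expR (2 * e) * (N%:R / ln N%:R)))).
    by rewrite ler_pM2l.
  by rewrite !mulrA ltr_pdivrMr// mulrC ltr_pM2l//; clear -g2; lra.
- by rewrite -natr1; lra.
- by move=> y z hy hz hyz; apply: ratio => //; exact: le_trans loY _.
Unshelve. all: by end_near. Qed.

Lemma expn_fact_small (t e : R) : 0 < e -> exists r, t ^+ r.+1 / r.+1`!%:R <= e.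
Proof.
move=> e0; have := cvg_series_cvg_0 (is_cvg_series_exp_coeff t).
move=> /cvgrPdist_le/(_ e e0) [n _ hn]; exists n.
have := hn n.+1 (leqnSn n); rewrite sub0r normrN /exp_coeff => h.
by apply: le_trans h; rewrite ler_norm.
Qed.

(** The hits behave like independent events of small probabilities [c k]. Their sum telescopes to
    the exponent, and their maximum tends to 0 because g varies slowly from one turn to the next. *)
Lemma void_model w s e : 0 < w -> 0 < s -> 0 < e -> \forall N \near \oo,
  `|grid_mean (N ^ 2) (fun p => \prod_(k <- index_iota (first_turn N) (last_turn N))
      (1 - (turn_hit w s N k p)%:R)) -
    expR (- (w * (s / N%:R) * (g (last_turn N)%:R - g (first_turn N)%:R)))| <= e.
Proof.
move=> w0 s0 e0; pose t := w * s.
have t0 : 0 < t by rewrite mulr_gt0.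
have e3 : 0 < e / 6 by rewrite divr_gt0.
have [r hr] := expn_fact_small t e3.
(* There are fewer than (ln N)^a turns and products of up to r + 1 hits; the extra power absorbs the
   constants. *)
pose E := (a * r.+1 + 1)%N.
(* The first bound makes every probability at most 1, the second makes the error of the exponential
   approximation at most e/3. *)
pose e' := Num.min (1 / (2 * t)) (e / (6 * t ^+ 2)).
have e'0 : 0 < e' by rewrite lt_min !divr_gt0 ?mulr_gt0 ?exprn_gt0.
have e'1 : 2 * e' * t <= 1.
  have : e' <= 1 / (2 * t) by rewrite ge_min lexx.
  by rewrite ler_pdivlMr ?mulr_gt0//; lra.
have e'2 : 2 * e' * t * t <= e / 3.
  have : e' <= e / (6 * t ^+ 2) by rewrite ge_min lexx orbT.
  by rewrite ler_pdivlMr ?mulr_gt0 ?exprn_gt0//; lra.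
near=> N.
have N0 : (0 < N)%N by near: N; exact: nbhs_infty_gt.
have Np : 0 < N%:R :> R by rewrite ltr0n.
have P0 : (0 < N ^ 2)%N by rewrite expn_gt0 N0.
have L1 : 1 + 3 * r.+2%:R / e <= ln N%:R :> R by near: N; exact: near_ln_ge.
have [[lohi _ _ hiN hiL] ratio] : regular_turns e' N by near: N; exact: regular_turns_near.
have corr := near (correlation_near A_gt1 alpha_gt0 r.+1 E) N.
have q0 : 0 <= 3 * r.+2%:R / e by rewrite divr_ge0 ?mulr_ge0// ltW.
have Lp : 0 < ln N%:R :> R by lra.
have pos k : (first_turn N <= k)%N -> 0 < k%:R :> R by move=> lk; rewrite ltr0n (leq_trans _ lk).
pose c k := w * (s / N%:R) * (g k.+1%:R - g k%:R).
pose cmax := 2 * e' * t.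
have wsN : 0 < w * (s / N%:R) by rewrite mulr_gt0// divr_gt0.
have hc k : (first_turn N <= k < last_turn N)%N -> 0 <= c k <= cmax.
  move=> /andP[lk kh].
  have k0 := pos k lk; have k10 := pos k.+1 (leqW lk).
  have gm : g k%:R <= g k.+1%:R by rewrite (@ler_stretch R A alpha A_gt1)// ler_nat.
  have gN : g k.+1%:R <= N%:R.
    apply: le_trans hiN; rewrite (@ler_stretch R A alpha A_gt1) ?ler_nat//.
    exact: pos (ltnW lohi).
  have gk : g k.+1%:R <= expR (2 * e') * g k%:R.
    apply: (ratio _ _ _ _ _).1; rewrite ?ler_nat//; first exact: leqW.
    by rewrite -natr1 addrAC subrr add0r normr1 ler1n.
  have gk0 : 0 < g k.+1%:R by exact: expR_gt0.
  (* Consecutive values of g differ by a factor at most expR (2 e'), so their difference is at most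
     2 e' times the larger one. *)
  have d2 : g k.+1%:R - g k%:R <= 2 * e' * N%:R.
    have h1 : expR (- (2 * e')) * g k.+1%:R <= g k%:R.
      by rewrite expRN mulrC ler_pdivrMr ?expR_gt0// mulrC.
    have h2 := expR_ge1Dx (- (2 * e')).
    apply: (@le_trans _ _ (2 * e' * g k.+1%:R)); first by clear -h1 h2 gk0; nra.
    by rewrite ler_wpM2l// mulr_ge0// ltW.
  apply/andP; split; first by rewrite mulr_ge0 ?subr_ge0// ltW.
  apply: (@le_trans _ _ (w * (s / N%:R) * (2 * e' * N%:R))).
    by rewrite ler_wpM2l// ltW.
  by rewrite le_eqVlt; apply/orP; left; apply/eqP; rewrite /cmax /t; field; rewrite gt_eqF.
have hc' k : k \in index_iota (first_turn N) (last_turn N) -> 0 <= c k <= cmax.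
  by rewrite mem_index_iota; exact: hc.
have c01 k : k \in index_iota (first_turn N) (last_turn N) -> 0 <= c k <= 1.
  by move=> /hc'/andP[-> h]; exact: le_trans h e'1.
have S_eq : \sum_(k <- index_iota (first_turn N) (last_turn N)) c k =
    w * (s / N%:R) * (g (last_turn N)%:R - g (first_turn N)%:R).
  rewrite -big_distrr/= (telescope_sumr (fun k => g k%:R))//; exact: ltnW.
have S0 : 0 <= \sum_(k <- index_iota (first_turn N) (last_turn N)) c k.
  by rewrite big_seq sumr_ge0// => k /c01/andP[].
have St : \sum_(k <- index_iota (first_turn N) (last_turn N)) c k <= t.
  rewrite S_eq; apply: (@le_trans _ _ (w * (s / N%:R) * N%:R)).
    rewrite ler_wpM2l ?(ltW wsN)//.
    by apply: le_trans hiN; rewrite gerBl expR_ge0.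
  by rewrite le_eqVlt; apply/orP; left; apply/eqP; rewrite /t; field; rewrite gt_eqF.
have m1 := @grid_mean_void R nat r (N ^ 2) (index_iota (first_turn N) (last_turn N))
   (fun k p => (turn_hit w s N k p)%:R) c (ln N%:R ^- E) P0 (iota_uniq _ _).
have {}m1 := m1 _ _ c01.
have m2 := prod_1B_expR hc' e'1.
rewrite S_eq in m2.
rewrite -[X in `|X| <= _](subrKA (\prod_(k <- index_iota (first_turn N) (last_turn N)) (1 - c k))).
apply: le_trans (ler_normD _ _) _.
apply: le_trans (lerD (m1 _ _) m2) _.
- move=> d ud sd szd; apply: corr => //.
  + by move=> k /sd; rewrite mem_index_iota.
  + by move=> k /sd; exact: c01.
- by move=> k p; case: turn_hit; rewrite ?lexx ?ler01.
rewrite -S_eq.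
have b1 : cmax * \sum_(k <- index_iota (first_turn N) (last_turn N)) c k <= e / 3.
  by apply: le_trans e'2; rewrite ler_wpM2l// !mulr_ge0// ltW.
have b2 : (\sum_(k <- index_iota (first_turn N) (last_turn N)) c k) ^+ r.+1 / r.+1`!%:R <= e / 6.
  by apply: le_trans hr; rewrite ler_wpM2r// lerXn2r// nnegrE// ltW.
have b3 : r.+2%:R * (ln N%:R ^- E *
  (size (index_iota (first_turn N) (last_turn N))).+1%:R ^+ r.+1) <= e / 3.
  have h : (size (index_iota (first_turn N) (last_turn N))).+1%:R <= ln N%:R ^+ a :> R.
    by apply: le_trans hiL; rewrite ler_nat size_iota ltnS leq_subr.
  apply: (@le_trans _ _ (r.+2%:R * (ln N%:R ^- E * (ln N%:R ^+ a) ^+ r.+1))).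
    rewrite ler_wpM2l// ler_wpM2l ?invr_ge0 ?exprn_ge0 ?(ltW Lp)//.
    by rewrite lerXn2r ?nnegrE// exprn_ge0// ltW.
  rewrite -exprM /E exprD expr1 invfM mulrAC mulVf ?expf_neq0 ?gt_eqF// mul1r.
  rewrite ler_pdivrMr//.
  have : 3 * r.+2%:R / e <= ln N%:R by apply: le_trans L1; rewrite lerDr.
  by rewrite ler_pdivrMr//; clear; lra.
by clear -b1 b2 b3; lra.
Unshelve. all: by end_near. Qed.

End VoidLimit.

(** * Comparison of empty windows with turns without hits *)

Section Void.
Context {R : realType}.
Implicit Types (x : nat -> R) (N P p n k : nat) (s t u v e : R).

(** The window does not wrap around at 1; this matters only for t above 1 - s/N, a proportion about
    s/N of the grid. *)
Definition void_at x N s t : bool :=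
  ~~ has (fun n => t <= x n < t + s / N%:R) (iota 1 N).

Definition void_freq x s N : R :=
  grid_mean (N ^ 2) (fun p => (void_at x N s (grid_point N p))%:R).

Lemma card_between P u v : u <= v ->
  \sum_(0 <= p < P) (u <= p%:R <= v)%R%:R <= v - u + 1.
Proof.
move=> uv.
(* The added alternative is the induction invariant: either nothing has been counted, or the count
   is at most P - u. *)
suff [] : \sum_(0 <= p < P) (u <= p%:R <= v)%R%:R <= v - u + 1 /\
   (\sum_(0 <= p < P) (u <= p%:R <= v)%R%:R <= 0 :> R \/
    \sum_(0 <= p < P) (u <= p%:R <= v)%R%:R <= P%:R - u) by [].
elim: P => [|P [IH1 IH2]].
  by rewrite big_geq//; split; [lra|left].
rewrite big_nat_recr//=; move: IH1 IH2; set S := \sum_(0 <= _ < _) _ => IH1 IH2.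
rewrite -natr1; case: (boolP (u <= P%:R <= v)) => [/andP[h1 h2]|_].
  by rewrite mulr1n; case: IH2 => ?; split; try right; lra.
by rewrite mulr0n addr0; split => //; case: IH2 => ?; [left|right; lra].
Qed.

Lemma grid_between N u v : (0 < N)%N -> u <= v ->
  grid_mean (N ^ 2) (fun p => (u <= grid_point N p <= v)%R%:R) <= (v - u) + (N ^ 2)%:R^-1.
Proof.
move=> N0 uv; have Pp : 0 < (N ^ 2)%:R :> R by rewrite ltr0n expn_gt0 N0.
rewrite /grid_mean ler_pdivrMr// mulrDl mulVf ?gt_eqF// mulrBl.
have := @card_between (N ^ 2) (u * (N ^ 2)%:R) (v * (N ^ 2)%:R).
rewrite ler_pM2r// => /(_ uv); apply: le_trans.
by apply: ler_sum => p _; rewrite /grid_point ler_pdivlMr// ler_pdivrMr.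
Qed.

Lemma frac_part_nat k t : k%:R <= t < k%:R + 1 -> frac_part t = t - k%:R.
Proof.
move=> /andP[kt tk]; rewrite /frac_part (_ : Num.floor t = k%:Z)//.
by apply: floor_def; rewrite intrD -!pmulrn kt tk.
Qed.

Lemma frac_part_itv t : 0 <= frac_part t < 1.
Proof.
rewrite /frac_part subr_ge0 floor_le/= ltrBlDl addrC.
by have := floorD1_gt t; rewrite intrD addrC.
Qed.

End Void.

Section VoidLimit.
Context {R : realType}.
Variables (A alpha : R).
Hypotheses (A_gt1 : 1 < A) (alpha_gt0 : 0 < alpha).
Local Notation f := (lpow A alpha).
Local Notation g := (stretch (inv_degree A) (stretch_coef A alpha)).
Local Notation gp y := (g y * (stretch_coef A alpha * expR ((inv_degree A - 1) * ln y))).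
Local Notation a := (log_degree A).
Local Notation first_turn := (first_turn A alpha).
Local Notation last_turn := (last_turn A alpha).
Local Notation turn_hit := (turn_hit A alpha).
Local Notation x := (log_pow_seq alpha A).
Implicit Types (N p n k : nat) (e s t y z : R).

(** The mean value theorem on the window and on the whole turn gives two values of g' at points at
    most 2 apart, hence comparable. *)
Lemma stretch_increment e N k t d : regular_turns A alpha e N -> (first_turn N <= k)%N ->
  0 <= t <= 1 -> 0 <= d <= 1 ->
  (expR (2 * e))^-1 * d * (g k.+1%:R - g k%:R) <= g (k%:R + t + d) - g (k%:R + t) /\
  g (k%:R + t + d) - g (k%:R + t) <= expR (2 * e) * d * (g k.+1%:R - g k%:R).
Proof.
move=> [_ ratio] lk /andP[t0 t1] /andP[d0 d1].
have lkR : (first_turn N)%:R <= k%:R :> R by rewrite ler_nat.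
have lo0 : 0 < (first_turn N)%:R :> R by rewrite ltr0n.
have dg y : 0 < y -> is_derive y 1 g (gp y).
  by move=> y0; apply: is_derive_stretch => //; exact: inv_degree_gt0.
have [|c1 /andP[a1 b1] ->] := @MVT_le R g (fun y => gp y) (k%:R + t) (k%:R + t + d)
  (ler_wpDr d0 (lexx _)).
  by move=> y /andP[? ?]; apply: dg; lra.
have k01 : k%:R <= k.+1%:R :> R by rewrite ler_nat.
have [|c2 /andP[a2 b2] ->] := @MVT_le R g (fun y => gp y) k%:R k.+1%:R k01.
  by move=> y /andP[? ?]; apply: dg; lra.
move: b2; rewrite -natr1 => b2.
have -> : k%:R + 1 - k%:R = 1 :> R by ring.
have -> : k%:R + t + d - (k%:R + t) = d by ring.
have om : 0 < expR (2 * e) :> R by exact: expR_gt0.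
have dist : `|c1 - c2| <= 2 by rewrite ler_norml; apply/andP; split; lra.
have hc1 : (first_turn N)%:R <= c1 by lra.
have hc2 : (first_turn N)%:R <= c2 by lra.
have [_ r1] := ratio c1 c2 hc1 hc2 dist.
rewrite distrC in dist; have [_ r2] := ratio c2 c1 hc2 hc1 dist.
rewrite mulr1; set G1 := gp c1 in r1 r2 *; set G2 := gp c2 in r1 r2 *.
split; last by rewrite [leRHS]mulrAC ler_wpM2r.
by rewrite [leLHS]mulrAC ler_wpM2r// ler_pdivrMl.
Qed.

Lemma lpow_itv N n y z : (0 < n)%N -> 0 < y -> g y <= n%:R < g z -> y <= z -> y <= f n%:R < z.
Proof.
move=> n0 y0 /andP[yn nz] yz.
have z0 : 0 < z by exact: lt_le_trans yz.
have n1 : 1 < n%:R :> R.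
  apply: lt_le_trans yn; rewrite stretchE// -expR0 ltr_expR; exact: expR_gt0.
have fn : n%:R = g (f n%:R) :> R by rewrite (lpowK A_gt1 alpha_gt0 n1).
have f0 := lpow_gt0 A alpha_gt0 n1.
by rewrite fn in yn nz; rewrite -(ler_stretch alpha A_gt1 y0 f0)
  -(ltr_stretch alpha A_gt1 f0 z0) yn nz.
Qed.

(** The model intervals are shorter than the true ones, so a hit produces a term in the window. The
    last summand pays for windows that reach beyond 1, where the true interval enters the next
    turn. *)
Lemma void_le_no_hit e N s p : regular_turns A alpha e N -> 0 <= s / N%:R <= 1 -> (0 < N)%N ->
  (p < N ^ 2)%N ->
  (void_at x N s (grid_point N p))%:R <=
  \prod_(k <- index_iota (first_turn N) (last_turn N))
    (1 - (turn_hit (expR (2 * e))^-1 s N k p)%:R) +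
  (1 - s / N%:R <= (grid_point N p : R) <= 1)%R%:R :> R.
Proof.
move=> ok d01 N0 pP; set t := grid_point N p; set d := s / N%:R in d01 *.
have Pp : 0 < (N ^ 2)%:R :> R by rewrite ltr0n expn_gt0 N0.
have t01 : 0 <= t < 1.
  by rewrite /t /grid_point divr_ge0//= ltr_pdivrMr// mul1r ltr_nat.
have prod0 : 0 <= \prod_(k <- index_iota (first_turn N) (last_turn N))
  (1 - (turn_hit (expR (2 * e))^-1 s N k p)%:R) :> R.
  by apply: prodr_ge0 => k _; case: turn_hit; rewrite ?subrr// subr0.
have /andP[t0 t1] := t01; have /andP[d0 d1] := d01.
case: (leP (1 - d) t) => [dt|td] /=.
  rewrite (ltW t1); apply: ler_wpDl => //.
  by case: void_at.
rewrite addr0; case: (boolP (void_at x N s t)) => // vd.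
rewrite big_seq big1// => k; rewrite mem_index_iota => /andP[lk kh].
suff /negbTE -> : ~~ turn_hit (expR (2 * e))^-1 s N k p by rewrite subr0.
apply: contra vd => /asboolP[n /andP[n0 nc]].
have k0 : 0 < k%:R :> R by rewrite ltr0n (leq_trans _ lk).
have [inc _] := stretch_increment ok lk (introT andP (conj t0 (ltW t1))) d01.
have n1 : g (k%:R + t) <= n%:~R by rewrite -subr_ge0.
have n2 : n%:~R < g (k%:R + t + d).
  by rewrite ltrBlDl in nc; apply: (lt_le_trans nc); rewrite -lerBrDl.
have np : 0 < n.
  by rewrite -(ltr0z R); apply: lt_le_trans n1; exact: expR_gt0.
have nE : n%:~R = (absz n)%:R :> R by rewrite natr_absz gtr0_norm.
rewrite nE in n1 n2; set m := absz n in nE n1 n2.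
have m0 : (0 < m)%N by rewrite absz_gt0 gt_eqF.
have /andP[f1 f2] : k%:R + t <= f m%:R < k%:R + t + d.
  by apply: lpow_itv; rewrite ?n1 ?n2//; [exact: ltr_wpDr|rewrite lerDl].
apply/hasP; exists m; last first.
  have fk : k%:R <= f m%:R < k%:R + 1.
    rewrite (le_trans _ f1) ?lerDl//= (lt_le_trans f2)//.
    by rewrite -addrA lerD2l -lerBrDr ltW.
  rewrite /log_pow_seq -/(f m%:R) (frac_part_nat fk) lerBrDl ltrBlDl f1/=.
  by rewrite addrA.
rewrite mem_iota m0/= add1n ltnS -(ler_nat R).
have [[_ _ _ hiN _] _] := ok.
apply: le_trans hiN; apply: (le_trans (ltW n2)).
rewrite (ler_stretch alpha A_gt1);
  [|by rewrite -addrA ltr_wpDr// addr_ge0|by rewrite ltr0n (leq_ltn_trans _ kh)].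
apply: (@le_trans _ _ k.+1%:R); last by rewrite ler_nat.
by rewrite -natr1 -addrA lerD2l -lerBrDr ltW.
Qed.

(** The integers of the discarded initial range and of the last, incomplete turn. *)
Definition uncovered N n : bool := (n%:R <= g (first_turn N)%:R) || (g (last_turn N)%:R <= n%:R).

(** Now the model intervals are longer, so a covered term in the window is seen as a hit. An
    uncovered term can fill the window unseen, but only for starting points in an interval of length
    s/N; the sum counts these. *)
Lemma no_hit_le_void e N s p : regular_turns A alpha e N -> 0 <= s / N%:R <= 1 -> (0 < N)%N ->
  (p < N ^ 2)%N ->
  \prod_(k <- index_iota (first_turn N) (last_turn N)) (1 - (turn_hit (expR (2 * e)) s N k p)%:R) <=
  (void_at x N s (grid_point N p))%:R +
  \sum_(n <- iota 1 N) (uncovered N n)%:R * (x n - s / N%:R <= grid_point N p <= x n)%R%:R :> R.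
Proof.
move=> ok d01 N0 pP; set t := grid_point N p; set d := s / N%:R in d01 *.
have Pp : 0 < (N ^ 2)%:R :> R by rewrite ltr0n expn_gt0 N0.
have t01 : 0 <= t < 1.
  by rewrite /t /grid_point divr_ge0//= ltr_pdivrMr// mul1r ltr_nat.
have /andP[t0 t1] := t01; have /andP[d0 d1] := d01.
have fac k : 0 <= 1 - (turn_hit (expR (2 * e)) s N k p)%:R <= (1 : R).
  by case: turn_hit; rewrite ?subrr ?subr0 ?lexx ?ler01.
have prod1 : \prod_(k <- index_iota (first_turn N) (last_turn N))
  (1 - (turn_hit (expR (2 * e)) s N k p)%:R) <= 1 :> R.
  by apply: prodr_ile1.
have sum0 : 0 <= \sum_(n <- iota 1 N) (uncovered N n)%:R * (x n - d <= t <= x n)%R%:R :> R.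
  by apply: sumr_ge0 => n _; rewrite mulr_ge0.
case: (boolP (void_at x N s t)) => [_|]; first by rewrite (le_trans prod1)// lerDl.
rewrite negbK add0r => /hasP[n nN /andP[tx xt]].
rewrite -/d in xt.
have [un|] := boolP (uncovered N n).
  apply: (le_trans prod1).
  rewrite (bigD1_seq n) ?iota_uniq//= un mul1r (_ : x n - d <= t <= x n).
    by rewrite lerDl; apply: sumr_ge0 => i _; rewrite mulr_ge0.
  by apply/andP; split; lra.
rewrite negb_or -!ltNge => /andP[n1 n2].
suff [k kin ->] : exists2 k, k \in index_iota (first_turn N) (last_turn N) &
  \prod_(k <- index_iota (first_turn N) (last_turn N))
     (1 - (turn_hit (expR (2 * e)) s N k p)%:R) = 0 :> R by [].
have n0 : (0 < n)%N by rewrite -(ltr0n R); apply: lt_trans n1; exact: expR_gt0.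
have lohi : (first_turn N)%:R <= (last_turn N)%:R :> R by rewrite ler_nat; have [[/ltnW]] := ok.
have lo0 : 0 < (first_turn N)%:R :> R by rewrite ltr0n.
have /andP[f1 f2] : (first_turn N)%:R <= f n%:R < (last_turn N)%:R.
  by apply: lpow_itv => //; rewrite (ltW n1) n2.
have fn0 : 0 <= f n%:R by apply: le_trans f1.
(* The turn to which the integer [n] belongs. *)
pose k := Num.truncn (f n%:R).
have /andP[k1 k2] := truncn_itv fn0; rewrite -/k in k1 k2.
have lk : (first_turn N <= k)%N.
  by rewrite -ltnS -(ltr_nat R); exact: le_lt_trans k2.
have kh : (k < last_turn N)%N by rewrite -(ltr_nat R); exact: le_lt_trans f2.
have kin : k \in index_iota (first_turn N) (last_turn N) by rewrite mem_index_iota lk kh.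
exists k => //; rewrite (bigD1_seq k) ?iota_uniq//=.
suff -> : turn_hit (expR (2 * e)) s N k p by rewrite subrr mul0r.
have k0 : 0 < k%:R :> R by rewrite ltr0n (leq_trans _ lk).
have [_ inc] := stretch_increment ok lk (introT andP (conj t0 (ltW t1))) d01.
have xE : x n = f n%:R - k%:R.
  by rewrite /log_pow_seq -/(f n%:R) (@frac_part_nat _ k)// natr1 k1.
have N1 : 1 < n%:R :> R.
  by apply: lt_trans n1; rewrite stretchE// -expR0 ltr_expR; exact: expR_gt0.
have gfn := lpowK A_gt1 alpha_gt0 N1.
have fp := lpow_gt0 A alpha_gt0 N1.
rewrite xE in tx xt.
have kt0 : 0 < k%:R + t by rewrite ltr_wpDr.
have ktd0 : 0 < k%:R + t + d by rewrite ltr_wpDr.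
have h1 : g (k%:R + t) <= n%:R.
  by rewrite -gfn (ler_stretch alpha A_gt1 kt0 fp) -lerBrDl.
have h2 : n%:R < g (k%:R + t + d).
  by rewrite -gfn (ltr_stretch alpha A_gt1 fp ktd0) -addrA -ltrBlDl.
apply/asboolP; exists n%:Z; rewrite -pmulrn -/t -/d subr_ge0 h1 ltrBlDl.
by apply: (lt_le_trans h2); rewrite -lerBlDl.
Qed.

End VoidLimit.

Section VoidLimit.
Context {R : realType}.
Variables (A alpha : R).
Hypotheses (A_gt1 : 1 < A) (alpha_gt0 : 0 < alpha).
Local Notation g := (stretch (inv_degree A) (stretch_coef A alpha)).
Local Notation first_turn := (first_turn A alpha).
Local Notation last_turn := (last_turn A alpha).
Local Notation turn_hit := (turn_hit A alpha).
Local Notation x := (log_pow_seq alpha A).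
Implicit Types (N p n k : nat) (e s : R).

Lemma sum_uncovered e N : (0 < N)%N -> regular_turns A alpha e N ->
  \sum_(n <- iota 1 N) (uncovered A alpha N n)%:R <= g (first_turn N)%:R +
    (N%:R - g (last_turn N)%:R) + 2.
Proof.
move=> N0 [[_ _ _ hiN _] _].
have glo : 0 <= g (first_turn N)%:R by exact: expR_ge0.
have h1 := card_between N.+1 glo; have h2 := card_between N.+1 hiN.
apply: (@le_trans _ _ (\sum_(0 <= n < N.+1) (0 <= n%:R <= g (first_turn N)%:R)%R%:R +
    \sum_(0 <= n < N.+1) (g (last_turn N)%:R <= n%:R <= N%:R)%R%:R)); last by lra.
rewrite -big_split/= [leRHS]big_ltn//; apply: ler_wpDl; first by rewrite addr_ge0.
rewrite /index_iota subn1 /= big_seq [leRHS]big_seq; apply: ler_sum => n.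
rewrite mem_iota add1n ltnS => /andP[_ nN].
rewrite /uncovered ler0n/= (ler_nat R n N) nN andbT.
by case: (_ <= g _); case: (g _ <= _); rewrite /= ?addr0 ?add0r// lerDr.
Qed.

Lemma scaled_mass_bounds (tau q iL G : R) : 0 < tau <= 1 -> 0 <= iL -> 0 < q ->
  q * (1 + tau) = 1 -> q - (1 + tau) * iL <= G <= 1 ->
  `|q * G - 1| <= 2 * tau + iL /\ `|(1 + tau) * G - 1| <= tau + 4 * iL.
Proof.
move=> /andP[tau0 tau1] iL0 q0 qom /andP[G2 G1].
have tt : 0 <= tau * tau by rewrite mulr_ge0// ltW.
have om0 : 0 <= 1 + tau by lra.
have q2 : 1 - tau <= q by nra.
have q1 : q <= 1 by nra.
split.
  have b1 : q * G <= 1 by rewrite -[leRHS]mul1r; nra.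
  have b2 : q * (q - (1 + tau) * iL) <= q * G by rewrite ler_wpM2l// ltW.
  have b3 : q * (q - (1 + tau) * iL) = q * q - iL by rewrite mulrBr mulrA qom mul1r.
  have b4 : (1 - tau) * (1 - tau) <= q * q by apply: ler_pM => //; lra.
  by rewrite ler_norml; apply/andP; split; lra.
have b1 : (1 + tau) * G <= 1 + tau by rewrite -[leRHS]mulr1 ler_wpM2l.
have b2 : (1 + tau) * (q - (1 + tau) * iL) <= (1 + tau) * G by rewrite ler_wpM2l.
have b3 : (1 + tau) * (q - (1 + tau) * iL) = 1 - (1 + tau) * (1 + tau) * iL.
  by rewrite mulrBr [(1 + tau) * q]mulrC qom mulrA.
have b4 : (1 + tau) * (1 + tau) * iL <= 4 * iL by rewrite ler_wpM2r//; nra.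
by rewrite ler_norml; apply/andP; split; lra.
Qed.

Lemma squeeze_bounds (eta V Mm Mp Em Ep E dn up : R) :
  `|Em - E| <= eta / 4 -> `|Ep - E| <= eta / 4 ->
  `|Mm - Em| <= eta / 4 -> `|Mp - Ep| <= eta / 4 ->
  V <= Mm + up -> Mp <= V + dn -> up <= eta / 4 -> dn <= eta / 4 ->
  `|E - V| <= eta.
Proof.
rewrite !ler_norml => /andP[? ?] /andP[? ?] /andP[? ?] /andP[? ?] ? ? ? ?.
by apply/andP; split; lra.
Qed.

Lemma void_limit s : 0 < s -> void_freq x s N @[N --> \oo] --> expR (- s).
Proof.
move=> s0; apply/cvgrPdist_le => eta eta0.
(* The extra 1 absorbs the grid rounding: s/N + 1/N^2 <= sg/N. *)
pose sg := s + 1; have sg0 : 0 < sg by rewrite addr_gt0.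
pose tau := Num.min 1 (eta / (16 * sg)).
have tau0 : 0 < tau by rewrite lt_min ltr01 divr_gt0// mulr_gt0.
have tau1 : tau <= 1 by rewrite ge_min lexx.
have tau2 : tau * sg <= eta / 16.
  have : tau <= eta / (16 * sg) by rewrite ge_min lexx orbT.
  by rewrite ler_pdivlMr ?mulr_gt0//; lra.
(* Makes the distortion factor expR (2 e) equal to 1 + tau. *)
pose e := ln (1 + tau) / 2.
have om : expR (2 * e) = 1 + tau.
  by rewrite /e mulrC divfK ?pnatr_eq0// lnK ?posrE// addr_gt0.
have e0 : 0 < e by rewrite divr_gt0// ln_gt0// ltrDl.
have om0 : 0 < 1 + tau by rewrite addr_gt0.
have omi0 : 0 < (1 + tau)^-1 by rewrite invr_gt0.
have et4 : 0 < eta / 4 by rewrite divr_gt0.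
near=> N.
have N0 : (0 < N)%N by near: N; exact: nbhs_infty_gt.
have Np : 0 < N%:R :> R by rewrite ltr0n.
have P0 : (0 < N ^ 2)%N by rewrite expn_gt0 N0.
have NL : 32 * sg / eta + 1 <= ln N%:R :> R by near: N; exact: near_ln_ge.
have NN : 32 * sg / eta + 1 + s <= N%:R :> R by near: N; exact: nbhs_infty_ger.
have c0 : 0 <= 32 * sg / eta by rewrite divr_ge0 ?mulr_ge0 ?(ltW sg0) ?(ltW eta0).
have Lp : 0 < ln N%:R :> R by lra.
have sgL : sg / ln N%:R <= eta / 32.
  have : 32 * sg / eta <= ln N%:R by lra.
  by rewrite !ler_pdivrMr//; lra.
have sgN : sg / N%:R <= eta / 32.
  have : 32 * sg / eta <= N%:R by lra.
  by rewrite !ler_pdivrMr//; lra.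
have d01 : 0 <= s / N%:R <= 1.
  by rewrite divr_ge0 ?(ltW s0)//= ler_pdivrMr// mul1r; lra.
have dP : s / N%:R + (N ^ 2)%:R^-1 <= sg / N%:R.
  rewrite /sg mulrDl lerD2l mul1r lef_pV2 ?posrE ?ltr0n// ler_nat.
  by rewrite -{1}(expn1 N) leq_pexp2l.
pose iL := (ln N%:R : R)^-1; pose q := (1 + tau)^-1.
have iL0 : 0 < iL by rewrite invr_gt0.
have q0 : 0 < q := omi0.
have qom : q * (1 + tau) = 1 by rewrite mulVf// gt_eqF.
have q2 : 1 - tau <= q by have := mulr_ge0 (ltW tau0) (ltW tau0); nra.
have sLe : s * iL <= eta / 32 by apply: le_trans sgL; rewrite ler_wpM2r ?(ltW iL0)// /sg lerDl.
have ste : tau * s <= eta / 16 by apply: le_trans tau2; rewrite ler_wpM2l ?(ltW tau0)// /sg lerDl.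
have small_up : sg / N%:R <= eta / 4 by lra.
have small_dn : (2 * iL + tau + 2 / N%:R) * sg <= eta / 4.
  have -> : (2 * iL + tau + 2 / N%:R) * sg = 2 * (sg / ln N%:R) + tau * sg + 2 * (sg / N%:R).
    by rewrite /iL; ring.
  lra.
have r1 : (2 * tau + iL) * s <= eta / 4 by lra.
have r2 : (tau + 4 * iL) * s <= eta / 4 by lra.
have ok : regular_turns A alpha e N by near: N; exact: regular_turns_near.
have [[lohi glo ghi hiN _] _] := ok; rewrite om in glo ghi.
pose G := (g (last_turn N)%:R - g (first_turn N)%:R) / N%:R.
have lo0 : 0 < (first_turn N)%:R :> R by rewrite ltr0n.
have hi0 : 0 < (last_turn N)%:R :> R by rewrite ltr0n (leq_ltn_trans _ lohi).
have glolt : g (first_turn N)%:R <= g (last_turn N)%:R.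
  by rewrite (ler_stretch alpha A_gt1 lo0 hi0) ler_nat ltnW.
have g0 : 0 <= g (first_turn N)%:R by exact: expR_ge0.
have ghi' : q * N%:R <= g (last_turn N)%:R by rewrite ler_pdivrMl.
have G0 : 0 <= G by rewrite divr_ge0 ?subr_ge0// ltW.
have G1 : G <= 1.
  by rewrite ler_pdivrMr// mul1r; apply: le_trans hiN; rewrite gerBl.
have G2 : q - (1 + tau) * iL <= G.
  by rewrite /G ler_pdivlMr// mulrBl lerB// -mulrA (mulrC iL).
have [a1 a2] := scaled_mass_bounds (introT andP (conj tau0 tau1)) (ltW iL0) q0 qom
  (introT andP (conj G2 G1)).
have near_s (w del : R) : 0 <= w -> `|w * G - 1| <= del -> del * s <= eta / 4 ->
    `|expR (- (w * (s / N%:R) * (g (last_turn N)%:R - g (first_turn N)%:R))) - expR (- s)| <=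
      eta / 4.
  move=> w0 wG wdel.
  have -> : w * (s / N%:R) * (g (last_turn N)%:R - g (first_turn N)%:R) = w * s * G.
    by rewrite /G; ring.
  apply: le_trans (expR_N_lipschitz _ (ltW s0)) _; first exact: mulr_ge0 (mulr_ge0 w0 (ltW s0)) G0.
  apply: le_trans wdel.
  by rewrite mulrAC -{2}(mul1r s) -mulrBl normrM (gtr0_norm s0) ler_wpM2r ?(ltW s0).
have n1 := near_s _ _ (ltW q0) a1 r1; have n2 := near_s _ _ (ltW om0) a2 r2.
have up : void_freq x s N <= grid_mean (N ^ 2)
  (fun p => \prod_(k <- index_iota (first_turn N) (last_turn N))
      (1 - (turn_hit q s N k p)%:R)) + sg / N%:R.
  rewrite /q -om.
  apply: le_trans (grid_mean_le (fun p pP => void_le_no_hit A_gt1 alpha_gt0 ok d01 N0 pP)) _.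
  rewrite grid_meanD lerD2l; apply: le_trans dP.
  apply: le_trans (grid_between N0 _) _; first by rewrite gerBl; case/andP: d01.
  by rewrite opprB addrCA subrr addr0.
have low : grid_mean (N ^ 2) (fun p => \prod_(k <- index_iota (first_turn N) (last_turn N))
      (1 - (turn_hit (1 + tau) s N k p)%:R)) <=
    void_freq x s N + (2 * iL + tau + 2 / N%:R) * sg.
  rewrite -{1}om.
  apply: le_trans (grid_mean_le (fun p pP => no_hit_le_void A_gt1 alpha_gt0 ok d01 N0 pP)) _.
  rewrite grid_meanD lerD2l.
  rewrite /grid_mean exchange_big big_distrl/=.
  apply: (@le_trans _ _ (\sum_(n <- iota 1 N) (uncovered A alpha N n)%:R * (sg / N%:R))).
    apply: ler_sum => n _; rewrite -big_distrr/= -mulrA ler_wpM2l//.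
    apply: le_trans dP; have h : x n - s / N%:R <= x n by rewrite gerBl; case/andP: d01.
    have := grid_between N0 h; rewrite /grid_mean => /le_trans; apply.
    by rewrite opprB addrCA subrr addr0.
  rewrite -big_distrl/=.
  have sN0 : 0 <= sg / N%:R by rewrite divr_ge0// ltW.
  apply: le_trans (ler_wpM2r sN0 (sum_uncovered N0 ok)) _.
  have b1 : g (first_turn N)%:R <= 2 * iL * N%:R.
    apply: (le_trans glo); rewrite -/iL (mulrC _ iL) mulrA ler_wpM2r ?(ltW Np)//.
    by rewrite ler_wpM2r ?(ltW iL0)// -[leRHS]/(1 + 1) lerD2l.
  have b2 : N%:R - g (last_turn N)%:R <= tau * N%:R.
    rewrite lerBlDr -lerBlDl; apply: le_trans ghi'.
    by rewrite -{1}[N%:R]mul1r -mulrBl ler_wpM2r ?(ltW Np).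
  apply: (@le_trans _ _ ((2 * iL * N%:R + tau * N%:R + 2) * (sg / N%:R))).
    by rewrite ler_wpM2r// lerD2r lerD.
  rewrite le_eqVlt; apply/orP; left; apply/eqP; field; by rewrite gt_eqF.
have mm : `|grid_mean (N ^ 2) (fun p => \prod_(k <- index_iota (first_turn N) (last_turn N))
      (1 - (turn_hit (1 + tau)^-1 s N k p)%:R)) -
    expR (- ((1 + tau)^-1 * (s / N%:R) * (g (last_turn N)%:R - g (first_turn N)%:R)))| <= eta / 4.
  by near: N; exact: void_model.
have mp : `|grid_mean (N ^ 2) (fun p => \prod_(k <- index_iota (first_turn N) (last_turn N))
      (1 - (turn_hit (1 + tau) s N k p)%:R)) -
    expR (- ((1 + tau) * (s / N%:R) * (g (last_turn N)%:R - g (first_turn N)%:R)))| <= eta / 4.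
  by near: N; exact: void_model.
exact: squeeze_bounds n1 n2 mm mp up low small_up small_dn.
Unshelve. all: by end_near. Qed.

End VoidLimit.

(** * From empty windows to gaps *)

Section Gaps.
Context {R : realType}.
Implicit Types (M N P p n i j : nat) (s t u v y e : R).

Lemma card_between_ge P u v : 0 <= u -> v < P%:R ->
  v - u - 1 <= \sum_(0 <= p < P) (u < p%:R <= v)%R%:R.
Proof.
move=> u0 vP; suff : Num.min (P%:R - 1) (v - 1) - u <= \sum_(0 <= p < P) (u < p%:R <= v)%R%:R.
  by rewrite min_r; lra.
elim: P {vP} => [|P IH].
  by rewrite big_geq// subr_le0 ge_min; apply/orP; left; lra.
rewrite big_nat_recr//=; move: IH; set S := \sum_(0 <= _ < _) _.
have S0 : 0 <= S by rewrite /S sumr_ge0.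
have nat1 : P.+1%:R = P%:R + 1 :> R by rewrite -natr1.
rewrite nat1 !lerBlDr !ge_min => /orP IH; apply/orP.
have [uP|Pu] := ltP u P%:R; have [Pv|vP] := leP P%:R v; rewrite /= ?mulr1n ?mulr0n ?addr0.
- by case: IH => ?; [left|right]; lra.
- by case: IH => ?; right; lra.
- by left; lra.
- by left; lra.
Qed.

Lemma grid_between_ge N u v : (0 < N)%N -> 0 <= u -> v < 1 ->
  (v - u) - (N ^ 2)%:R^-1 <= grid_mean (N ^ 2) (fun p => (u < grid_point N p <= v)%R%:R).
Proof.
move=> N0 u0 v1; have Pp : 0 < (N ^ 2)%:R :> R by rewrite ltr0n expn_gt0 N0.
rewrite /grid_mean ler_pdivlMr// mulrBl mulVf ?gt_eqF// mulrBl.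
have := @card_between_ge (N ^ 2) (u * (N ^ 2)%:R) (v * (N ^ 2)%:R).
rewrite mulr_ge0 ?(ltW Pp)// => /(_ isT); rewrite -[ltRHS]mul1r ltr_pM2r// => /(_ v1).
move=> /le_trans; apply.
by apply: ler_sum => p _; rewrite /grid_point ltr_pdivlMr// ler_pdivrMr.
Qed.

Lemma dist_int_le y : dist_int y <= `|y|.
Proof.
apply: ge_inf; first by exists 0 => z [m _ <-].
by exists 0 => //; rewrite subr0.
Qed.

Lemma dist_int_half y : `|y| <= 1 / 2 -> dist_int y = `|y|.
Proof.
move=> hy; apply/le_anti/andP; split; first exact: dist_int_le.
apply: lb_le_inf; first by exists `|y - 0%:~R|, 0.
move=> z [m _ <-]; have [->|m0] := eqVneq m 0; first by rewrite subr0.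
have : 1 <= `|m%:~R| :> R by rewrite -intr_norm -natr_absz ler1n absz_gt0.
have := lerB_dist (m%:~R : R) y; rewrite distrC; lra.
Qed.

Section Fixed.
Variables (x : nat -> R) (M : nat).
Hypothesis x01 : forall n, 0 <= x n < 1.
(** The sorted terms are [U 0], ..., [U M], with [M] gaps between neighbours besides the gap that
    wraps around. *)
Let N := M.+1.
Let U := nth 0 (sorted_terms x N).

Lemma size_sorted_terms : size (sorted_terms x N) = N.
Proof. by rewrite size_sort size_map size_iota. Qed.

Lemma sorted_terms_le i j : (i <= j < N)%N -> U i <= U j.
Proof.
move=> /andP[ij jN]; apply: (sorted_leq_nth le_trans le_refl) => //.
- by apply: sort_sorted; exact: le_total.
- by rewrite inE size_sorted_terms (leq_ltn_trans ij).
- by rewrite inE size_sorted_terms.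
Qed.

Lemma sorted_terms01 i : (i < N)%N -> 0 <= U i < 1.
Proof.
move=> iN; have : U i \in sorted_terms x N by rewrite mem_nth// size_sorted_terms.
by rewrite mem_sort => /mapP[n _ ->].
Qed.

Lemma void_atE s y : reflect (exists2 i, (i < N)%N & y <= U i < y + s / N%:R) (~~ void_at x N s y).
Proof.
rewrite /void_at negbK.
have -> : has (fun n => y <= x n < y + s / N%:R) (iota 1 N) =
    has (fun z => y <= z < y + s / N%:R) (sorted_terms x N).
  by rewrite /sorted_terms (perm_has _ (permEl (perm_sort _ _))) has_map.
by apply: (iffP (has_nthP 0)) => -[k]; rewrite ?size_sorted_terms => kN h; exists k;
  rewrite ?size_sorted_terms.
Qed.

(** The wrapping gap is left out: a single gap does not affect the limiting proportion. *)
Definition long_gaps s : R := \sum_(0 <= i < M) (s / N%:R <= U i.+1 - U i)%R%:R.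

(* The window at y is empty for s but not for s + t exactly when the next term
   above y is at a distance between s/N and (s + t)/N. *)
Lemma long_gaps_le_void s t y : 0 < s -> 0 <= t ->
  \sum_(0 <= i < M) ((s + t) / N%:R <= U i.+1 - U i)%R%:R *
    (U i.+1 - (s + t) / N%:R < y <= U i.+1 - s / N%:R)%R%:R <=
  (void_at x N s y)%:R - (void_at x N (s + t) y)%:R :> R.
Proof.
move=> s0 t0; have Np : 0 < N%:R :> R by rewrite ltr0n.
have sN : 0 < s / N%:R by rewrite divr_gt0.
have stN : s / N%:R <= (s + t) / N%:R by rewrite ler_pM2r ?invr_gt0// lerDl.
have mono : void_at x N (s + t) y -> void_at x N s y.
  apply: contraLR => /void_atE[i iN /andP[h1 h2]]; apply/void_atE; exists i => //.
  by rewrite h1 (lt_le_trans h2)// lerD2l.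
(* At most one summand is nonzero: the intervals for y lie in the distinct gaps below the respective
   [U i.+1]. *)
have [[i iM /andP[gi /andP[yi1 yi2]]]|none] := pselect (exists2 i, (i < M)%N &
    ((s + t) / N%:R <= U i.+1 - U i) && (U i.+1 - (s + t) / N%:R < y <= U i.+1 - s / N%:R));
      last first.
  rewrite big_nat big1 ?subr_ge0; last first.
    move=> i /andP[_ iM]; case: (boolP (_ <= _)) => [h1|_]; last by rewrite mul0r.
    case: (boolP (_ < _ <= _)) => [h2|_]; last by rewrite mulr0.
    by exfalso; apply: none; exists i => //; rewrite h1 h2.
  by case: (void_at x N (s + t) y) mono => [->//|_]; case: void_at.
have nv : void_at x N (s + t) y = false.
  apply/negbTE/void_atE; exists i.+1 => //; apply/andP; split; lra.
have vs : void_at x N s y.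
  have [//|/void_atE[j jN /andP[h1 h2]]] := boolP (void_at x N s y); exfalso.
  have [ji|ij] := leqP j i.
    have : U j <= U i by apply: sorted_terms_le; rewrite ji ltnW// ltnS.
    lra.
  have : U i.+1 <= U j by apply: sorted_terms_le; rewrite ij.
  lra.
rewrite nv vs subr0 (bigD1_seq i) ?iota_uniq ?mem_index_iota//=.
rewrite [X in _ + X]big_seq_cond big1 ?addr0.
  by rewrite gi yi1 yi2 mulr1.
move=> j; rewrite mem_index_iota => /andP[jM ne].
case: (boolP (_ <= _)) => [h1|_]; last by rewrite mul0r.
case: (boolP (_ < _ <= _)) => [/andP[h2 h3]|_]; last by rewrite mulr0.
exfalso; move: ne; rewrite neq_ltn => /orP[ji|ij].
  have : U j.+1 <= U i by apply: sorted_terms_le; rewrite ji ltnW// ltnS.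
  lra.
have : U i.+1 <= U j by apply: sorted_terms_le; rewrite ij ltnW// ltnS; case/andP: jM.
lra.
Qed.

(** If only the longer window is occupied, the first term at or above y lies at distance between s/N
    and (s + t)/N; the gap below it contains y and is therefore long. The separate summand is the
    case in which this term is the smallest one. *)
Lemma void_le_long_gaps s t y : 0 < s -> 0 <= t ->
  (void_at x N s y)%:R - (void_at x N (s + t) y)%:R <=
  (U 0%N - (s + t) / N%:R <= y <= U 0%N - s / N%:R)%R%:R +
  \sum_(0 <= i < M) (s / N%:R <= U i.+1 - U i)%R%:R *
    (U i.+1 - (s + t) / N%:R <= y <= U i.+1 - s / N%:R)%R%:R :> R.
Proof.
move=> s0 t0; have Np : 0 < N%:R :> R by rewrite ltr0n.
set S := \sum_(0 <= i < M) _.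
have S0 : 0 <= S by rewrite /S sumr_ge0// => i _; rewrite mulr_ge0.
have T0 : 0 <= (U 0%N - (s + t) / N%:R <= y <= U 0%N - s / N%:R)%R%:R :> R by [].
have [vst|nvst] := boolP (void_at x N (s + t) y).
  by apply: le_trans (addr_ge0 T0 S0); rewrite subr_le0; case: void_at.
have [vs|nvs] := boolP (void_at x N s y); last by rewrite subrr addr_ge0.
rewrite subr0; have [i0 i0N /andP[i01 i02]] := void_atE _ _ nvst.
have ex : exists j, (j < N)%N && (y <= U j) by exists i0; rewrite i0N i01.
case: (ex_minnP ex) => j /andP[jN yj] jmin.
have j1 : y + s / N%:R <= U j.
  rewrite leNgt; apply: contraL vs => h; apply/void_atE; exists j => //.
  by rewrite yj h.
have j2 : U j < y + (s + t) / N%:R.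
  apply: le_lt_trans i02; apply: sorted_terms_le; rewrite i0N andbT.
  by apply: jmin; rewrite i0N i01.
case: j => [|j] in jN yj jmin j1 j2 *.
  rewrite (_ : (_ <= y <= _) = true) ?lerDl//.
  by apply/andP; split; lra.
have jy : U j < y.
  rewrite ltNge; apply/negP => h.
  by have := jmin j; rewrite h (ltnW jN) ltnn => /(_ isT).
rewrite (le_trans _ (ler_wpDl T0 (lexx _)))// /S.
rewrite (bigD1_seq j) ?iota_uniq ?mem_index_iota//=.
have -> : s / N%:R <= U j.+1 - U j by lra.
have -> : U j.+1 - (s + t) / N%:R <= y <= U j.+1 - s / N%:R by apply/andP; split; lra.
by rewrite mulr1 lerDl sumr_ge0// => i _; rewrite mulr_ge0.
Qed.

Lemma long_gaps_ge0 s : 0 <= long_gaps s.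
Proof. by rewrite sumr_ge0. Qed.

(** Averaging over y: each gap counted on the left contributes t/N, up to the grid rounding
    1/N^2. *)
Lemma long_gaps_upper s t : 0 < s -> 0 <= t ->
  long_gaps (s + t) / N%:R * (t - N%:R^-1) <= void_freq x s N - void_freq x (s + t) N.
Proof.
move=> s0 t0; have Np : 0 < N%:R :> R by rewrite ltr0n.
rewrite /void_freq -grid_meanB.
apply: le_trans (grid_mean_le (fun p _ => long_gaps_le_void (grid_point N p) s0 t0)).
rewrite grid_mean_big /long_gaps -mulrA big_distrl/= big_nat [leRHS]big_nat.
apply: ler_sum => i /andP[_ iM].
case: (boolP ((s + t) / N%:R <= U i.+1 - U i)) => [gi|_]; last by rewrite !mul0r.
rewrite !mul1r.
have /andP[a0 _] : 0 <= U i < 1 by apply: sorted_terms01; rewrite ltnW// ltnS.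
have /andP[_ b1] : 0 <= U i.+1 < 1 by apply: sorted_terms01.
have sN : 0 < s / N%:R by rewrite divr_gt0.
have := @grid_between_ge N (U i.+1 - (s + t) / N%:R) (U i.+1 - s / N%:R) isT.
move=> h; apply: le_trans (h _ _); [|lra|lra].
rewrite le_eqVlt; apply/orP; left; apply/eqP; rewrite natrX; field.
by rewrite gt_eqF.
Qed.

Lemma long_gaps_lower s t : 0 < s -> 0 <= t ->
  void_freq x s N - void_freq x (s + t) N <=
  (long_gaps s + 1) / N%:R * (t + N%:R^-1).
Proof.
move=> s0 t0; have Np : 0 < N%:R :> R by rewrite ltr0n.
rewrite /void_freq -grid_meanB.
apply: le_trans (grid_mean_le (fun p _ => void_le_long_gaps (grid_point N p) s0 t0)) _.
have stN : s / N%:R <= (s + t) / N%:R by rewrite ler_pM2r ?invr_gt0// lerDl.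
have one i : grid_mean (N ^ 2) (fun p =>
    (U i - (s + t) / N%:R <= grid_point N p <= U i - s / N%:R)%R%:R) <= (t + N%:R^-1) / N%:R.
  apply: le_trans (grid_between _ _) _ => //; first by rewrite lerB.
  rewrite le_eqVlt; apply/orP; left; apply/eqP; rewrite natrX; field.
  by rewrite gt_eqF.
rewrite grid_meanD grid_mean_big mulrAC -mulrA [leRHS]mulrDl mul1r addrC lerD//.
rewrite /long_gaps big_distrl/=; apply: ler_sum => i _.
by rewrite ler_wpM2l.
Qed.

(** The wrapping gap accounts for 1. Distance to the nearest integer and length of the gap agree up
    to 1/2, and the gaps exceeding 1/2 are paid for by the total length of the gaps, at a cost of at
    most 2. *)
Lemma gap_count_long_gaps s : 0 < s ->
  `|(gap_count x N s)%:R - (N%:R - long_gaps s)| <= 3.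
Proof.
move=> s0; have Np : 0 < N%:R :> R by rewrite ltr0n.
pose F n : R := (N%:R * dist_int (ordered_term x N n - ordered_term x N n.+1) < s)%R%:R.
have F01 n : 0 <= F n <= 1 by rewrite /F; case: (_ < _); rewrite ?lexx ?ler01.
have -> : (gap_count x N s)%:R = \sum_(0 <= i < M) F i.+1 + F N.
  have eF n : (if N%:R * dist_int (ordered_term x N n - ordered_term x N n.+1) < s
      then 1%:R else 0) = F n by rewrite /F; case: (_ < s).
  rewrite /gap_count -sum1_count natr_sum big_mkcond (eq_bigr _ (fun n _ => eF n)).
  rewrite (_ : iota 1 N = index_iota 1 N.+1); last by rewrite /index_iota subn1.
  by rewrite big_nat_recr//= big_add1.
pose big i : R := (1 / 2 < U i.+1 - U i)%R%:R.
have Fi i : (i < M)%N -> `|F i.+1 - (1 - (s / N%:R <= U i.+1 - U i)%R%:R)| <= big i.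
  move=> iM; have gap0 : 0 <= U i.+1 - U i.
    by rewrite subr_ge0; apply: sorted_terms_le; rewrite leqnSn.
  have -> : F i.+1 = (N%:R * dist_int (U i - U i.+1) < s)%R%:R.
    have e1 : (i.+1 == N.+1) = false by rewrite eqSS ltn_eqF// ltnW.
    have e2 : (i.+2 == N.+1) = false by rewrite !eqSS ltn_eqF.
    by rewrite /F /ordered_term e1 e2.
  have dU : `|U i - U i.+1| = U i.+1 - U i by rewrite distrC ger0_norm.
  rewrite ler_pdivrMr// (mulrC _ N%:R) /big.
  have [h|h] := ltP (1 / 2) (U i.+1 - U i).
    case: (N%:R * dist_int (U i - U i.+1) < s); case: (s <= N%:R * (U i.+1 - U i));
      by rewrite /= ler_norml; apply/andP; split; lra.
  rewrite dist_int_half dU//; case: ltP => _; rewrite /= ler_norml; apply/andP; split; lra.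
have sum_big : \sum_(0 <= i < M) big i <= 2.
  apply: (@le_trans _ _ (\sum_(0 <= i < M) (2 * (U i.+1 - U i)))).
    rewrite big_nat [leRHS]big_nat; apply: ler_sum => i /andP[_ iM]; rewrite /big.
    have gap0 : 0 <= U i.+1 - U i.
      by rewrite subr_ge0; apply: sorted_terms_le; rewrite leqnSn.
    by case: ltP => h; rewrite ?mulr1n ?mulr0n; lra.
  rewrite -big_distrr/= telescope_sumr//.
  have /andP[_ u1] := sorted_terms01 (ltnSn M); have /andP[u0 _] := sorted_terms01 (ltn0Sn M).
  by rewrite -/U in u0 u1; lra.
have NE : N%:R = \sum_(0 <= i < M) 1 + 1 :> R by rewrite sumr_const_nat subn0 natr1.
rewrite NE /long_gaps.
set W := \sum_(0 <= i < M) (s / N%:R <= _)%R%:R.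
have -> : \sum_(0 <= i < M) F i.+1 + F N - (\sum_(0 <= i < M) 1 + 1 - W) =
    (\sum_(0 <= i < M) F i.+1 - (\sum_(0 <= i < M) 1 - W)) + (F N - 1) by ring.
rewrite /W -!sumrB; apply: le_trans (ler_normD _ _) _.
rewrite (_ : 3 = 2 + 1 :> R); last by ring.
apply: lerD.
  apply: le_trans (ler_norm_sum _ _ _) _; apply: le_trans sum_big.
  by rewrite big_nat [leRHS]big_nat; apply: ler_sum => i /andP[_ iM]; exact: Fi.
by rewrite distrC ger0_norm; have /andP[? ?] := F01 N; lra.
Qed.

End Fixed.
End Gaps.

(** * Difference quotients of the void probability *)

Section Final.
Context {R : realType}.
Implicit Types (s t : R).

(** [C] is the proportion of long gaps and [V0], [V1], [V2] are the void frequencies at s - t, s and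
    s + t. The two difference quotients enclose [C], and both are close to E = exp (-s), minus the
    derivative of exp (-s). *)
Lemma long_gaps_sandwich (E C iN t dl eta V0 V1 V2 : R) :
  0 < t -> t <= 1 / 4 -> t <= eta / 16 -> 0 <= E <= 1 -> 0 <= C <= 1 -> 0 < iN <= 1 ->
  dl <= t * (eta / 16) -> 3 * iN <= t * (eta / 16) ->
  `|V0 - E * expR t| <= dl -> `|V1 - E| <= dl -> `|V2 - E * expR (- t)| <= dl ->
  C * (t - iN) <= V0 - V1 -> V1 - V2 <= (C + iN) * (t + iN) ->
  `|C - E| <= eta / 2.
Proof.
move=> t0 t4 te /andP[E0 E1] /andP[C0 C1] /andP[i0 i1] hdl hiN.
rewrite !ler_norml => /andP[a1 a2] /andP[b1 b2] /andP[c1 c2] up low.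
(* Second-order upper bounds, obtained by inverting 1 + x <= exp x. *)
have ex1 : expR t <= 1 + t * (1 + 2 * t).
  have h1 : expR t * expR (- t) = 1 := expRxMexpNx_1 t.
  have h2 := expR_ge1Dx (- t); have h3 := expR_gt0 t.
  have h4 : expR t * (1 - t) <= 1 by rewrite -[leRHS]h1 ler_wpM2l ?(ltW h3).
  have h5 : 1 <= (1 + t * (1 + 2 * t)) * (1 - t) by nra.
  have t1 : 0 < 1 - t by lra.
  by rewrite -(ler_pM2r t1); exact: le_trans h5.
have ex2 : expR (- t) <= 1 - t + t * t.
  have h1 : expR t * expR (- t) = 1 := expRxMexpNx_1 t.
  have h2 := expR_ge1Dx t; have h3 := expR_gt0 (- t).
  have h4 : (1 + t) * expR (- t) <= 1 by rewrite -[leRHS]h1 ler_wpM2r ?(ltW h3).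
  have h5 : 1 <= (1 - t + t * t) * (1 + t) by have := mulr_gt0 t0 t0; nra.
  have t1 : 0 < 1 + t by lra.
  by rewrite -(ler_pM2r t1) mulrC; exact: le_trans h5.
have u1 : E * expR t <= E * (1 + t * (1 + 2 * t)) by rewrite ler_wpM2l.
have u2 : E * expR (- t) <= E * (1 - t + t * t) by rewrite ler_wpM2l.
have tt : t * t <= t * (eta / 16) by rewrite ler_wpM2l// ltW.
have tt0 : 0 <= t * t by rewrite mulr_ge0// ltW.
have Ett : E * (t * t) <= t * t by rewrite ler_piMl.
have CiN : C * iN <= iN by rewrite ler_piMl// ltW.
have iiN : iN * iN <= iN by rewrite ler_piMl// ltW.
have tiN : t * iN <= iN by rewrite ler_piMl ?(ltW i0)//; lra.
have k1 : C * t <= E * t + t * (eta / 2) by lra.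
have k2 : E * t - t * (eta / 2) <= C * t by lra.
apply/andP; split; rewrite -(ler_pM2l t0); lra.
Qed.

Lemma poissonian_of_void (x : nat -> R) : (forall n, 0 <= x n < 1) ->
  (forall s, 0 < s -> void_freq x s N @[N --> \oo] --> expR (- s)) ->
  poissonian_gaps x.
Proof.
move=> x01 hV s s0; apply/cvgrPdist_le => eta eta0.
(* t <= s/2 keeps s - t positive, and t <= eta/16 controls the second-order terms. The void
   frequencies are then needed up to t * (eta / 16), since their differences are divided by t. *)
pose t := Num.min (s / 2) (Num.min (1 / 4) (eta / 16)).
have t0 : 0 < t by rewrite !lt_min !divr_gt0.
have ts : t <= s / 2 by rewrite ge_min lexx.
have t4 : t <= 1 / 4 by rewrite !ge_min lexx ?orbT.
have te : t <= eta / 16 by rewrite !ge_min lexx ?orbT.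
have st0 : 0 < s - t by lra.
have st1 : 0 < s + t by lra.
have dl0 : 0 < t * (eta / 16) by rewrite mulr_gt0// divr_gt0.
near=> N.
have h0 : `|expR (- (s - t)) - void_freq x (s - t) N| <= t * (eta / 16).
  by near: N; move/cvgrPdist_le: (hV _ st0); apply.
have h1 : `|expR (- s) - void_freq x s N| <= t * (eta / 16).
  by near: N; move/cvgrPdist_le: (hV _ s0); apply.
have h2 : `|expR (- (s + t)) - void_freq x (s + t) N| <= t * (eta / 16).
  by near: N; move/cvgrPdist_le: (hV _ st1); apply.
have N0 : (0 < N)%N by near: N; exact: nbhs_infty_gt.
have NN : 3 / (t * (eta / 16)) <= N%:R by near: N; exact: nbhs_infty_ger.
suff main M : M.+1 = N ->
    `|1 - expR (- s) - (gap_count x M.+1 s)%:R / M.+1%:R| <= eta.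
  by have := main N.-1 (prednK N0); rewrite prednK.
move=> MN; rewrite -MN in NN h0 h1 h2; move: NN h0 h1 h2 => {MN N0}.
move: M => M; set N' := M.+1 => NN h0 h1 h2.
have Np : 0 < N'%:R :> R by rewrite ltr0n.
have N1 : 1 <= N'%:R :> R by rewrite ler1n.
pose iN := (N'%:R : R)^-1.
have iN0 : 0 < iN <= 1 by rewrite invr_gt0 Np invf_le1.
have hiN : 3 * iN <= t * (eta / 16).
  by move: NN; rewrite !ler_pdivrMr// mulrC.
pose C := long_gaps x M s * iN.
have C01 : 0 <= C <= 1.
  rewrite /C mulr_ge0 ?long_gaps_ge0 ?invr_ge0//= ler_pdivrMr// mul1r.
  apply: (@le_trans _ _ (\sum_(0 <= i < M) 1)).
    by apply: ler_sum => i _; case: (s / _ <= _); rewrite ?lexx ?ler01.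
  by rewrite sumr_const_nat subn0 ler_nat.
have E01 : 0 <= expR (- s) <= 1 by rewrite expR_ge0 expR_le1; lra.
have up := long_gaps_upper M x01 st0 (ltW t0); rewrite subrK in up.
have low := long_gaps_lower x M s0 (ltW t0).
have key : `|C - expR (- s)| <= eta / 2.
  apply: (@long_gaps_sandwich (expR (- s)) C iN t (t * (eta / 16)) eta
    (void_freq x (s - t) N') (void_freq x s N') (void_freq x (s + t) N')) => //.
  - by rewrite -expRD distrC (_ : - s + t = - (s - t))//; ring.
  - by rewrite distrC.
  - by rewrite -expRD distrC (_ : - s + - t = - (s + t))//; ring.
  - by move: low; rewrite mulrDl mul1r.
have gc := gap_count_long_gaps M x01 s0.
have gcN : `|(gap_count x N' s)%:R / N'%:R - (1 - C)| <= eta / 16.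
  have -> : (gap_count x N' s)%:R / N'%:R - (1 - C) =
      ((gap_count x N' s)%:R - (N'%:R - long_gaps x M s)) * iN.
    by rewrite /C /iN; field; rewrite gt_eqF.
  rewrite normrM (gtr0_norm (_ : 0 < iN)); last by case/andP: iN0.
  apply: (@le_trans _ _ (3 * iN)); first by rewrite ler_wpM2r//; case/andP: iN0 => /ltW.
  by apply: (le_trans hiN); nra.
have -> : 1 - expR (- s) - (gap_count x N' s)%:R / N'%:R =
  (C - expR (- s)) - ((gap_count x N' s)%:R / N'%:R - (1 - C)) by ring.
by apply: le_trans (ler_normB _ _) _; lra.
Unshelve. all: by end_near. Qed.

End Final.

Theorem theorem1p1 (R : realType) (A alpha : R) (hA : 1 < A)
    (halpha : 0 < alpha) :
  poissonian_gaps (log_pow_seq alpha A).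
Proof.
apply: poissonian_of_void => [n|s s0]; first exact: frac_part_itv.
exact: void_limit.
Qed.
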